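(* Let $K,L$ be étale $\mathbb Q$-algebras and let $R$ and $S$ be non-large cofinite sieves for $K$ and $L$, respectively. Let $(f,A):\mathbb D(K,R)\to\mathbb D(L,S)$ be a morphism of topological dynamical systems. Assume that $A$ is surjective and that the image of $f$ contains a non-empty set. Let $M\subseteq\mathcal O_K$ be a finite set and $\mathcal T$ a non-empty family of non-empty subsets $T\subseteq M$ with $T\in\mathbb X(K,R)$, such that for all $x\in\mathcal O_K$ and $X\in\mathbb X(K,R)$ we have $A(x)\in f(X)$ if and only if $X\cap(x+M)=x+T$ for some $T\in\mathcal T$ (such $M$ and $\mathcal T$ exist). Then: (a) The group homomorphism $A$ is the composition of (the restriction to $\mathcal O_K$ of) a $\mathbb Q$-algebra isomorphism $\tau:K\to L$ and the multiplication map $M_\varepsilon:x\mapsto\varepsilon x$ for some unit $\varepsilon\in\mathcal O_L^\times$. In particular, $K$ is isomorphic to $L$ and $A$ is bijective. (Consequently $A$ extends to a bijection $A=M_\varepsilon\circ\tau:\mathcal O_{K,\mathfrak p}\to\mathcal O_{L,\tau(\mathfrak p)}$ for all primes $\mathfrak p$ of $K$; this notation is used below.) (b) For all primes $\mathfrak p$ of $K$, the set $S_{\tau(\mathfrak p)}\subseteq\mathcal O_{L,\tau(\mathfrak p)}$ is a subset of some translate of $A(R'_{\mathfrak p})\subseteq\mathcal O_{L,\tau(\mathfrak p)}$, where $R'_{\mathfrak p}=\bigcap_{T\in\mathcal T}(-T+R_{\mathfrak p})\subseteq\mathcal O_{K,\mathfrak p}$. (c) If $(f,A)$ is an isomorphism,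 then for all primes $\mathfrak p$ of $K$, the set $S_{\tau(\mathfrak p)}$ is a translate of $A(R_{\mathfrak p})$. (d) If $(f,A)$ is a factor map, then there is a set $T\in\mathcal T$ such that for all but finitely many primes $\mathfrak p$ of $K$, the set $S_{\tau(\mathfrak p)}$ is a translate of $A(-T+R_{\mathfrak p})$.
   Context: An étale $\mathbb Q$-algebra is a cartesian product $K=K_1\times\cdots\times K_r$ ($r\ge1$) of finitely many number fields; $\mathcal O_K=\prod_i\mathcal O_{K_i}$. A prime $\mathfrak p$ of $K$ is a maximal ideal of $\mathcal O_K$; $\mathcal O_{K,\mathfrak p}$ is the $\mathfrak p$-adic completion of $\mathcal O_K$, with Haar measure $\operatorname{meas}$ normalized by $\operatorname{meas}(\mathcal O_{K,\mathfrak p})=1$; elements of $\mathcal O_K$ are viewed in $\mathcal O_{K,\mathfrak p}$. A sieve for $K$ is a collection $R=(R_{\mathfrak p})_{\mathfrak p}$ of compact open subsets $R_{\mathfrak p}\subseteq\mathcal O_{K,\mathfrak p}$, one for each prime $\mathfrak p$ of $K$. It is non-large if $R_{\mathfrak p}\neq\mathcal O_{K,\mathfrak p}$ for all $\mathfrak p$ and for every $\epsilon>0$ there are only finitely many $\mathfrak p$ with $\operatorname{meas}(R_{\mathfrak p})>\epsilon$. It is cofinite if $R_{\mathfrak p}=\emptyset$ for only finitely many $\mathfrak p$. For $T\subseteq\mathcal O_K$, $-T+R_{\mathfrak p}=\{-t+r:t\in T,\ r\in R_{\mathfrak p}\}$. A translate of $B\subseteq\mathcal O_{K,\mathfrak p}$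 is a set $\delta+B$ with $\delta\in\mathcal O_{K,\mathfrak p}$. $\mathbb X(K,R)$ is the family of (admissible) subsets $X\subseteq\mathcal O_K$ such that for each prime $\mathfrak p$ of $K$, $X$ is disjoint from some translate $\delta_{\mathfrak p}+R_{\mathfrak p}$ of $R_{\mathfrak p}$. It is a closed translation-invariant subset of the power set $\mathcal P(\mathcal O_K)\cong\{0,1\}^{\mathcal O_K}$ (product topology), and $\mathbb D(K,R)=(\mathbb X(K,R),\mathcal O_K)$ is the resulting system with the translation action of the additive group $\mathcal O_K$. A topological dynamical system $(\mathbb X,G)$ is a compact space $\mathbb X$ with an action of a group $G$ by homeomorphisms (written additively). A morphism $(f,A):(\mathbb X,G)\to(\mathbb Y,H)$ consists of a group homomorphism $A:G\to H$ and a continuous map $f:\mathbb X\to\mathbb Y$ with $f(g+X)=A(g)+f(X)$ for all $g\in G$, $X\in\mathbb X$. It is a factor map if $A$ and $f$ are both surjective, and an isomorphism if $A$ is a group isomorphism and $f$ a homeomorphism. *)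

(* Defs.v *)
From HB Require Import structures.
From mathcomp Require Import all_boot all_order all_algebra all_field.
From mathcomp Require Import all_classical all_reals all_analysis.

Set Implicit Arguments.
Unset Strict Implicit.
Unset Printing Implicit Defensive.

Import Order.TTheory GRing.Theory Num.Theory.

Local Open Scope classical_set_scope.
Local Open Scope ring_scope.

Definition translate (V : zmodType) (d : V) (B : set V) : set V :=
  [set d + b | b in B].

Definition is_translate (V : zmodType) (B C : set V) : Prop :=
  exists d : V, C = translate d B.

(* the cartesian product of [etale_rank.+1] number fields *)
Record etaleAlg := EtaleAlg {
  etale_rank : nat;
  etale_factor : 'I_etale_rank.+1 -> fieldExtType rat }.

Definition etale_sort (K : etaleAlg) : Type := forall i, @etale_factor K i.
Coercion etale_sort : etaleAlg >-> Sortclass.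

Section EtaleAlgebra.
Variable K : etaleAlg.
Implicit Types (x y z : K) (a b : rat).

HB.instance Definition _ := gen_eqMixin (etale_sort K).
HB.instance Definition _ := gen_choiceMixin (etale_sort K).

Let ext x y : (forall i, x i = y i) -> x = y.
Proof. exact: functional_extensionality_dep. Qed.

Definition etale_zero : K := fun=> 0.
Definition etale_one : K := fun=> 1.
Definition etale_opp x : K := fun i => - x i.
Definition etale_add x y : K := fun i => x i + y i.
Definition etale_mul x y : K := fun i => x i * y i.
Definition etale_scale a x : K := fun i => a *: x i.

Fact etale_addA : associative etale_add.
Proof. by move=> x y z; apply: ext => i; apply: addrA. Qed.
Fact etale_addC : commutative etale_add.
Proof. by move=> x y; apply: ext => i; apply: addrC. Qed.
Fact etale_add0 : left_id etale_zero etale_add.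
Proof. by move=> x; apply: ext => i; apply: add0r. Qed.
Fact etale_addN : left_inverse etale_zero etale_opp etale_add.
Proof. by move=> x; apply: ext => i; apply: addNr. Qed.

HB.instance Definition _ := GRing.isZmodule.Build (etale_sort K)
  etale_addA etale_addC etale_add0 etale_addN.

Fact etale_mulA : associative etale_mul.
Proof. by move=> x y z; apply: ext => i; apply: mulrA. Qed.
Fact etale_mulC : commutative etale_mul.
Proof. by move=> x y; apply: ext => i; apply: mulrC. Qed.
Fact etale_mul1 : left_id etale_one etale_mul.
Proof. by move=> x; apply: ext => i; apply: mul1r. Qed.
Fact etale_mulDl : left_distributive etale_mul (@GRing.add K).
Proof. by move=> x y z; apply: ext => i; apply: mulrDl. Qed.
Fact etale_one_neq0 : etale_one != 0.
Proof.
apply/eqP => /(congr1 (fun x : K => x ord0)) /eqP.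
by rewrite (oner_eq0 (etale_factor ord0)).
Qed.

HB.instance Definition _ := GRing.Zmodule_isComNzRing.Build (etale_sort K)
  etale_mulA etale_mulC etale_mul1 etale_mulDl etale_one_neq0.

Fact etale_scaleA a b x :
  etale_scale a (etale_scale b x) = etale_scale (a * b) x.
Proof. by apply: ext => i; apply: scalerA. Qed.
Fact etale_scale1 : left_id 1 etale_scale.
Proof. by move=> x; apply: ext => i; apply: scale1r. Qed.
Fact etale_scaleDr : right_distributive etale_scale +%R.
Proof. by move=> a x y; apply: ext => i; apply: scalerDr. Qed.
Fact etale_scaleDl x : {morph etale_scale^~ x : a b / a + b}.
Proof. by move=> a b; apply: ext => i; apply: scalerDl. Qed.

HB.instance Definition _ := GRing.Zmodule_isLmodule.Build rat (etale_sort K)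
  etale_scaleA etale_scale1 etale_scaleDr etale_scaleDl.

Fact etale_scaleAl a x y : a *: (x * y) = (a *: x) * y.
Proof. by apply: ext => i; apply: scalerAl. Qed.

HB.instance Definition _ := GRing.Lmodule_isLalgebra.Build rat (etale_sort K)
  etale_scaleAl.
HB.instance Definition _ :=
  GRing.Lalgebra_isComAlgebra.Build rat (etale_sort K).

(* the product of the rings of integers of the factors *)
Definition etale_int : {pred K} :=
  fun x => `[< forall i, integralOver (intr : int -> etale_factor i) (x i) >].

Fact etale_int_subring : subring_closed etale_int.
Proof.
split.
- by apply/asboolP => i; apply: integral1.
- move=> x y /asboolP hx /asboolP hy; apply/asboolP => i.
  exact: integral_sub (hx i) (hy i).
- move=> x y /asboolP hx /asboolP hy; apply/asboolP => i.
  exact: integral_mul (hx i) (hy i).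
Qed.

HB.instance Definition _ := GRing.isSubringClosed.Build K etale_int
  etale_int_subring.

Record integers := Integers {
  etale_val :> K;
  etale_valP : etale_val \in etale_int }.

HB.instance Definition _ := [isSub for etale_val].
HB.instance Definition _ := [Choice of integers by <:].
HB.instance Definition _ := [SubChoice_isSubComNzRing of integers by <:].

End EtaleAlgebra.

Section Ideals.
Variable O : comNzRingType.
Implicit Types (I J : set O) (x y : O).

(* [idealr_closed] already includes properness of the ideal *)
Record maxideal := MaxIdeal {
  maxideal_pred :> O -> bool;
  maxideal_idealr : idealr_closed maxideal_pred;
  maxideal_max : forall J : O -> bool, idealr_closed J ->
    {subset maxideal_pred <= J} -> {subset J <= maxideal_pred} }.

Definition ideal_mul I J : set O :=
  [set x | exists2 s : seq (O * O),
     (forall u, u \in s -> I u.1 /\ J u.2) & x = \sum_(u <- s) u.1 * u.2].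

Definition ideal_exp I n : set O := iter n (ideal_mul I) setT.

Definition coset I x : set O := [set y | I (y - x)].

Fact ideal_mul_ideal I J :
    (J 0 /\ forall a x y, J x -> J y -> J (a * x + y)) ->
  ideal_mul I J `<=` J /\
  (ideal_mul I J 0 /\
   forall a x y, ideal_mul I J x -> ideal_mul I J y ->
     ideal_mul I J (a * x + y)).
Proof.
move=> [J0 Jl]; split=> [x [s sIJ ->]|].
  elim: s sIJ => [|u s IHs] sIJ; first by rewrite big_nil.
  rewrite big_cons; apply: Jl; first by case: (sIJ u (mem_head _ _)).
  by apply: IHs => v vs; apply: sIJ; rewrite inE vs orbT.
split; first by exists [::]; rewrite ?big_nil.
move=> a x y [s sIJ ->] [t tIJ ->].
exists ([seq (u.1, a * u.2) | u <- s] ++ t).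
  move=> u; rewrite mem_cat => /orP[/mapP[v vs ->]|/tIJ//].
  have [Iv Jv] := sIJ v vs; split=> //=.
  by rewrite -[a * _]addr0; apply: Jl.
rewrite big_cat big_map mulr_sumr; congr (_ + _).
by apply: eq_bigr => u _ /=; rewrite mulrCA.
Qed.

Fact ideal_exp_ideal I n : ideal_exp I n 0 /\
  forall a x y, ideal_exp I n x -> ideal_exp I n y -> ideal_exp I n (a * x + y).
Proof. by elim: n => [|n IHn]; [|case: (ideal_mul_ideal I IHn)]. Qed.

Fact ideal_exp_dec I n : ideal_exp I n.+1 `<=` ideal_exp I n.
Proof. by case: (ideal_mul_ideal I (ideal_exp_ideal I n)). Qed.

Fact ideal_exp0 I n : ideal_exp I n 0.
Proof. by case: (ideal_exp_ideal I n). Qed.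

Fact ideal_expN I n x : ideal_exp I n x -> ideal_exp I n (- x).
Proof.
case: (ideal_exp_ideal I n) => I0 Il Ix.
by rewrite -mulN1r -[_ * _]addr0; apply: Il.
Qed.

Fact ideal_expD I n x y :
  ideal_exp I n x -> ideal_exp I n y -> ideal_exp I n (x + y).
Proof.
by case: (ideal_exp_ideal I n) => _ Il Ix Iy; rewrite -[x]mul1r; apply: Il.
Qed.

Fact coset_exp_add I n x y :
  [set u + v | u in coset (ideal_exp I n) x & v in coset (ideal_exp I n) y] =
  coset (ideal_exp I n) (x + y).
Proof.
apply/seteqP; split=> [_ [u Iu [v Iv <-]]|w Iw].
  by rewrite /coset /= opprD addrACA; apply: ideal_expD.
exists x; first by rewrite /coset /= subrr; apply: ideal_exp0.
exists (w - x); last by rewrite addrC subrK.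
by rewrite /coset /= -addrA -opprD.
Qed.

Fact coset_exp_opp I n x :
  [set - u | u in coset (ideal_exp I n) x] = coset (ideal_exp I n) (- x).
Proof.
apply/seteqP; split=> [_ [u Iu <-]|w Iw].
  by rewrite /coset /= -opprD; apply: ideal_expN.
by exists (- w); rewrite ?opprK // /coset /= -opprD -[x]opprK; apply: ideal_expN.
Qed.

End Ideals.

Section Completion.
Variables (O : comNzRingType) (m : maxideal O).

Definition mexp (n : nat) : set O := ideal_exp [set x | m x] n.

(* The projective limit of the quotients O / m^n: an element is a compatible
   family of cosets of the m^n, each represented as a subset of O. *)
Record adic := Adic {
  adic_coset :> nat -> set O;
  adic_cosetP : forall n, exists a, adic_coset n = coset (mexp n) a;
  adic_compat : forall n, adic_coset n.+1 `<=` adic_coset n }.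

HB.instance Definition _ := gen_eqMixin adic.
HB.instance Definition _ := gen_choiceMixin adic.

Fact adic_ext (x y : adic) : (forall n, x n = y n) -> x = y.
Proof.
case: x y => [x x1 x2] [y y1 y2] /= /funext xy; move: x1 x2 y1 y2.
by rewrite xy => *; congr Adic; apply: Prop_irrelevance.
Qed.

Fact adic_of_compat (a : O) n : coset (mexp n.+1) a `<=` coset (mexp n) a.
Proof. by move=> x; apply: ideal_exp_dec. Qed.

Definition adic_of (a : O) : adic :=
  @Adic (fun n => coset (mexp n) a)
    (fun n => ex_intro _ a erefl) (@adic_of_compat a).

Fact adic_addP (x y : adic) n :
  exists a, [set u + v | u in x n & v in y n] = coset (mexp n) a.
Proof.
have [a ->] := adic_cosetP x n; have [b ->] := adic_cosetP y n.
by exists (a + b); apply: coset_exp_add.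
Qed.

Fact adic_add_compat (x y : adic) n :
  [set u + v | u in x n.+1 & v in y n.+1] `<=`
  [set u + v | u in x n & v in y n].
Proof.
move=> _ [u xu [v yv <-]].
by exists u; [apply: adic_compat|exists v => //; apply: adic_compat].
Qed.

Definition adic_add (x y : adic) : adic :=
  Adic (adic_addP x y) (@adic_add_compat x y).

Fact adic_oppP (x : adic) n : exists a, [set - u | u in x n] = coset (mexp n) a.
Proof.
by have [a ->] := adic_cosetP x n; exists (- a); apply: coset_exp_opp.
Qed.

Fact adic_opp_compat (x : adic) n :
  [set - u | u in x n.+1] `<=` [set - u | u in x n].
Proof. by move=> _ [u xu <-]; exists u => //; apply: adic_compat. Qed.

Definition adic_opp (x : adic) : adic :=
  Adic (adic_oppP x) (@adic_opp_compat x).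

Fact adic_addA : associative adic_add.
Proof.
move=> x y z; apply: adic_ext => n /=.
have [a ->] := adic_cosetP x n; have [b ->] := adic_cosetP y n.
by have [c ->] := adic_cosetP z n; rewrite !coset_exp_add addrA.
Qed.

Fact adic_addC : commutative adic_add.
Proof.
move=> x y; apply: adic_ext => n /=.
have [a ->] := adic_cosetP x n; have [b ->] := adic_cosetP y n.
by rewrite !coset_exp_add addrC.
Qed.

Fact adic_add0 : left_id (adic_of 0) adic_add.
Proof.
move=> x; apply: adic_ext => n /=.
by have [a ->] := adic_cosetP x n; rewrite coset_exp_add add0r.
Qed.

Fact adic_addN : left_inverse (adic_of 0) adic_opp adic_add.
Proof.
move=> x; apply: adic_ext => n /=.
have [a ->] := adic_cosetP x n.
by rewrite coset_exp_opp coset_exp_add addNr.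
Qed.

HB.instance Definition _ := GRing.isZmodule.Build adic
  adic_addA adic_addC adic_add0 adic_addN.
HB.instance Definition _ := isPointed.Build adic 0.

(* the projective limit topology, for discrete quotients O / m^n *)
Definition adic_open : set_system adic :=
  [set U | forall x : adic, U x -> exists n, forall y : adic,
     (forall k, (k <= n)%N -> y k = x k) -> U y].

Fact adic_openT : adic_open setT.
Proof. by move=> x _; exists 0%N. Qed.

Fact adic_openI : setI_closed adic_open.
Proof.
move=> U V oU oV x [/oU[n nU] /oV[k kV]]; exists (maxn n k) => y yx; split.
- by apply: nU => j jn; apply: yx; rewrite leq_max jn.
- by apply: kV => j jk; apply: yx; rewrite leq_max jk orbT.
Qed.

Fact adic_open_bigU (I : Type) (f : I -> set adic) :
  (forall i, adic_open (f i)) -> adic_open (\bigcup_i f i).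
Proof.
move=> of_ x [i _ /of_[n nf]]; exists n => y yx; exists i => //.
exact: nf.
Qed.

HB.instance Definition _ := isOpenTopological.Build adic
  adic_openT adic_openI adic_open_bigU.

Definition adic_borel : measurableType (sigma_display (@open adic)) :=
  g_sigma_algebraType (@open adic).

End Completion.

(* the Haar measure of total mass 1 on the completion *)
Record haar_measure (rT : realType) (O : comNzRingType) (m : maxideal O) :=
  HaarMeasure {
    haar_prob :> probability (adic_borel m) rT;
    haar_invariant : forall (d : adic m) (B : set (adic m)),
      measurable (B : set (adic_borel m)) ->
      haar_prob (translate d B) = haar_prob B }.

Definition prime_of (K : etaleAlg) := maxideal (integers K).

Section Sieves.
Variable K : etaleAlg.

Record sieve := Sieve {
  sieve_set :> forall p : prime_of K, set (adic p);
  sieve_compact : forall p, compact (@sieve_set p);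
  sieve_open : forall p, open (@sieve_set p) }.

Arguments sieve_set : clear implicits.

Definition non_large (rT : realType)
    (meas : forall p : prime_of K, haar_measure rT p) (R : sieve) : Prop :=
  (forall p, R p <> setT) /\
  forall eps : rT, 0 < eps ->
    finite_set [set p : prime_of K | (eps%:E < meas p (R p))%E].

Definition cofinite_sieve (R : sieve) : Prop :=
  finite_set [set p : prime_of K | R p = set0].

Definition sieve_diff (R : sieve) (T : set (integers K)) (p : prime_of K) :
    set (adic p) :=
  [set - adic_of p t + r | t in T & r in R p].

(* Subsets of O_K are their indicator functions, with the product topology. *)
Definition admissible (R : sieve) : set {ptws integers K -> bool} :=
  [set X | forall p : prime_of K, exists d : adic p,
     forall x : integers K, X x -> ~ translate d (R p) (adic_of p x)].

End Sieves.

Arguments sieve_set {K} s p.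
Arguments sieve_diff {K} R T p.

(* Compactness of the phase space plays no role in the notions below, so it is
   not recorded; it holds for the systems [sieve_system R]. *)
Record dynsys := DynSys {
  phase :> topologicalType;
  group : zmodType;
  action : group -> phase -> phase;
  action0 : forall X, action 0 X = X;
  actionD : forall g h X, action (g + h) X = action g (action h X);
  action_continuous : forall g, continuous (action g) }.

Section Morphisms.
Variables (X Y : dynsys) (f : X -> Y) (A : group X -> group Y).

Definition is_morphism : Prop :=
  [/\ {morph A : g h / g + h}, continuous f &
      forall g x, f (action g x) = action (A g) (f x)].

Definition is_factor_map : Prop :=
  [/\ is_morphism, (forall h, exists g, A g = h) & forall y, exists x, f x = y].

Definition is_isomorphism : Prop :=
  [/\ is_morphism, bijective A &
      exists f' : Y -> X, [/\ cancel f f', cancel f' f & continuous f']].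

End Morphisms.

Section SieveSystem.
Variables (K : etaleAlg) (R : sieve K).

Definition shift (g : integers K) (X : {ptws integers K -> bool}) : {ptws integers K -> bool} :=
  fun x => X (x - g).

Fact shift_admissible g (X : admissible R) : shift g (val X) \in admissible R.
Proof.
case: X => X /= /set_mem aX; apply/mem_set => p; have [d dX] := aX p.
exists (adic_of p g + d) => x /dX; apply: contra_not => -[r Rr e].
exists r => //; apply: (addrI (adic_of p g)); rewrite addrA e.
apply: adic_ext => n; rewrite [RHS]/= coset_exp_add.
by rewrite addrC subrK.
Qed.

Definition sieve_shift g (X : admissible R) : admissible R :=
  exist _ (shift g (val X)) (shift_admissible g X).

Fact sieve_shift0 X : sieve_shift 0 X = X.
Proof. by apply/val_inj/funext => x; rewrite /= /shift subr0. Qed.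

Fact sieve_shiftD g h X : sieve_shift (g + h) X = sieve_shift g (sieve_shift h X).
Proof.
by apply/val_inj/funext => x; rewrite /= /shift opprD addrA.
Qed.

Fact sieve_shift_continuous g : continuous (sieve_shift g).
Proof.
apply: continuous_comp_initial => X; rewrite /continuous_at.
have FX : Filter (nbhs X) by apply: nbhs_filter.
have FF := fmap_filter (set_val \o sieve_shift g) FX.
apply/(@cvg_sup _ _ _ _ _ FF) => x.
suff: continuous ((fun Y : {ptws integers K -> bool} => Y (x - g)) \o
                  (fun Y : admissible R => val Y)).
  move=> ce.
  have /(_ X) := @continuous_comp_initial {ptws integers K -> bool} (admissible R) _
    (fun Y : {ptws integers K -> bool} => Y x) (fun Y => shift g (val Y)) ce.
  by apply.
move=> {FX FF}X; apply: continuous_comp; first exact: initial_continuous.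
exact: proj_continuous.
Qed.

Definition sieve_system : dynsys :=
  DynSys sieve_shift0 sieve_shiftD sieve_shift_continuous.

End SieveSystem.

Section Morphism.
Variables (K L : etaleAlg) (R : sieve K) (S : sieve L).
Variables (f : sieve_system R -> sieve_system S) (A : integers K -> integers L).

(* [f] is the sliding block code with window [M] and allowed patterns [TT] *)
Definition local_rule (M : set (integers K)) (TT : set (integers K -> bool)) :
    Prop :=
  [/\ finite_set M,
      TT !=set0,
      (forall T, TT T ->
         [/\ [set` T] !=set0, [set` T] `<=` M & admissible R T]) &
      forall (x : integers K) (X : sieve_system R),
        val (f X) (A x) <->
        exists2 T, TT T &
          [set` val X] `&` translate x M = translate x [set` T]].

End Morphism.

Section Transport.
Variables (K L : etaleAlg).

Definition is_prime_image (tau : K -> L) (p : prime_of K) (q : prime_of L) :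
    Prop :=
  forall y : integers L,
    q y <-> exists2 x : integers K, p x & etale_val y = tau (etale_val x).

(* [Ahat] is the extension of [A] to the completions by continuity; it is unique
   because O_K is dense in its completion, which is Hausdorff *)
Definition extends_to_completion (A : integers K -> integers L)
    (p : prime_of K) (q : prime_of L) (Ahat : adic p -> adic q) : Prop :=
  continuous Ahat /\ forall x, Ahat (adic_of p x) = adic_of q (A x).

End Transport.

(* Main.v *)
Require Import Defs.
From HB Require Import structures.
From mathcomp Require Import all_boot all_order all_algebra all_field.
From mathcomp Require Import all_classical all_reals all_analysis.
From mathcomp Require Import measurable_realfun ring lra zify.

Set Implicit Arguments.
Unset Strict Implicit.
Unset Printing Implicit Defensive.

Import Order.TTheory GRing.Theory Num.Theory.

Local Open Scope classical_set_scope.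
Local Open Scope ring_scope.

(* If finitely many points x with patterns T in TT have x + T avoiding translates of the
   R_p, then, after moving the points apart without changing them modulo the relevant prime
   powers, f maps the union of the x + T to a set containing A x for all x; hence these A x
   avoid a translate of S_q.  Only primes p with R_p of non-negligible measure matter.
   Apply this to a prime q above a large totally split l: were A^-1(q) not a prime of K, the
   Chinese remainder theorem (at one or two primes, using that R_p has small measure above l)
   would produce such points with A x in all classes modulo q^k.  As A^-1(q) is a prime with
   residue field F_l, A(xy)A(1) = A(x)A(y) modulo q, hence everywhere, since totally split
   primes are infinitely many; so A is a unit times a ring isomorphism, injectivity being
   forced by the finiteness of the patterns.  At a single prime the same principle says that
   S_{tau p} lies in a translate of A(-T + R_p) for all T, which is (b).  For an isomorphism
   TT contains a singleton and (b) holds in both directions; for factor maps, preimages of a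
   finite set chosen by a diagonal construction give the reverse inclusion. *)

(** * Integers of number fields *)

(** By compactness each sieve set is a union of classes modulo a power of its prime, so the argument
    runs on congruences between integers; measure enters only through averaging over translates.
    Totally split primes are used because Z is dense in their completions: modulo q^k every class is
    an integer multiple of any element outside q, so one progression w + n x sweeps all classes
    under [A]. The obstacle is the case of two primes p1, p2 above l that both contribute to the
    image modulo q. There the points cannot be kept away from R_p1 and R_p2 by congruences, and a
    single point must avoid both sets. Hence smallness of measure is used in the form that some
    translate meets fewer than half of any given family of small sets: two majorities intersect.
    Total splitting is expressed by y^l = y modulo l for all integers y, which replaces the
    factorization of ideals and yields both the residue field F_l and the fact that l is
    unramified. *)

Notation isint F := (integralOver (intr : int -> F)).

Lemma map_intr_rat (F : fieldExtType rat) (p : {poly int}) :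
  map_poly (in_alg F) (map_poly intr p) = map_poly intr p.
Proof.
by rewrite -map_poly_comp; apply: eq_map_poly => b; rewrite /= alg_num_field ratr_int.
Qed.

Lemma map_intr_algC (p : {poly int}) :
  map_poly (ratr : rat -> algC) (map_poly intr p) = map_poly intr p.
Proof. by rewrite -map_poly_comp; apply: eq_map_poly => b; rewrite /= ratr_int. Qed.

Lemma horner_map_intr (F : nzRingType) (p : {poly int}) n (x : F) :
  (size p <= n)%N ->
  (map_poly intr p).[x] = \sum_(i < n) (p`_i)%:~R * x ^+ i.
Proof.
move=> sp; rewrite (@horner_coef_wide _ n); last first.
  exact: leq_trans (size_poly _ _) sp.
by apply: eq_bigr => i _; rewrite coef_map.
Qed.

(** With a the leading coefficient and n + 1 the degree, multiplying q(x) = 0 by a^n gives a monic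
    equation [r] for a x. *)
Lemma lead_coef_integral (F : comNzRingType) (q : {poly int}) (x : F) :
  (1 < size q)%N -> root (map_poly intr q) x ->
  isint F ((lead_coef q)%:~R * x).
Proof.
case sq: (size q) => [|[|n]] // _; set a := lead_coef q => /rootP.
rewrite (horner_map_intr _ (leqnn _)) sq big_ord_recr /= => qx.
pose r := \poly_(i < n.+2) (if i == n.+1 then 1 else q`_i * a ^+ (n - i)).
have r1 : r`_n.+1 = 1 by rewrite coef_poly ltnSn eqxx.
have sr : size r = n.+2.
  by apply/anti_leq; rewrite size_poly /= ltnNge; apply/negP => /leq_sizeP/(_ _ (leqnn _)); rewrite r1.
exists r; first by rewrite monicE lead_coefE sr /= r1.
apply/rootP; rewrite (horner_map_intr _ (leqnn _)) sr big_ord_recr /= r1 mul1r.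
rewrite -[RHS](mulr0 (a%:~R ^+ n)) -[X in _ = _ * X]qx mulrDr mulr_sumr; congr (_ + _).
  apply: eq_bigr => i _; rewrite coef_poly (ltn_trans (ltn_ord i)) // (ltn_eqF (ltn_ord i)).
  rewrite intrM rmorphXn /= exprMn !mulrA; congr (_ * _).
  by rewrite -mulrA -exprD subnK 1?mulrC // -ltnS.
by rewrite exprMn mulrA exprSr; congr (_ * _ * _); rewrite /a lead_coefE sq.
Qed.

Lemma int_multiple_integral (F : fieldExtType rat) (x : F) :
  exists2 n : nat, (0 < n)%N & isint F (n%:R * x).
Proof.
have [q Dq] := polyOver1P (minPolyOver 1 x).
have [p [a a0 qE]] := rat_poly_scale q.
have p_root : root (map_poly intr p) x.
  have := root_minPoly 1%AS x; rewrite Dq qE map_polyZ rootZ ?map_intr_rat ?fmorph_eq0 //.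
  by rewrite invr_eq0 intr_eq0.
have s1 : (1 < size p)%N.
  have := size_minPoly 1%AS x; rewrite Dq size_map_poly qE size_scale ?invr_eq0 ?intr_eq0 //.
  by rewrite size_rat_int_poly => ->.
have := lead_coef_integral s1 p_root; set c := lead_coef p => cx.
have c0 : c != 0 by rewrite lead_coef_eq0 -size_poly_eq0 -lt0n (ltn_trans _ s1).
exists `|c|%N; first by rewrite absz_gt0.
have -> : `|c|%N%:R = (sgz c * c)%:~R :> F by rewrite -abszEsg.
rewrite intrM -mulrA; apply: integral_mul cx; exact: integral_id.
Qed.

(** Gauss's lemma. If p = a q with q integral dividing P, comparing leading coefficients identifies
    a with the leading coefficient of the cofactor, an integer. *)
Lemma monic_dvdp_int (p : {poly rat}) (P : {poly int}) :
  p \is monic -> P \is monic -> p %| map_poly intr P ->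
  exists h : {poly int}, p = map_poly intr h.
Proof.
move=> mp mP /dvdpP_rat_int[qz [a nz_a Dq] [r]].
move/(congr1 (fun q1 => lead_coef (a *: map_poly (intr : int -> rat) q1))).
rewrite rmorphM /= scalerAl -Dq lead_coefZ lead_coefM /= (monicP mp) mul1r.
have mP' : map_poly (intr : int -> rat) P \is monic by apply: monic_map.
rewrite (monicP mP') mulr1 lead_coef_map_inj //; last exact: intr_inj.
by move=> e; rewrite Dq e; exists (lead_coef r *: qz); rewrite map_polyZ.
Qed.

(** A primitive element is scaled to an algebraic integer; by Gauss's lemma its minimal polynomial
    has integer coefficients. *)
Lemma primitive_integer (F : fieldExtType rat) :
  exists (theta : F) (h : {poly int}),
  [/\ h \is monic, irreducible_poly (map_poly intr h : {poly rat}),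
      root (map_poly intr h) theta &
      forall x : F, exists2 g : {poly rat}, (size g < size h)%N &
        x = (map_poly (in_alg F) g).[theta]].
Proof.
pose t := separable_generator 1%AS {:F}%AS.
have tE : (<<1; t>> = fullv :> {vspace F})%VS.
  apply/esym/eq_adjoin_separable_generator; last exact: subvf.
  by apply/separableP => y _; apply: pcharf0_separable => p; rewrite pchar_lalg; apply: pchar_num.
have [n n0 [P mP Pt]] := int_multiple_integral t.
set th := n%:R * t in Pt.
have n0' : n%:R != 0 :> rat by rewrite pnatr_eq0 -lt0n.
have thE : (<<1; th>> = fullv :> {vspace F})%VS.
  apply/eqP; rewrite eqEsubv subvf -tE /=; apply/FadjoinP; split; first exact: sub1v.
  have -> : t = n%:R^-1 *: th by rewrite /th mulr_natl -scaler_nat scalerA mulVf // scale1r.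
  by rewrite memvZ // memv_adjoin.
have [q Dq] := polyOver1P (minPolyOver 1 th).
have mq : q \is monic by have := monic_minPoly 1 th; rewrite Dq map_monic.
have root_q r : root (map_poly (in_alg F) r) th -> q %| r.
  move=> rr; rewrite -(dvdp_map (in_alg F)) -Dq minPoly_dvdp //.
  by apply/polyOver1P; exists r.
have [h hE] : exists h : {poly int}, q = map_poly intr h.
  by apply: (@monic_dvdp_int q P) => //; apply: root_q; rewrite map_intr_rat.
have sq : size q = (adjoin_degree 1 th).+1.
  by rewrite -(size_map_poly (in_alg F)) -Dq size_minPoly.
exists th, h; split.
- move: mq; rewrite hE !monicE (lead_coef_map_inj (@intr_inj rat) (mulr0z 1)).
  by rewrite -(inj_eq (@intr_inj rat)).
- rewrite -hE; split; first by rewrite sq.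
  move=> r r1 rq.
  have rP : map_poly (in_alg F) r \is a polyOver 1%VS by apply/polyOver1P; exists r.
  have := @minPoly_irr _ _ 1%AS th _ rP.
  rewrite Dq dvdp_map eqp_map => /(_ rq) /orP[//|].
  by rewrite -(rmorph1 (map_poly (in_alg F))) /= eqp_map -size_poly_eq1 (negbTE r1).
- by rewrite -(map_intr_rat F) -hE -Dq root_minPoly.
- move=> x; have : x \in <<1; th>>%VS by rewrite thE memvf.
  move=> xt; have := Fadjoin_poly_eq xt.
  have [g gE] := polyOver1P (Fadjoin_polyOver 1 th x).
  have := size_Fadjoin_poly 1 th x; rewrite gE size_map_poly => sg <-; exists g => //.
  by rewrite -size_rat_int_poly -hE sq ltnS.
Qed.

Lemma irreducible_root_dvdp (k L : fieldType) (f : {rmorphism k -> L})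
    (p q : {poly k}) (x : L) :
  irreducible_poly p -> root (map_poly f p) x -> root (map_poly f q) x ->
  p %| q.
Proof.
move=> irr px qx; apply: contraT; rewrite -irreducible_poly_coprime //.
rewrite -(coprimep_map f) => /coprimep_root/(_ px).
by rewrite (rootP qx) eqxx.
Qed.

Lemma irreducible_separable (p : {poly rat}) :
  irreducible_poly p -> separable_poly p.
Proof.
move=> irr; rewrite unlock irreducible_poly_coprime //.
have p0 : p != 0 by apply: irredp_neq0.
have d0 : p^`() != 0.
  have := irr.1; case sp: (size p) => [|[|n]] // _.
  apply/eqP => /(congr1 (fun q : {poly rat} => q`_n)); rewrite coef_deriv coef0 => /eqP.
  by rewrite mulrn_eq0 /= -[n.+1]/(n.+2.-1) -sp -lead_coefE lead_coef_eq0 (negbTE p0).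
by apply/negP => /(dvdp_leq d0); rewrite leqNgt lt_size_deriv.
Qed.

Lemma rat_integral_int (F : fieldExtType rat) (a : rat) :
  isint F a%:A -> a \is a Num.int.
Proof.
case=> P mP; rewrite -map_intr_rat fmorph_root => Pa.
rewrite -Cint_rat; apply: Cint_rat_Aint; first exact: Crat_rat.
apply: (@root_monic_Aint (map_poly intr P)).
- by rewrite -map_intr_algC fmorph_root.
- exact: monic_map.
- by apply/polyOverP => i; rewrite coef_map /= intr_int.
Qed.

Lemma integral_Aint (x : algC) : isint algC x -> x \in Aint.
Proof.
case=> P mP Px; apply: (root_monic_Aint Px); first exact: monic_map.
by apply/polyOverP => i; rewrite coef_map /= intr_int.
Qed.

Lemma algC_int_multiple (x : algC) :
  exists2 n : nat, (0 < n)%N & n%:R * x \in Aint.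
Proof.
have [p [_ mp] dvp] := minCpolyP x.
have px : root (map_poly ratr p) x by rewrite dvp.
have s1 : (1 < size p)%N.
  by rewrite -(size_map_poly (ratr : rat -> algC)) (root_size_gt1 _ px) // monic_neq0 // monic_map.
have [q [a a0 qE]] := rat_poly_scale p.
have qx : root (map_poly intr q) x.
  by move: px; rewrite qE map_polyZ rootZ ?map_intr_algC // fmorph_eq0 invr_eq0 intr_eq0.
have s1q : (1 < size q)%N.
  by move: s1; rewrite qE size_scale ?size_rat_int_poly // invr_eq0 intr_eq0.
have /integral_Aint cx := lead_coef_integral s1q qx.
have c0 : lead_coef q != 0 by rewrite lead_coef_eq0 -size_poly_eq0 -lt0n (ltn_trans _ s1q).
exists `|lead_coef q|%N; first by rewrite absz_gt0.
have -> : `|lead_coef q|%N%:R = (sgz (lead_coef q) * lead_coef q)%:~R :> algC by rewrite -abszEsg.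
by rewrite intrM -mulrA rpredM // Aint_int.
Qed.

Lemma det_Aint n (M : 'M[algC]_n) :
  (forall i j, M i j \in Aint) -> \det M \in Aint.
Proof.
move=> MA; apply: rpred_sum => p _; apply: rpredM; last by apply: rpred_prod.
by rewrite rpredX // rpredN rpred1.
Qed.

(* The values of the coordinate polynomial of an integral [y] at the conjugates of [theta]
   are algebraic integers; inverting their Vandermonde matrix bounds the denominators. *)
Lemma integral_denominator (F : fieldExtType rat) (theta : F) (h : {poly int}) :
    h \is monic -> irreducible_poly (map_poly intr h : {poly rat}) ->
    root (map_poly intr h) theta ->
    (forall x : F, exists2 g : {poly rat}, (size g < size h)%N &
        x = (map_poly (in_alg F) g).[theta]) ->
  exists2 D : nat, (0 < D)%N & forall y : F, isint F y ->
    exists2 g : {poly int}, (size g < size h)%N &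
      D%:R * y = (map_poly intr g).[theta].
Proof.
move=> mh irr ht gen.
have [s sE] := closed_field_poly_normal (map_poly (intr : int -> algC) h).
have mhC : map_poly (intr : int -> algC) h \is monic by apply: monic_map.
move: sE; rewrite (monicP mhC) scale1r => sE.
have us : uniq s.
  rewrite -separable_prod_XsubC -sE -map_intr_algC separable_map.
  exact: irreducible_separable.
have szh : size h = (size s).+1.
  by rewrite -(size_prod_XsubC s id) -sE -map_intr_algC size_map_poly size_rat_int_poly.
have hs : {in s, forall z, root (map_poly intr h) z}.
  by move=> z zs; rewrite sE root_prod_XsubC.
have sA : {in s, forall z, z \in Aint}.
  by move=> z /hs hz; apply: integral_Aint; exists h.
set n := size s in szh.
pose a : 'rV[algC]_n := \row_j s`_j.
pose V := Vandermonde n a.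
have V0 : \det V != 0.
  rewrite det_Vandermonde; apply/prodf_neq0 => i _; apply/prodf_neq0 => j ij.
  by rewrite !mxE subr_eq0 nth_uniq // gtn_eqF.
have AV i j : V i j \in Aint by rewrite !mxE rpredX // sA // mem_nth.
have [D D0 Du] := algC_int_multiple (\det V)^-1.
exists D => // y [P mP Py].
have [g sg yE] := gen y.
(* [P] composed with [g] vanishes at [theta], so it is divisible by [h] and vanishes at all
   conjugates. *)
have gA z : z \in s -> (map_poly ratr g).[z] \in Aint.
  move=> zs; apply: integral_Aint; exists P => //.
  rewrite -map_intr_algC rootE -horner_comp -map_comp_poly -rootE.
  rewrite -map_intr_rat yE rootE -horner_comp -map_comp_poly -rootE in Py.
  rewrite -map_intr_rat in ht.
  have /dvdpP[r ->] := irreducible_root_dvdp irr ht Py.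
  by rewrite rmorphM /= rootM map_intr_algC hs ?orbT.
pose b : 'rV[algC]_n := \row_j ratr g`_j.
pose w : 'rV[algC]_n := \row_j (map_poly ratr g).[s`_j].
have wE : w = b *m V.
  apply/rowP => j; rewrite !mxE (@horner_coef_wide _ n); last first.
    by rewrite size_map_poly -ltnS -szh.
  by apply: eq_bigr => i _; rewrite coef_map /= !mxE.
(* Cramer's rule: det V times the coordinates is integral, and D / det V is an algebraic integer
   that does not depend on [y]. *)
have bE : \det V *: b = w *m \adj V.
  by rewrite wE -mulmxA mul_mx_adj -mul_scalar_mx scalar_mxC.
have coefA i : (D%:R * g`_i) \is a Num.int.
  have [ni|ltin] := leqP n i.
    by rewrite nth_default ?mulr0 ?rpred0 // (leq_trans _ ni) // -ltnS -szh.
  rewrite -Cint_rat; apply: Cint_rat_Aint; first exact: Crat_rat.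
  have -> : ratr (D%:R * g`_i) = D%:R * (\det V)^-1 * (\det V *: b) 0 (Ordinal ltin) :> algC.
    by rewrite !mxE mulrA divfK // rmorphM /= ratr_nat.
  apply: rpredM => //; rewrite bE mxE; apply: rpred_sum => j _; apply: rpredM.
    by rewrite mxE gA // mem_nth.
  rewrite mxE /cofactor; apply: rpredM; first by rewrite rpredX // rpredN rpred1.
  by apply: det_Aint => k l; rewrite mxE mxE; apply: AV.
have [g' g'E] : exists g' : {poly int}, D%:R *: g = map_poly intr g'.
  exists (map_poly Num.floor (D%:R *: g)); rewrite -map_poly_comp.
  apply/polyP => i; rewrite coef_map_id0 /= ?floor0 // coefZ floorK //.
exists g'.
  rewrite -size_rat_int_poly -g'E size_scale // pnatr_eq0 -lt0n //.
rewrite -map_intr_rat -g'E map_polyZ hornerZ -yE; congr (_ * _).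
by rewrite /= alg_num_field ratr_nat.
Qed.

(** * Totally split primes *)

(** Euclid's argument: at multiples of B! mu(0) the value is mu(0) t with t congruent to 1 modulo
    B!, so all prime factors of t exceed B. *)
Lemma prime_divisor_of_values (mu : {poly int}) B :
  (1 < size mu)%N ->
  exists l : nat, [/\ prime l, (B < l)%N & exists b : int, (l%:Z %| mu.[b])%Z].
Proof.
move=> smu.
have zero_case b : mu.[b] = 0 ->
  exists l : nat, [/\ prime l, (B < l)%N & exists b : int, (l%:Z %| mu.[b])%Z].
  move=> mub; have [l lB pl] := prime_above B.
  by exists l; split => //; exists b; rewrite mub dvdz0.
have [|c0] := eqVneq mu.[0] 0; first exact: zero_case.
set c := mu.[0] in c0.
have [q qE] : exists q, mu = c%:P + 'X * q.
  have /factor_theorem[q] : root (mu - c%:P) 0 by rewrite rootE hornerD hornerN hornerC subrr.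
  by rewrite subr0 mulrC => /eqP; rewrite subr_eq addrC => /eqP ->; exists q.
pose f : int := (B`!)%:Z * c.
have f0 : f != 0 by rewrite mulf_neq0 // -lt0n fact_gt0.
have valE (k : int) : mu.[f * k] = c * (1 + (B`!)%:Z * (k * q.[f * k])).
  by rewrite {1}qE !hornerE mulrDr mulr1 !mulrA [c * (B`!)%:Z]mulrC.
(* [g] vanishes exactly where [mu] takes the values c and -c, that is where t would be 1 or -1; it
   has too few roots to vanish at all the candidates. *)
pose g := (mu - c%:P) * (mu + c%:P).
have g0 : g != 0.
  have sm : (size (c%:P) < size mu)%N by apply: leq_ltn_trans smu; rewrite size_polyC; case: (c != 0).
  rewrite mulf_neq0 // -size_poly_eq0 ?size_polyDl ?size_polyN //; by case: (size mu) smu.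
have [k kg] : exists k : nat, ~~ root g (f * k%:Z).
  pose rs := [seq f * k%:Z | k <- iota 0 (size g)].
  have urs : uniq rs.
    rewrite map_inj_uniq ?iota_uniq // => k l /(mulfI f0) /eqP; by rewrite eqz_nat => /eqP.
  have : ~~ all (root g) rs.
    apply/negP => ars; have := max_poly_roots g0 ars urs.
    by rewrite size_map size_iota ltnn.
  by case/allPn => x /mapP[k _ ->] ?; exists k.
pose y := f * k%:Z; pose t := 1 + (B`!)%:Z * (k%:Z * q.[y]).
have muy : mu.[y] = c * t by rewrite /y valE.
have [t0|t0] := eqVneq t 0; first by apply: (zero_case y); rewrite muy t0 mulr0.
have t1 : (1 < `|t|)%N.
  rewrite ltn_neqAle eq_sym absz_gt0 t0 andbT; apply: contra kg => /eqP t1.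
  have gy : g.[y] = (c * t - c) * (c * t + c) by rewrite /g !hornerE muy.
  rewrite rootE -/y gy; move/esym: t1; case: (t) => [[|[|n]]|[|n]] // _.
    by rewrite mulr1 subrr mul0r.
  by rewrite mulrN1 addNr mulr0.
exists (pdiv `|t|); split; first exact: pdiv_prime.
  rewrite ltnNge; apply/negP => le.
  have d1 : (pdiv `|t| %| B`!)%N by apply: dvdn_fact; rewrite pdiv_gt0.
  have : ((pdiv `|t|)%:Z %| t - (B`!)%:Z * (k%:Z * q.[y]))%Z.
    by rewrite rpredB // ?dvdzE ?pdiv_dvd // absz_nat abszM dvdn_mulr.
  rewrite /t addrK dvdzE /= dvdn1 => /eqP e1.
  by have := pdiv_prime t1; rewrite e1.
by exists y; rewrite muy dvdz_mull // dvdzE /= pdiv_dvd.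
Qed.

(** The primitive part of the minimal polynomial is taken so that, by Gauss's lemma, divisibility
    holds over Z and not only over Q. *)
Lemma minimal_int_poly (z : algC) :
  exists mu : {poly int}, [/\ (1 < size mu)%N,
    irreducible_poly (map_poly intr mu : {poly rat}), root (map_poly intr mu) z &
    forall q : {poly int}, root (map_poly intr q) z -> exists r, q = mu * r].
Proof.
have [p [_ mp] dvp] := minCpolyP z.
have pz : root (map_poly ratr p) z by rewrite dvp.
have p0 := monic_neq0 mp.
have irr : irreducible_poly p.
  apply/(subfx_irreducibleP pz p0) => q qz q0; by rewrite dvdp_leq // -dvp.
have [q0 [a a0 qE]] := rat_poly_scale p.
have a0' : (a%:~R : rat)^-1 != 0 by rewrite invr_eq0 intr_eq0.
have q00 : q0 != 0 by apply: contra_neq p0 => q00; rewrite qE q00 map_poly0 scaler0.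
have cE : (map_poly intr q0 : {poly rat}) = (zcontents q0)%:~R *: map_poly intr (zprimitive q0).
  by rewrite {1}[q0]zpolyEprim map_polyZ.
have c0 : (zcontents q0)%:~R != 0 :> rat by rewrite intr_eq0 zcontents_eq0.
have pE : p %= map_poly intr (zprimitive q0).
  by rewrite qE cE scalerA eqp_scale // mulf_neq0.
have irr' : irreducible_poly (map_poly intr (zprimitive q0) : {poly rat}).
  split; first by rewrite -(eqp_size pE) irr.1.
  by move=> q q1; rewrite -(eqp_dvdr _ pE) => /(irr.2 q q1) /eqp_trans; apply.
exists (zprimitive q0); split => //.
- by rewrite -size_rat_int_poly irr'.1.
- by rewrite -map_intr_algC dvp (eqp_dvdl _ pE).
- move=> q; rewrite -map_intr_algC dvp (eqp_dvdl _ pE) dvdp_rat_int => /dvdpP_int[r ->].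
  by rewrite zprimitive_id; exists r.
Qed.

(** A Bezout identity for the coprime [mu] and [q] over Q, cleared of denominators, expresses a
    nonzero integer N as a combination of their values. *)
Lemma bounded_irreducible_value (mu q : {poly int}) (z : algC) :
  irreducible_poly (map_poly intr mu : {poly rat}) ->
  root (map_poly intr mu) z -> ~~ root (map_poly intr q) z ->
  exists2 N : nat, (0 < N)%N & forall (l : nat) (b : int),
    (l%:Z %| mu.[b])%Z -> (l%:Z %| q.[b])%Z -> (l %| N)%N.
Proof.
move=> irr muz qz.
have cop : coprimep (map_poly intr mu : {poly rat}) (map_poly intr q).
  rewrite irreducible_poly_coprime //; apply: contra qz => /dvdpP[r].
  rewrite -!map_intr_algC => ->; rewrite rmorphM rootM /= map_intr_algC muz orbT //.
have [[u v] /= uv] := Bezout_eq1_coprimepP _ _ cop.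
have [u' [a a0 uE]] := rat_poly_scale u; have [v' [b b0 vE]] := rat_poly_scale v.
have e : (b *: u') * mu + (a *: v') * q = (a * b)%:P.
  apply: (map_inj_poly (@intr_inj rat)) => //.
  have uE' : map_poly intr u' = a%:~R *: u by rewrite uE scalerA mulfV ?intr_eq0 // scale1r.
  have vE' : map_poly intr v' = b%:~R *: v by rewrite vE scalerA mulfV ?intr_eq0 // scale1r.
  rewrite rmorphD !rmorphM /= map_polyC /= !map_polyZ uE' vE' !scalerA -!scalerAl.
  rewrite map_polyC /= -polyCM -[RHS]mulr1 -uv mul_polyC scalerDr.
  by congr (_ *: _ + _); rewrite mulrC.
exists `|(a * b)%R|%N; first by rewrite absz_gt0 mulf_neq0.
move=> l x lm lq; have : (l%:Z %| (a * b))%Z; last by rewrite dvdzE.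
by rewrite -(hornerC (a * b) x) -e hornerD !hornerM rpredD // dvdz_mull.
Qed.

Lemma int_Fp_eq0 (l : nat) (c : int) : prime l ->
  (c%:~R == 0 :> 'F_l) = (l%:Z %| c)%Z.
Proof. by move=> pl; rewrite (dvdz_pcharf (pchar_Fp pl)). Qed.

(** Division by the monic [h] already works over Z; the remainder is too short to be a nonzero
    multiple of [h] modulo l, so l divides it. *)
Lemma lift_dvdp_Fp (l : nat) (h p : {poly int}) : prime l -> h \is monic ->
  (map_poly intr h : {poly 'F_l}) %| map_poly intr p ->
  exists a b : {poly int}, p = h * a + l%:R *: b.
Proof.
move=> pl mh dv.
have pE := Pdiv.RingMonic.rdivp_eq mh p.
set a := Pdiv.Ring.rdivp p h in pE; set r := Pdiv.Ring.rmodp p h in pE.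
have sr : (size r < size h)%N by apply: Pdiv.Ring.ltn_rmodpN0; apply: monic_neq0.
have r0 : map_poly intr r = 0 :> {poly 'F_l}.
  have : (map_poly intr h : {poly 'F_l}) %| map_poly intr r.
    by move: dv; rewrite pE rmorphD rmorphM /= dvdp_addr // dvdp_mull.
  have mh' : (map_poly intr h : {poly 'F_l}) \is monic by apply: monic_map.
  move=> d; apply/eqP; apply: contraT => r0; have := dvdp_leq r0 d.
  have -> : size (map_poly intr h : {poly 'F_l}) = size h.
    by rewrite size_map_poly_id0 // (monicP mh) oner_eq0.
  by rewrite leqNgt (leq_ltn_trans (size_poly _ _) sr).
exists a, (map_poly (divz^~ l%:Z) r).
rewrite {1}pE mulrC natz map_poly_divzK //; apply/polyOverP => i.
have := congr1 (fun q : {poly 'F_l} => q`_i) r0.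
by rewrite coef_map coef0 /= => /eqP; rewrite int_Fp_eq0.
Qed.

Lemma seq_common_multiple (T : eqType) (s : seq T) (P : T -> nat -> Prop) :
    (forall x n m, (0 < m)%N -> P x n -> P x (n * m)%N) ->
    {in s, forall x, exists2 n, (0 < n)%N & P x n} ->
  exists2 n, (0 < n)%N & {in s, forall x, P x n}.
Proof.
move=> Pm; elim: s => [|x s IHs] sP; first by exists 1%N.
have [n n0 Pn] := IHs (fun y ys => sP y (@mem_behead _ (x :: s) y ys)).
have [m m0 Px] := sP x (mem_head _ _).
exists (n * m)%N; first by rewrite muln_gt0 n0.
move=> y; rewrite inE => /predU1P[->|/Pn/Pm]; last exact.
by rewrite mulnC; apply: Pm.
Qed.

(* The roots of [h] are polynomials in [z]; reducing [z] to a root [b] of [mu] modulo [l]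
   turns the factorization of [h] over Q(z) into one over F_l, whose roots stay distinct. *)
Lemma split_modulo (z : algC) (mu h : {poly int}) :
    irreducible_poly (map_poly intr mu : {poly rat}) -> root (map_poly intr mu) z ->
    (forall q : {poly int}, root (map_poly intr q) z -> exists r, q = mu * r) ->
    h \is monic -> irreducible_poly (map_poly intr h : {poly rat}) ->
    (forall r : algC, root (map_poly intr h) r ->
       exists p : {poly rat}, r = (map_poly ratr p).[z]) ->
  exists2 N : nat, (0 < N)%N & forall (l : nat) (b : int), prime l ->
    ~~ (l %| N)%N -> (l%:Z %| mu.[b])%Z ->
    (map_poly intr h : {poly 'F_l}) %| 'X^l - 'X.
Proof.
move=> irr muz mu_dvd mh irrh hz.
have [s sE] := closed_field_poly_normal (map_poly (intr : int -> algC) h).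
have mhC : map_poly (intr : int -> algC) h \is monic by apply: monic_map.
move: sE; rewrite (monicP mhC) scale1r => sE.
have us : uniq s.
  rewrite -separable_prod_XsubC -sE -map_intr_algC separable_map.
  exact: irreducible_separable.
have hs : {in s, forall z, root (map_poly intr h) z}.
  by move=> x zs; rewrite sE root_prod_XsubC.
have [E E0 EP] : exists2 E, (0 < E)%N & {in s, forall r, exists G : {poly int},
    E%:R * r = (map_poly intr G).[z]}.
  apply: seq_common_multiple => [r n m _ [G GE]|r /hs /hz[p ->]].
    exists (m%:R *: G); rewrite map_polyZ hornerZ -GE mulnC natrM mulrA.
    by rewrite /= mulrz_nat.
  have [q [a a0 ->]] := rat_poly_scale p.
  exists `|a|%N; first by rewrite absz_gt0.
  exists (sgz a *: q); rewrite !map_polyZ !hornerZ map_intr_algC mulrA /=; congr (_ * _).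
  have -> : `|a|%N%:R = (sgz a * a)%:~R :> algC by rewrite -abszEsg.
  by rewrite fmorphV rmorph_int intrM mulfK // intr_eq0.
have [G GE] : exists G : algC -> {poly int}, {in s, forall r,
    E%:R * r = (map_poly intr (G r)).[z]}.
  have /choice[G GP] : forall r : algC, exists G : {poly int},
      r \in s -> E%:R * r = (map_poly intr G).[z].
    move=> r; have [/EP[G GE]|_] := boolP (r \in s); first by exists G.
    by exists 0.
  by exists G.
have E0' : E%:R != 0 :> algC by rewrite pnatr_eq0 -lt0n.
(* A prime not dividing D keeps distinct roots of [h] distinct after reduction, because [mu] is
   coprime to G r - G r'. *)
have [D D0 DP] : exists2 D, (0 < D)%N & {in [seq (r, r') | r <- s, r' <- s],
    forall rr, rr.1 != rr.2 -> forall (l : nat) (b : int),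
    (l%:Z %| mu.[b])%Z -> (l%:Z %| (G rr.1 - G rr.2).[b])%Z -> (l %| D)%N}.
  apply: seq_common_multiple => [rr n m _ H ne l b lm lG|_ /allpairsP[[r r'] [/= rs rs' ->]] /=].
    by rewrite dvdn_mulr // (H ne l b).
  have [->|ne] := eqVneq r r'; first by exists 1%N.
  have [|D D0 DP] := bounded_irreducible_value irr muz (q := G r - G r'); last first.
    by exists D => // _; apply: DP.
  rewrite rootE rmorphB hornerD hornerN -!GE //= -mulrBr mulf_neq0 //.
  by rewrite subr_eq0.
exists (D * E)%N; first by rewrite muln_gt0 D0.
move=> l b pl; rewrite Euclid_dvdM // negb_or => /andP[lD lE] lmu.
pose phi (q : {poly int}) : 'F_l := (map_poly intr q).[b%:~R].
have phiE q : phi q = (q.[b])%:~R by rewrite /phi horner_map.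
have El : E%:R != 0 :> 'F_l.
  by rewrite -(dvdn_pcharf (pchar_Fp pl)).
pose t := [seq phi (G r) / E%:R | r <- s].
have ut : uniq t.
  rewrite map_inj_in_uniq // => r r' rs rs' /(mulIf _) e.
  apply/eqP; apply: contraT => ne; case/negP: lD.
  apply: (DP (r, r') _ ne l b lmu); first by apply: allpairs_f.
  rewrite -int_Fp_eq0 // hornerD hornerN rmorphB /= -!phiE e ?subrr // invr_eq0 //.
(* A factorization defect over Z[Y]. It vanishes at Y = z, so [mu] divides its coefficients, and
   therefore it also vanishes at Y = b modulo l. *)
pose P : {poly {poly int}} := (E%:R ^+ size s) *: map_poly polyC h -
  \prod_(r <- s) (E%:R *: 'X - (G r)%:P).
have mapP (R : comNzRingType) (f : {rmorphism {poly int} -> R}) :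
    (forall c : int, f c%:P = c%:~R) ->
    map_poly f P = (E%:R ^+ size s) *: map_poly intr h -
      \prod_(r <- s) (E%:R *: 'X - (f (G r))%:P).
  move=> fC; rewrite rmorphB /= map_polyZ rmorphXn rmorph_nat -map_poly_comp.
  congr (_ *: _ - _); first exact: eq_map_poly.
  rewrite rmorph_prod; apply: eq_bigr => r _.
  by rewrite rmorphB /= map_polyZ rmorph_nat map_polyX map_polyC.
have prodZ (R : fieldType) (a : algC -> R) : E%:R != 0 :> R ->
    \prod_(r <- s) (E%:R *: 'X - (a r)%:P) =
    E%:R ^+ size s *: \prod_(r <- s) ('X - (a r / E%:R)%:P).
  move=> ER; have -> : E%:R ^+ size s = \prod_(r <- s) E%:R :> R.
    by rewrite big_const_seq count_predT -Monoid.iteropE.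
  rewrite -scaler_prod; apply: eq_bigr => r _.
  by rewrite scalerBr -[X in _ = _ - X]mul_polyC -polyCM mulrC divfK.
pose ez : {rmorphism {poly int} -> algC} := horner_eval z \o map_poly intr.
pose eb : {rmorphism {poly int} -> 'F_l} := horner_eval b%:~R \o map_poly intr.
have ezP : map_poly ez P = 0.
  rewrite mapP; last by move=> c; rewrite /= /horner_eval map_polyC hornerC.
  rewrite sE; apply/eqP; rewrite subr_eq0; apply/eqP.
  transitivity (\prod_(r <- s) (E%:R *: 'X - (E%:R * r)%:P) : {poly algC}).
    rewrite prodZ //; congr (_ *: _); apply: eq_bigr => r _.
    by rewrite mulrAC divff // mul1r.
  by rewrite !big_seq; apply: eq_bigr => r rs; rewrite /= /horner_eval GE.
have ebP : map_poly eb P = 0.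
  apply/polyP => i; rewrite coef_map coef0.
  have /mu_dvd[q ->] : root (map_poly intr P`_i) z.
    by have := congr1 (fun q : {poly algC} => q`_i) ezP; rewrite coef_map coef0 /= => /eqP.
  rewrite [LHS](rmorphM eb) [eb mu]phiE.
  by move: lmu; rewrite -int_Fp_eq0 // => /eqP ->; rewrite mul0r.
have hE : map_poly intr h = \prod_(a <- t) ('X - a%:P) :> {poly 'F_l}.
  have EsF : E%:R ^+ size s != 0 :> 'F_l by rewrite expf_neq0.
  apply: (scalerI EsF); rewrite big_map -prodZ //.
  apply/eqP; rewrite -subr_eq0 -[X in _ == X]ebP mapP //.
  by move=> c; rewrite /= /horner_eval map_polyC hornerC.
rewrite hE; apply: uniq_roots_dvdp; last by rewrite uniq_rootsE.
apply/allP => a _; rewrite rootE hornerD hornerN hornerXn hornerX.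
by rewrite -[X in _ ^+ X](card_Fp pl) expf_card subrr.
Qed.

(** A primitive element z for the roots of all the [hs] together lets one root of one polynomial
    [mu] modulo l split them all. *)
Lemma split_primes (hs : seq {poly int}) :
    {in hs, forall h, h \is monic /\ irreducible_poly (map_poly intr h : {poly rat})} ->
  forall B, exists l : nat, [/\ prime l, (B < l)%N &
    {in hs, forall h, (map_poly intr h : {poly 'F_l}) %| 'X^l - 'X}].
Proof.
move=> hsP B.
have /choice[rts rtsE] : forall h : {poly int}, exists s : seq algC,
    h \is monic -> map_poly intr h = \prod_(r <- s) ('X - r%:P).
  move=> h; have [s sE] := closed_field_poly_normal (map_poly (intr : int -> algC) h).
  exists s => mh; rewrite sE (monicP _) ?scale1r //; exact: monic_map.
have [z _ [ps psE]] := algC_PET (flatten (map rts hs)).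
have [mu [smu irr muz mu_dvd]] := minimal_int_poly z.
have [N N0 NP] : exists2 N, (0 < N)%N & {in hs, forall h, forall (l : nat) (b : int),
    prime l -> ~~ (l %| N)%N -> (l%:Z %| mu.[b])%Z ->
    (map_poly intr h : {poly 'F_l}) %| 'X^l - 'X}.
  apply: seq_common_multiple => [h n m _ H l b pl lnm|h hhs].
    by apply: H => //; apply: contra lnm; apply: dvdn_mulr.
  have [mh irrh] := hsP h hhs.
  apply: (split_modulo irr muz mu_dvd mh irrh) => r.
  rewrite rtsE // root_prod_XsubC => rr.
  have : r \in flatten (map rts hs) by apply/flatten_mapP; exists h.
  by rewrite psE => /mapP[p _ ->]; exists p.
have [l [pl lB [b lb]]] := prime_divisor_of_values (B + N) smu.
exists l; split => //; first by apply: leq_ltn_trans lB; apply: leq_addr.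
move=> h hhs; apply: NP lb => //; apply/negP => /(dvdn_leq N0).
by rewrite leqNgt (leq_ltn_trans (leq_addl _ _) lB).
Qed.

Lemma integral_exp (F : fieldExtType rat) (x : F) n : isint F x -> isint F (x ^+ n).
Proof.
move=> ix; elim: n => [|n IHn]; first by rewrite expr0; apply: integral1.
by rewrite exprS; apply: integral_mul.
Qed.

Lemma integral_int (F : fieldExtType rat) (c : int) : isint F c%:~R.
Proof. exact: integral_id. Qed.

Lemma integral_horner_int (F : fieldExtType rat) (g : {poly int}) (x : F) :
  isint F x -> isint F (map_poly intr g).[x].
Proof.
move=> ix; rewrite (horner_map_intr _ (leqnn _)).
apply: (big_ind (isint F)); [exact: mxpoly.integral0|by move=> *; apply: integral_add|].
by move=> i _; apply: integral_mul; [apply: integral_int|apply: integral_exp].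
Qed.

Lemma dvdp_frobenius (l : nat) (g : {poly 'F_l}) : prime l ->
  'X^l - 'X %| g ^+ l - g.
Proof.
move=> pl; have ch : l \in [pchar {poly 'F_l}] by rewrite pchar_poly pchar_Fp.
elim/poly_ind: g => [|g c IHg]; first by rewrite expr0n subr0; case: l pl {ch}.
have -> : (g * 'X + c%:P) ^+ l = g ^+ l * 'X^l + c%:P ^+ l.
  by rewrite -!(pFrobenius_autE ch) rmorphD rmorphM.
have -> : c%:P ^+ l = c%:P.
  by rewrite -rmorphXn /= -[X in _ ^+ X](card_Fp pl) expf_card.
rewrite opprD addrACA subrr addr0.
have -> : g ^+ l * 'X^l - g * 'X = (g ^+ l - g) * 'X^l + g * ('X^l - 'X) by ring.
by apply: dvdp_add; [apply: dvdp_mulr | apply: dvdp_mull].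
Qed.

(** Multiplication by D brings y into Z[theta], where Frobenius is the identity modulo l since [h]
    divides X^l - X there; D is prime to l and can be cancelled. *)
Lemma integral_frobenius (F : fieldExtType rat) :
  exists (h : {poly int}) (D : nat),
  [/\ h \is monic, irreducible_poly (map_poly intr h : {poly rat}), (0 < D)%N &
    forall l, prime l -> ~~ (l %| D)%N ->
      (map_poly intr h : {poly 'F_l}) %| 'X^l - 'X ->
      forall y : F, isint F y -> exists2 z, isint F z & y ^+ l - y = l%:R * z].
Proof.
have [th [h [mh irr ht gen]]] := primitive_integer F.
have [D D0 DP] := integral_denominator mh irr ht gen.
exists h, D; split => // l pl lD hl y iy.
have [g _ gE] := DP y iy.
have [a [b ab]] : exists a b : {poly int}, g ^+ l - g = h * a + l%:R *: b.
  apply: lift_dvdp_Fp => //; apply: dvdp_trans hl _.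
  by rewrite rmorphB rmorphXn /=; apply: dvdp_frobenius.
have ith : isint F th by exists h.
set beta := (map_poly intr b).[th].
have ibeta : isint F beta by apply: integral_horner_int.
have e1 : D%:R ^+ l * y ^+ l - D%:R * y = l%:R * beta.
  have := congr1 (fun p : {poly int} => (map_poly intr p).[th]) ab.
  rewrite /= !rmorphB rmorphD rmorphM rmorphXn /= map_polyZ !hornerE.
  by rewrite (rootP ht) mul0r add0r -gE exprMn rmorph_nat.
have [e eE] : exists e, (D ^ l = D + l * e)%N.
  have := fermat_little D pl; have le : (D <= D ^ l)%N.
    by rewrite -[X in (X <= _)%N]expn1 leq_pexp2l // prime_gt0.
  move/eqP; rewrite eqn_mod_dvd // => /dvdnP[e eE].
  by exists e; rewrite mulnC -eE subnKC.
have [u [v uv]] : exists u v : int, u * D%:Z + v * l%:Z = 1.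
  have [u [v uv]] := Bezoutz D%:Z l%:Z; exists u, v; rewrite uv.
  by apply/eqP; rewrite -[_ == _]/(coprimez _ _) coprimezE /= coprime_sym prime_coprime.
(* With D^l = D + l e, the equation [e1] says that D (y^l - y) is l times the first bracket; the
   Bezout relation u D + v l = 1 removes the factor D. *)
exists (u%:~R * (beta - e%:R * y ^+ l) + v%:~R * (y ^+ l - y)).
  have iyl := integral_exp l iy.
  apply: integral_add; apply: integral_mul; try exact: integral_int; apply: integral_sub => //.
  by apply: integral_mul => //; apply: integral_nat.
have uvF : u%:~R * D%:R + v%:~R * l%:R = 1 :> F.
  by have := congr1 (fun c : int => c%:~R : F) uv; rewrite rmorphD !rmorphM.
have DlF : D%:R ^+ l = D%:R + l%:R * e%:R :> F by rewrite -natrX eE natrD natrM.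
transitivity ((u%:~R * D%:R + v%:~R * l%:R) * (y ^+ l - y)); first by rewrite uvF mul1r.
move: e1; rewrite DlF => e1.
have -> : l%:R * (u%:~R * (beta - e%:R * y ^+ l) + v%:~R * (y ^+ l - y)) =
  u%:~R * (l%:R * beta - l%:R * e%:R * y ^+ l) + v%:~R * l%:R * (y ^+ l - y) by ring.
rewrite -e1; by ring.
Qed.

(** The class of x modulo n is determined by the coefficients of D x in powers of theta, taken
    modulo n D. *)
Lemma integral_residues (F : fieldExtType rat) (n : nat) : (0 < n)%N ->
  exists (I : finType) (c : F -> I), forall x y, isint F x -> isint F y -> c x = c y ->
    exists2 z, isint F z & x - y = n%:R * z.
Proof.
have [th [h [mh irr ht gen]]] := primitive_integer F.
have [D D0 DP] := integral_denominator mh irr ht gen => n0.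
have /choice[G GP] : forall y : F, exists g : {poly int}, isint F y ->
    (size g < size h)%N /\ D%:R * y = (map_poly intr g).[th].
  move=> y; have [/DP[g sg gE]|ny] := pselect (isint F y); first by exists g.
  by exists 0.
have ith : isint F th by exists h.
case Dn : (n * D)%N => [|m]; first by move/eqP: Dn; rewrite muln_eq0 -!leqn0 leqNgt n0 leqNgt D0.
exists {ffun 'I_(size h) -> 'I_m.+1},
  (fun x => [ffun i : 'I__ => inord (absz ((G x)`_i %% m.+1%:Z)%Z)]).
move=> x y ix iy /ffunP e.
have [sx xE] := GP x ix; have [sy yE] := GP y iy.
pose b := map_poly (divz^~ (n * D)%N%:Z) (G x - G y).
have bE : (n * D)%N%:Z *: b = G x - G y.
  apply: map_poly_divzK; apply/polyOverP => i.
  have [lti|gei] := ltnP i (size h); last first.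
    by rewrite coefB !nth_default ?subrr ?dvdz0 // ltnW // (leq_trans _ gei).
  have := congr1 val (e (Ordinal lti)); rewrite !ffunE /= !inordK; first last.
  - by rewrite -ltz_nat gez0_abs ?modz_ge0 // ltz_pmod.
  - by rewrite -ltz_nat gez0_abs ?modz_ge0 // ltz_pmod.
  move/(congr1 Posz); rewrite !gez0_abs ?modz_ge0 // => /eqP.
  by rewrite eqz_mod_dvd coefB Dn.
exists (map_poly intr b).[th]; first exact: integral_horner_int.
have D0' : D%:R != 0 :> F.
  by rewrite -(rmorph_nat (in_alg F)) fmorph_eq0 pnatr_eq0 -lt0n.
apply: (mulfI D0'); rewrite mulrBr xE yE.
have := congr1 (fun p : {poly int} => (map_poly intr p).[th]) bE.
rewrite /= rmorphB map_polyZ !hornerE => <-.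
by rewrite -[RHS]/(D%:R * n%:R * _) -natrM mulnC.
Qed.

(** If N / x is integral and x = l z, then N / l = (N / x) z is integral and rational, hence an
    integer. *)
Lemma int_multiple_bound (F : fieldExtType rat) (x : F) : x != 0 ->
  exists2 N : nat, (0 < N)%N & forall (l : nat) z, isint F z -> x = l%:R * z -> (l %| N)%N.
Proof.
move=> x0; have [N N0 iN] := int_multiple_integral x^-1.
exists N => // l z iz xE.
have l0 : l%:R != 0 :> rat.
  apply: contra_neq x0 => l0; rewrite xE -(rmorph_nat (in_alg F)) l0 rmorph0 mul0r //.
have : (N%:R / l%:R : rat) \is a Num.int.
  apply: (@rat_integral_int F).
  have -> : (N%:R / l%:R)%:A = (N%:R * x^-1) * z :> F.
    rewrite -[_%:A]/(in_alg F _) fmorph_div !rmorph_nat.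
    have l0' : l%:R != 0 :> F by rewrite -(rmorph_nat (in_alg F)) fmorph_eq0.
    by apply: (mulIf l0'); rewrite /= divfK // -!mulrA [z * _]mulrC -xE mulVf // mulr1.
  exact: integral_mul.
case/intrP => c; move/(canRL (divfK l0)) => e.
have : (N%:Z = c * l%:Z)%Z by apply: (@intr_inj rat); rewrite intrM.
by move=> eN; have : (l%:Z %| N%:Z)%Z by rewrite eN dvdz_mull.
Qed.

(** * Integers of etale algebras *)

Section Etale.
Variable K : etaleAlg.
Implicit Types x y : integers K.

Lemma etale_ext (x y : K) : (forall i, x i = y i) -> x = y.
Proof. exact: functional_extensionality_dep. Qed.

Lemma integers_ext x y : (forall i, etale_val x i = etale_val y i) -> x = y.
Proof. by move=> /etale_ext; apply: val_inj. Qed.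

Lemma integers_integral x i : isint (etale_factor i) (etale_val x i).
Proof. by have /asboolP := etale_valP x. Qed.

Lemma integers_of (z : forall i, @etale_factor K i) :
  (forall i, isint _ (z i)) -> exists x, etale_val x = z.
Proof.
move=> iz; have zP : (z : K) \in @etale_int K by apply/asboolP.
by exists (Integers zP).
Qed.

Lemma etale_valD x y i : etale_val (x + y) i = etale_val x i + etale_val y i.
Proof. by []. Qed.
Lemma etale_valB x y i : etale_val (x - y) i = etale_val x i - etale_val y i.
Proof. by []. Qed.
Lemma etale_valM x y i : etale_val (x * y) i = etale_val x i * etale_val y i.
Proof. by []. Qed.
Lemma etale_val_nat n i : etale_val (n%:R : integers K) i = n%:R.
Proof. by elim: n => // n IHn; rewrite -natr1 etale_valD IHn natr1. Qed.
Lemma etale_valX x n i : etale_val (x ^+ n) i = etale_val x i ^+ n.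
Proof. by elim: n => // n IHn; rewrite !exprS etale_valM IHn. Qed.

Lemma etale_val_int (c : int) i : etale_val (c%:~R : integers K) i = c%:~R.
Proof.
case: c => n; first exact: etale_val_nat.
by rewrite NegzE !rmorphN; congr (- _); apply: etale_val_nat.
Qed.

Lemma integers_dvd_nat x n :
  (forall i, exists2 z, isint _ z & etale_val x i = n%:R * z) ->
  exists z, x = n%:R * z.
Proof.
move=> xn; have xn' i : exists z, isint (etale_factor i) z /\ etale_val x i = n%:R * z.
  by have [z] := xn i; exists z.
pose z i := projT1 (cid (xn' i)).
have [|z' z'E] := @integers_of z; first by move=> i; apply: (projT2 (cid (xn' i))).1.
exists z'; apply: integers_ext => i.
by rewrite etale_valM etale_val_nat z'E (projT2 (cid (xn' i))).2.
Qed.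

Lemma natr_integers_inj (n : nat) x y : (0 < n)%N -> n%:R * x = n%:R * y -> x = y.
Proof.
move=> n0 e; apply: integers_ext => i.
have : etale_val (n%:R * x) i = etale_val (n%:R * y) i by rewrite e.
rewrite !etale_valM !etale_val_nat; apply: mulfI.
by rewrite -(rmorph_nat (in_alg (etale_factor i))) fmorph_eq0 pnatr_eq0 -lt0n.
Qed.

Lemma integers_residues (n : nat) : (0 < n)%N ->
  exists (I : finType) (c : integers K -> I),
    forall x y, c x = c y -> exists z, x - y = n%:R * z.
Proof.
move=> n0; have H i := integral_residues (@etale_factor K i) n0.
pose I i := projT1 (cid (H i)); pose HI i := projT2 (cid (H i)).
pose c i := projT1 (cid (HI i)); pose Hc i := projT2 (cid (HI i)).
exists {dffun forall i, I i}, (fun x => [ffun i => c i (etale_val x i)] : {dffun forall i, I i}).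
move=> x y /ffunP e; apply: integers_dvd_nat => i.
by apply: (Hc i); try apply: integers_integral; have := e i; rewrite !ffunE.
Qed.

Lemma integers_reps (n : nat) : (0 < n)%N ->
  exists s : seq (integers K), forall x, exists2 r, r \in s & exists z, x - r = n%:R * z.
Proof.
move=> /integers_residues[I [c cP]].
have /choice[r rP] : forall i : I, exists r, forall x, c x = i -> c r = i.
  move=> i; have [[x xi]|H] := pselect (exists x, c x = i); first by exists x.
  by exists 0 => x xi; case: H; exists x.
exists [seq r i | i <- enum I] => x.
by exists (r (c x)); [apply/map_f/mem_enum|apply: cP; rewrite (rP (c x) x)].
Qed.

Lemma integers_annihilator x : exists2 P : {poly int}, P \is monic & (map_poly intr P).[x] = 0.
Proof.
have /choice[P PP] : forall i, exists P : {poly int}, P \is monic /\ root (map_poly intr P) (etale_val x i).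
  by move=> i; have [P] := integers_integral x i; exists P.
exists (\prod_i P i); first by apply: monic_prod => i _; apply: (PP i).1.
have valh (Q : {poly int}) i : etale_val (map_poly intr Q).[x] i = (map_poly intr Q).[etale_val x i].
  rewrite !(horner_map_intr _ (leqnn _)).
  rewrite (big_morph (fun z : integers K => etale_val z i) (id1 := 0) (op1 := +%R)) //.
  by apply: eq_bigr => j _; rewrite etale_valM etale_valX etale_val_int.
apply: integers_ext => i; rewrite valh (bigD1 i) //= rmorphM hornerM.
by rewrite (rootP (PP i).2) mul0r.
Qed.

Lemma integers_dvd_inf x :
  (forall B, exists2 l : nat, (B < l)%N & exists z, x = l%:R * z) -> x = 0.
Proof.
move=> H; apply: integers_ext => i; apply/eqP; apply: contraT => x0.
have [N N0 NP] := int_multiple_bound x0.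
have [l lN [z xz]] := H N.
have : (l %| N)%N.
  by apply: (NP l _ (integers_integral z i)); rewrite xz etale_valM etale_val_nat.
by move/(dvdn_leq N0); rewrite leqNgt lN.
Qed.

Lemma etale_denominator (x : K) : exists2 n : nat, (0 < n)%N &
  exists y : integers K, etale_val y = n%:R * x.
Proof.
have /choice[n nP] : forall i, exists n : nat, (0 < n)%N /\ isint _ (n%:R * x i).
  by move=> i; have [n] := int_multiple_integral (x i); exists n.
exists (\prod_i n i)%N; first by apply: prodn_gt0 => i; apply: (nP i).1.
apply: (@integers_of ((\prod_i n i)%N%:R * x)) => i.
have -> : ((\prod_i n i)%N%:R * x) i = (\prod_i n i)%N%:R * x i.
  congr (_ * _); elim: (\prod_i n i)%N => // m IHm.
  by rewrite -!natr1 -IHm.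
rewrite (bigD1 i) //= mulnC natrM -mulrA.
apply: integral_mul; [exact: integral_nat|exact: (nP i).2].
Qed.

End Etale.

Lemma etale_split_primes (K L : etaleAlg) B :
  exists l : nat, [/\ prime l, (B < l)%N,
    forall y : integers K, exists z, y ^+ l - y = l%:R * z &
    forall y : integers L, exists z, y ^+ l - y = l%:R * z].
Proof.
have model (M : etaleAlg) : exists (hs : seq {poly int}) (D : nat), [/\ (0 < D)%N,
    {in hs, forall h, h \is monic /\ irreducible_poly (map_poly intr h : {poly rat})} &
    forall l, prime l -> ~~ (l %| D)%N ->
      {in hs, forall h, (map_poly intr h : {poly 'F_l}) %| 'X^l - 'X} ->
      forall y : integers M, exists z, y ^+ l - y = l%:R * z].
  have /choice[h /choice[D hD]] := fun i => integral_frobenius (@etale_factor M i).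
  exists [seq h i | i <- enum 'I_(etale_rank M).+1], (\prod_i D i)%N; split.
  - by apply: prodn_gt0 => i; case: (hD i).
  - by move=> _ /mapP[i _ ->]; case: (hD i).
  - move=> l pl lD hl y; apply: integers_dvd_nat => i.
    rewrite etale_valB etale_valX; have [_ _ _] := hD i; apply => //.
    + by apply: contra lD => lDi; rewrite (bigD1 i) //= dvdn_mulr.
    + by apply: hl; apply/map_f/mem_enum.
    + exact: integers_integral.
have [hK [DK [DK0 hKP lK]]] := model K; have [hL [DL [DL0 hLP lL]]] := model L.
have [|l [pl lB hl]] := @split_primes (hK ++ hL) _ (B + DK + DL).
  by move=> h; rewrite mem_cat => /orP[/hKP|/hLP].
have lD D : (0 < D)%N -> (D <= B + DK + DL)%N -> ~~ (l %| D)%N.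
  move=> D0 le; apply/negP => /(dvdn_leq D0).
  by rewrite leqNgt (leq_ltn_trans le).
exists l; split => //.
- by apply: leq_ltn_trans lB; rewrite -addnA leq_addr.
- apply: lK => //; first by apply: lD => //; rewrite -addnA addnCA leq_addr.
  by move=> h hh; apply: hl; rewrite mem_cat hh.
- apply: lL => //; first by apply: lD => //; rewrite leq_addl.
  by move=> h hh; apply: hl; rewrite mem_cat hh orbT.
Qed.

(** * Powers of maximal ideals *)

HB.instance Definition _ (O : comNzRingType) := gen_eqMixin (maxideal O).

Section MaxIdeal.
Variable O : comNzRingType.
Implicit Types (m p q : maxideal O) (x y a : O).

Lemma maxideal0 m : m 0.
Proof. by case: (maxideal_idealr m). Qed.
Lemma maxideal1 m : ~ m 1.
Proof. by case: (maxideal_idealr m) => _ /negP. Qed.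
Lemma maxidealMD m a x y : m x -> m y -> m (a * x + y).
Proof. by case: (maxideal_idealr m) => _ _ H mx my; apply: H. Qed.
Lemma maxidealM m a x : m x -> m (a * x).
Proof. by move=> mx; rewrite -[_ * _]addr0; apply: maxidealMD => //; apply: maxideal0. Qed.
Lemma maxidealD m x y : m x -> m y -> m (x + y).
Proof. by move=> mx; rewrite -[x]mul1r; apply: maxidealMD. Qed.
Lemma maxidealN m x : m x -> m (- x).
Proof. by move=> mx; rewrite -mulN1r; apply: maxidealM. Qed.
Lemma maxidealB m x y : m x -> m y -> m (x - y).
Proof. by move=> mx my; apply: maxidealD => //; apply: maxidealN. Qed.

Lemma maxideal_ext p q : (forall x, p x -> q x) -> p = q.
Proof.
move=> pq; have qp x : q x -> p x by apply: (maxideal_max (maxideal_idealr q)).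
have e : maxideal_pred p = maxideal_pred q.
  by apply/funext => x; apply/idP/idP; [apply: pq|apply: qp].
case: p q e {pq qp} => [p p1 p2] [q q1 q2] /= e; move: p1 p2 q1 q2; rewrite e => *.
by congr MaxIdeal; apply: Prop_irrelevance.
Qed.

Lemma maxideal_inv m x : ~ m x -> exists2 y, m y & exists a, a * x + y = 1.
Proof.
move=> mx.
pose J : O -> bool := fun z => `[< exists2 y, m y & exists a, a * x + y = z >].
have [[y my [a e]]|J1] := pselect (exists2 y, m y & exists a, a * x + y = 1).
  by exists y => //; exists a.
case: mx; have Jid : idealr_closed J.
  split.
  - by apply/asboolP; exists 0; [apply: maxideal0|exists 0; rewrite mul0r addr0].
  - by apply/asboolP.
  - move=> c _ _ /asboolP[y my [a <-]] /asboolP[z mz [b <-]]; apply/asboolP.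
    by exists (c * y + z); [apply: maxidealMD|exists (c * a + b); ring].
apply: (maxideal_max Jid) => [z mz|].
  by apply/asboolP; exists z => //; exists 0; rewrite mul0r add0r.
by apply/asboolP; exists 0; [apply: maxideal0|exists 1; rewrite mul1r addr0].
Qed.

Lemma maxideal_prime m x y : m (x * y) -> m x \/ m y.
Proof.
move=> mxy; have [|/maxideal_inv[z mz [a e]]] := pselect (m x); [by left|right].
have -> : y = a * (x * y) + y * z by rewrite -[LHS]mulr1 -e; ring.
by apply: maxidealD; apply: maxidealM.
Qed.

Lemma mexp0 m n : mexp m n 0. Proof. exact: ideal_exp0. Qed.
Lemma mexpN m n x : mexp m n x -> mexp m n (- x). Proof. exact: ideal_expN. Qed.
Lemma mexpD m n x y : mexp m n x -> mexp m n y -> mexp m n (x + y).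
Proof. exact: ideal_expD. Qed.
Lemma mexpB m n x y : mexp m n x -> mexp m n y -> mexp m n (x - y).
Proof. by move=> mx my; apply: mexpD => //; apply: mexpN. Qed.
Lemma mexpM m n a x : mexp m n x -> mexp m n (a * x).
Proof.
by move=> mx; rewrite -[_ * _]addr0; apply: (ideal_exp_ideal _ _).2 => //; apply: mexp0.
Qed.
Lemma mexpMr m n a x : mexp m n x -> mexp m n (x * a).
Proof. by rewrite mulrC; apply: mexpM. Qed.

Lemma mexp_le m n k x : (n <= k)%N -> mexp m k x -> mexp m n x.
Proof.
by move/subnK => <-; elim: (k - n)%N => // j IHj /ideal_exp_dec.
Qed.

Lemma mexpS m n a x : m a -> mexp m n x -> mexp m n.+1 (a * x).
Proof.
move=> ma mx; exists [:: (a, x)]; last by rewrite big_seq1.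
by move=> u; rewrite inE => /eqP ->.
Qed.

Lemma mexp1P m x : mexp m 1 x <-> m x.
Proof.
split=> [[s sP ->]|mx]; last by rewrite -[x]mulr1; apply: mexpS.
rewrite big_seq; elim/big_ind: _ => [|y z|u /sP[mu _]]; first exact: maxideal0.
  exact: maxidealD.
by rewrite mulrC; apply: maxidealM.
Qed.

Lemma mexpX m n x : m x -> mexp m n (x ^+ n).
Proof. by move=> mx; elim: n => // n IHn; rewrite exprS; apply: mexpS. Qed.

Lemma mexpXle m n k x : (n <= k)%N -> m x -> mexp m n (x ^+ k).
Proof. by move=> nk mx; apply: mexp_le nk (mexpX _ mx). Qed.

Lemma mexp_sum (I : Type) (s : seq I) (P : pred I) (F : I -> O) m n :
  (forall i, P i -> mexp m n (F i)) -> mexp m n (\sum_(i <- s | P i) F i).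
Proof.
by move=> H; elim/big_ind: _ => //; [apply: mexp0|move=> *; apply: mexpD].
Qed.

Lemma maxideal_comax p q : p != q -> exists a, p a /\ q (1 - a).
Proof.
move=> /eqP pq; have [x px qx] : exists2 x, p x & ~ q x.
  apply: contrapT => H; apply: pq; apply: maxideal_ext => x px.
  by apply: contrapT => qx; apply: H; exists x.
have [y qy [a e]] := maxideal_inv qx; exists (a * x); split; first exact: maxidealM.
by rewrite -e addrC addKr.
Qed.

Lemma mexp_comax p q n k : p != q -> exists a, mexp p n a /\ mexp q k (1 - a).
Proof.
move=> /maxideal_comax[a [pa qa]].
have [b [pb qb]] : exists b, mexp p n b /\ q (1 - b).
  elim: n => [|n [b [pb qb]]]; first by exists 1; rewrite subrr; split=> //; apply: maxideal0.
  exists (a * b); split; first exact: mexpS.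
  have -> : 1 - a * b = (1 - a) + a * (1 - b) by ring.
  by apply: maxidealD => //; apply: maxidealM.
exists (1 - (1 - b) ^+ k); split; last by rewrite opprB addrC subrK; apply: mexpX.
elim: k => [|k IHk]; first by rewrite expr0 subrr; apply: mexp0.
have -> : 1 - (1 - b) ^+ k.+1 = (1 - (1 - b) ^+ k) + (1 - b) ^+ k * b by rewrite exprSr; ring.
by apply: mexpD => //; apply: mexpM.
Qed.

Lemma crt_idempotent (s : seq (maxideal O)) (e : maxideal O -> nat) p :
  exists a, mexp p (e p) (1 - a) /\
    forall q, q \in s -> q != p -> mexp q (e q) a.
Proof.
elim: s => [|q s [a [pa sa]]]; first by exists 1; rewrite subrr; split=> //; apply: mexp0.
have [->|qp] := eqVneq q p.
  exists a; split => // r; rewrite inE => /predU1P[->|]; last exact: sa.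
  by rewrite eqxx.
have [b [qb pb]] := mexp_comax (e q) (e p) qp.
exists (b * a); split.
  have -> : 1 - b * a = (1 - b) + b * (1 - a) by ring.
  by apply: mexpD => //; apply: mexpM.
move=> r; rewrite inE => /predU1P[-> _|rs rp]; first exact: mexpMr.
by apply: mexpM; apply: sa.
Qed.

Lemma crt_solution (s : seq (maxideal O)) (e : maxideal O -> nat) (c : maxideal O -> O) :
  uniq s -> exists x, forall p, p \in s -> mexp p (e p) (x - c p).
Proof.
move=> us; have /choice[i iP] := crt_idempotent s e.
exists (\sum_(p <- s) i p * c p) => p ps; rewrite (bigD1_seq p) //= addrAC.
apply: mexpD.
  have -> : i p * c p - c p = - ((1 - i p) * c p) by ring.
  by apply: mexpN; apply: mexpMr; apply: (iP p).1.
rewrite big_seq_cond; apply: mexp_sum => q /andP[qs qp]; apply: mexpMr.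
by apply: (iP q).2 => //; rewrite eq_sym.
Qed.

(** Zorn's lemma is applied to sets J through the ideal J union I, so that the empty chain needs no
    separate treatment. *)
Lemma maxideal_exists (I : set O) : I 0 -> ~ I 1 ->
  (forall a x y, I x -> I y -> I (a * x + y)) ->
  exists m, forall x, I x -> m x.
Proof.
move=> I0 I1 Il.
pose P (J : set O) := ~ (J `|` I) 1 /\
  forall a x y, (J `|` I) x -> (J `|` I) y -> (J `|` I) (a * x + y).
have [|M [[M1 Ml] Mmax]] := @Zorn_bigcup _ P.
  move=> F FP tot; split; first by case=> // -[J FJ J1]; apply: (FP J FJ).1; left.
  move=> a x y Fx Fy.
  have [[J [FJ Jx Jy]]|noJ] := pselect (exists J, [/\ F J, (J `|` I) x & (J `|` I) y]).
    have [Jxy|Ixy] := (FP J FJ).2 a x y Jx Jy; last by right.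
    by left; exists J.
  case: Fx Fy => [[J FJ Jx]|Ix] [[J' FJ' Jy]|Iy].
  - case: (tot J J' FJ FJ') => sJ; case: noJ; [exists J'|exists J]; split => //; left => //; exact: sJ.
  - by case: noJ; exists J; split => //; [left|right].
  - by case: noJ; exists J'; split => //; [right|left].
  - by right; apply: Il.
pose m x : bool := `[< (M `|` I) x >].
have mid : idealr_closed m.
  split; [by apply/asboolP; right|by apply/asboolP|].
  by move=> a x y /asboolP mx /asboolP my; apply/asboolP; apply: Ml.
have mmax (J : O -> bool) : idealr_closed J -> {subset m <= J} -> {subset J <= m}.
  move=> [J0 J1 Jl] mJ x Jx; apply/asboolP; left; apply: contrapT => Mx.
  have MJ : M `<=` [set` J] by move=> y My; apply: mJ; apply/asboolP; left.
  apply: (Mmax [set` J]).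
    by split=> // JM; apply: Mx; apply: JM.
  have JI : [set` J] `|` I = [set` J].
    by apply/setUidPl => y Iy; apply: mJ; apply/asboolP; right.
  rewrite /P JI; split; first exact/negP.
  by move=> a y z; apply: Jl.
by exists (MaxIdeal mid mmax) => x Ix; apply/asboolP; right.
Qed.
End MaxIdeal.

(** * Primes of an étale algebra and their residue rings *)

Section EtalePrimes.
Variable K : etaleAlg.
Implicit Types (x y a : integers K) (p : prime_of K).

(* Clear denominators in a monic equation for [a], which behaves like 1/n modulo [I]. *)
Lemma int_of_inverse (I : set (integers K)) (n : nat) a :
    I 0 -> (forall b x y, I x -> I y -> I (b * x + y)) -> I (n%:R * a - 1) ->
  exists N : int, I N%:~R /\ (n%:Z %| N - 1)%Z.
Proof.
move=> I0 Il Ia.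
have IM b x : I x -> I (b * x) by move=> Ix; rewrite -[_ * _]addr0; apply: Il.
have [P mP Pa] := integers_annihilator a.
have P0 : (0 < size P)%N by rewrite size_poly_gt0 monic_neq0.
set d := (size P).-1; have sP : size P = d.+1 by rewrite prednK.
have Pd : P`_d = 1 by have := monicP mP; rewrite lead_coefE.
(* This is n^d P(a) with n a replaced by 1, so it lies in I; P being monic, every term except the
   last, which is 1, is a multiple of n. *)
pose N : int := \sum_(i < d.+1) P`_i * n%:Z ^+ (d - i).
have pow i : I ((n%:R * a) ^+ i - 1).
  elim: i => [|i IHi]; first by rewrite subrr.
  have -> : (n%:R * a) ^+ i.+1 - 1 =
    n%:R * a * ((n%:R * a) ^+ i - 1) + (n%:R * a - 1) by rewrite exprS; ring.
  exact: Il.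
exists N; split.
  have -> : N%:~R = - \sum_(i < d.+1) (P`_i * n%:Z ^+ (d - i))%:~R * ((n%:R * a) ^+ i - 1) :> integers K.
    apply/eqP; rewrite eq_sym -subr_eq0 -opprD oppr_eq0 /N rmorph_sum -big_split /=.
    rewrite -[X in _ == X](mulr0 (n%:R ^+ d)) -[X in _ == _ * X]Pa.
    rewrite (horner_map_intr _ (leqnn _)) sP mulr_sumr; apply/eqP/eq_bigr => i _.
    rewrite mulrBr mulr1 subrK rmorphM rmorphXn /= exprMn.
    have -> : n%:R ^+ d = n%:R ^+ (d - i) * n%:R ^+ i :> integers K.
      by rewrite -exprD subnK // -ltnS.
    by rewrite -[n%:~R]/(n%:R : integers K); ring.
  rewrite -mulN1r; apply/IM; elim/big_ind: _ => // [x y Ix Iy|i _].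
    by rewrite -[x]mul1r; apply: Il.
  exact: IM.
rewrite /N big_ord_recr /= subnn mulr1 Pd addrK; apply: rpred_sum => i _.
by rewrite dvdz_mull // -(subnSK (ltn_ord i)) exprS dvdz_mulr.
Qed.

Lemma integers_int_eq0 (N : int) : N%:~R = 0 :> integers K -> N = 0.
Proof.
move=> N0; have : etale_val (N%:~R : integers K) ord0 = 0 by rewrite N0.
by rewrite etale_val_int -(rmorph_int (in_alg _)) => /eqP; rewrite fmorph_eq0 intr_eq0 => /eqP.
Qed.

(** If 2 is not in p, it is invertible modulo p, and the inverse yields an odd, hence nonzero,
    integer in p. *)
Lemma prime_pos_nat p : exists2 n : nat, (0 < n)%N & p n%:R.
Proof.
have [p2|/maxideal_inv[y py [a e]]] := pselect (p 2%:R); first by exists 2%N.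
have [|||N [pN dN]] := @int_of_inverse [set x | p x] 2 a; first exact: maxideal0.
- by move=> b x z; apply: maxidealMD.
- by rewrite /= -[X in _ - X]e mulrC opprD addrA subrr add0r; apply: maxidealN.
have N0 : N != 0 by apply: contraTneq dN => ->; rewrite sub0r dvdzE.
exists `|N|%N; first by rewrite absz_gt0.
have -> : `|N|%N%:R = (Num.sg N)%:~R * N%:~R :> integers K.
  by rewrite -rmorphM /= -normrEsg -abszE.
exact: maxidealM.
Qed.

Lemma mexp_pos_nat p n : exists2 N : nat, (0 < N)%N & mexp p n N%:R.
Proof.
have [N N0 pN] := prime_pos_nat p.
by exists (N ^ n)%N; [rewrite expn_gt0 N0|rewrite natrX; apply: mexpX].
Qed.

Lemma mexp_reps p n :
  exists s : seq (integers K), forall x, exists2 r, r \in s & mexp p n (x - r).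
Proof.
have [N N0 pN] := mexp_pos_nat p n; have [s sP] := integers_reps K N0.
by exists s => x; have [r rs [z e]] := sP x; exists r => //; rewrite e; apply: mexpMr.
Qed.

Lemma prime_coprime_absurd p l n : prime l -> ~~ (l %| n)%N -> p l%:R -> p n%:R -> False.
Proof.
move=> pl ln pl1 pn; apply: (@maxideal1 _ p).
have [u [v uv]] := Bezoutz l%:Z n%:Z.
have g1 : gcdz l n = 1 :> int.
  by apply/eqP; rewrite -[_ == _]/(coprimez _ _) coprimezE /= prime_coprime.
have -> : 1 = u%:~R * l%:R + v%:~R * n%:R :> integers K.
  by have := congr1 (fun c : int => c%:~R : integers K) uv; rewrite g1 rmorphD !rmorphM.
by apply: maxidealMD => //; apply: maxidealM.
Qed.

Lemma large_prime_notin (s : seq (prime_of K)) : exists B, forall l, prime l -> (B < l)%N ->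
  forall p, p \in s -> ~ p l%:R.
Proof.
elim: s => [|p s [B BP]]; first by exists 0%N.
have [n n0 pn] := prime_pos_nat p.
exists (B + n)%N => l pl Bl q; rewrite inE => /predU1P[-> pl1|qs].
  apply: (prime_coprime_absurd pl _ pl1 pn).
  by apply/negP => /(dvdn_leq n0); rewrite leqNgt (leq_ltn_trans (leq_addl _ _) Bl).
by apply: BP => //; apply: leq_ltn_trans Bl; apply: leq_addr.
Qed.

Lemma proper_nat_ideal l z : prime l -> 1 <> l%:R * z :> integers K.
Proof.
move=> pl e; have [|||N [/= N0 dN]] := @int_of_inverse [set 0] l z.
- by [].
- by move=> b x y -> ->; rewrite mulr0 addr0.
- by rewrite /= -e subrr.
move: dN; rewrite (integers_int_eq0 N0) sub0r dvdzE /= dvdn1 => /eqP l1.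
by rewrite l1 in pl.
Qed.

Lemma prime_above_nat l : prime l -> exists p : prime_of K, p l%:R.
Proof.
move=> pl; have [|||p pP] := @maxideal_exists _ [set x : integers K | exists z, x = l%:R * z].
- by exists 0; rewrite mulr0.
- by case=> z; apply: proper_nat_ideal.
- by move=> a x y [z ->] [w ->]; exists (a * z + w); ring.
by exists p; apply: pP; exists 1; rewrite mulr1.
Qed.

(* Frobenius is the identity modulo [l]: the ring O/l is a product of copies of F_l. *)
Definition totally_split l := forall y, exists z, y ^+ l - y = l%:R * z.

(** The ring O/l is reduced: e = x^(l-1) acts as 1 on x modulo l. A maximal ideal containing l and 1
    - e would contain x, hence e and 1; so l and 1 - e generate the unit ideal, and multiplying by x
    shows that l divides x. *)
Lemma split_mem l x : prime l -> totally_split l ->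
  (forall p : prime_of K, p l%:R -> p x) -> exists z, x = l%:R * z.
Proof.
move=> pl sl xP; apply: contrapT => nx.
have l1 : (l = l.-1.+1)%N by rewrite prednK // prime_gt0.
have [z ez] := sl x.
pose e := x ^+ l.-1.
have ex : (1 - e) * x = - (l%:R * z).
  have xl : x ^+ l = x * e by rewrite {1}l1 exprS.
  by rewrite -ez xl; ring.
have [|||p pP] := @maxideal_exists _ [set y : integers K | exists a b, y = l%:R * a + (1 - e) * b].
- by exists 0, 0; rewrite !mulr0 addr0.
- case=> a [b ab]; apply: nx; exists (a * x - b * z).
  transitivity ((l%:R * a + (1 - e) * b) * x); first by rewrite -ab mul1r.
  transitivity (l%:R * a * x + ((1 - e) * x) * b); first by ring.
  by rewrite ex; ring.
- by move=> c y y' [a [b ->]] [a' [b' ->]]; exists (c * a + a'), (c * b + b'); ring.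
have px : p x.
  by apply: xP; apply: pP; exists 1, 0; rewrite mulr1 mulr0 addr0.
have pe : p (1 - e) by apply: pP; exists 0, 1; rewrite mulr0 add0r mulr1.
apply: (@maxideal1 _ p); rewrite -(subrK e 1); apply: maxidealD => //.
rewrite /e; have : (0 < l.-1)%N by rewrite -ltnS -l1 prime_gt1.
by case: (l.-1) => // k _; rewrite exprSr; apply: maxidealM.
Qed.

Lemma split_power l x n : totally_split l -> exists z, x ^+ (l ^ n) - x = l%:R * z.
Proof.
move=> sl; elim: n => [|n [z ez]]; first by exists 0; rewrite expr1 subrr mulr0.
have [w ew] := sl (x ^+ (l ^ n)).
exists (w + z); rewrite expnSr exprM mulrDr -ew -ez; ring.
Qed.

(** Modulo l the product of the x - i for i < l is a multiple of x^l - x, hence lies in the prime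
    ideal p, and so does one factor. *)
Lemma split_residue p l x : prime l -> totally_split l -> p l%:R ->
  exists a : nat, p (x - a%:R).
Proof.
move=> pl sl pl1.
pose h : {poly int} := \prod_(i < l) ('X - i%:R%:P).
have mX : ('X^l - 'X : {poly int}) \is monic.
  by rewrite monicE lead_coefDl ?lead_coefXn // size_polyN size_polyX size_polyXn ltnS prime_gt1.
have [a [b hE]] : exists a b : {poly int}, h = ('X^l - 'X) * a + l%:R *: b.
  apply: lift_dvdp_Fp => //; rewrite rmorphB /= map_polyXn map_polyX.
  have := finField_genPoly 'F_l; rewrite card_Fp // => ->.
  rewrite -big_enum /=; apply: uniq_roots_dvdp; last by rewrite uniq_rootsE enum_uniq.
  apply/allP => u _; rewrite /h rmorph_prod rootE horner_prod.
  have ul : (u < l)%N by rewrite -[X in (_ < X)%N](Fp_cast pl) ltn_ord.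
  rewrite (bigD1 (Ordinal ul)) //= rmorphB /= map_polyX map_polyC /= !hornerE.
  by rewrite rmorph_nat natr_Zp subrr mul0r.
have hx : p (\prod_(i < l) (x - i%:R)).
  have -> : \prod_(i < l) (x - i%:R) = (map_poly intr h).[x].
    rewrite /h rmorph_prod horner_prod; apply: eq_bigr => i _.
    by rewrite rmorphB /= map_polyX map_polyC /= !hornerE rmorph_nat.
  have [z ez] := sl x.
  rewrite hE rmorphD rmorphM /= map_polyZ rmorphB /= map_polyXn map_polyX !hornerE ez.
  rewrite rmorph_nat -mulrA; apply: maxidealD; rewrite mulrC; exact: maxidealM.
have : exists i : 'I_l, p (x - i%:R).
  apply: contrapT => nx; move: hx; apply/negP.
  elim/big_ind: _ => [|u v nu nv|i _].
  - by apply/negP/maxideal1.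
  - by apply/negP => /maxideal_prime[]; apply/negP.
  - by apply/negP => pi; apply: nx; exists i.
by case=> i pi; exists i.
Qed.

End EtalePrimes.

(** * Completions and Haar measure *)

Section Adic.
Variables (O : comNzRingType) (m : maxideal O).
Implicit Types (x y z : adic m) (a b : O).

Lemma adic_ofE a b n : adic_of m a n = adic_of m b n <-> mexp m n (a - b).
Proof.
split=> [e|ab].
  have : adic_of m b n a by rewrite -e /= /coset /= subrr; apply: mexp0.
  by [].
rewrite /=; apply/seteqP; split=> c; rewrite /coset /= => H.
- by have := mexpD H ab; rewrite addrA subrK.
- by have := mexpB H ab; rewrite opprB addrA subrK.
Qed.

Lemma adic_approx x n : exists a, x n = adic_of m a n.
Proof. by have [a ->] := adic_cosetP x n; exists a. Qed.

Lemma adic_eq_le x y n k : (k <= n)%N -> x n = y n -> x k = y k.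
Proof.
move=> kn e; have sub z : z n `<=` z k.
  move: kn => /subnK <-; elim: (n - k)%N => [|j IHj]; first by [].
  by rewrite addSn => w /adic_compat/IHj.
have [a ea] := adic_approx x k; have [b eb] := adic_approx y k.
have [c ec] := adic_approx x n.
have cx : x n c by rewrite ec /= /coset /= subrr; apply: mexp0.
have xc := sub x c cx; rewrite e in cx; have yc := sub y c cx.
rewrite ea eb in xc yc *; apply/adic_ofE.
have -> : a - b = (c - b) - (c - a) by ring.
exact: mexpB.
Qed.

Lemma adic_ofD a b : adic_of m (a + b) = adic_of m a + adic_of m b.
Proof. by apply: adic_ext => n; rewrite [RHS]/= coset_exp_add. Qed.

Lemma adic_ofN a : adic_of m (- a) = - adic_of m a.
Proof. by apply: adic_ext => n; rewrite [RHS]/= coset_exp_opp. Qed.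

Lemma adic_ofB a b : adic_of m (a - b) = adic_of m a - adic_of m b.
Proof. by rewrite adic_ofD adic_ofN. Qed.

Lemma adic_levelD x x' y y' n : x n = x' n -> y n = y' n -> (x + y) n = (x' + y') n.
Proof. by move=> e e'; rewrite /= e e'. Qed.

Lemma adic_levelN x x' n : x n = x' n -> (- x) n = (- x') n.
Proof. by move=> e; rewrite /= e. Qed.

Definition level (R : set (adic m)) k := forall x y, x k = y k -> R x -> R y.

Lemma level_mem R k a b : level R k -> mexp m k (a - b) ->
  R (adic_of m a) -> R (adic_of m b).
Proof. by move=> Rk ab; apply: Rk; apply/adic_ofE. Qed.

Lemma adic_openP (U : set (adic m)) : open U <-> adic_open U.
Proof. by []. Qed.

(** Finitely many balls inside R cover R, and the largest of their levels serves for all points. *)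
Lemma clopen_level (R : set (adic m)) : compact R -> open R -> exists k, level R k.
Proof.
rewrite compact_cover => cR oR.
have /choice[n nP] : forall x, exists n, R x -> forall y, y n = x n -> R y.
  move=> x; have [Rx|nRx] := pselect (R x); last by exists 0%N.
  have [n nR] := oR x Rx; exists n => _ y e; apply: nR => k kn.
  exact: adic_eq_le e.
have [|x Rx|D DR cov] := cR (adic m) R (fun x => [set y | y (n x) = x (n x)]).
- move=> x _; apply/adic_openP => y /= e; exists (n x) => z ez; rewrite /= -e; exact: ez.
- by exists x.
exists (\max_(x <- finmap.enum_fset D) n x)%N => x y e Rx.
have [z Dz /= xz] := cov x Rx.
have Rz : R z by have := DR z Dz; rewrite inE.
apply: (nP z Rz); rewrite -xz; apply/esym; apply: (adic_eq_le _ e).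
by apply: (leq_bigmax_seq (F := n) (P := predT)); first exact: Dz.
Qed.

End Adic.

(** * Averaging over translates *)

Section Haar.
Variables (rT : realType) (O : comNzRingType) (m : maxideal O).
Variable mu : haar_measure rT m.
Local Open Scope ereal_scope.

Lemma translate_open d (R : set (adic m)) : open R -> open (translate d R).
Proof.
move=> oR; apply/adic_openP => _ [r Rr <-]; have [n nR] := oR r Rr; exists n => y ye.
exists (- d + y)%R; last by rewrite addrA subrr add0r.
apply: nR => k kn; rewrite -[r in RHS]add0r -(addNr d) -addrA.
by apply: adic_levelD => //; apply: ye.
Qed.

Lemma adic_open_measurable (R : set (adic m)) : open R ->
  measurable (R : set (adic_borel m)).
Proof. by move=> oR; apply: sub_sigma_algebra. Qed.

(* Averaging over all translates of [R]: the integral counts, with multiplicity,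
   the points of the sets [E j] caught by a random translate. *)
Lemma haar_avoid (R : set (adic m)) (n s : nat) (eps : rT) (E : 'I_n -> seq O) :
    open R -> (0 < n)%N -> (forall j, size (E j) <= s)%N ->
    mu R <= eps%:E -> (2 * s%:R * eps < 1)%R ->
  exists d : adic m,
    (2 * #|[pred j | `[< exists2 e, e \in E j & R (adic_of m e - d)%R >]]| < n)%N.
Proof.
move=> oR n0 Es mR epss; apply: contrapT => H.
pose flat := flatten [seq E j | j <- enum 'I_n].
pose B (e : O) : set (adic_borel m) := translate (- adic_of m e)%R R.
have mB e : measurable (B e) by apply: adic_open_measurable; apply: translate_open.
pose f (x : adic_borel m) : \bar rT := \sum_(e <- flat) (\1_(B e) x)%:E.
have oc x : (n <= 2 * #|[pred j | `[< exists2 e, e \in E j & R (adic_of m e + x)%R >]]|)%N.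
  rewrite leqNgt; apply/negP => lt; apply: H; exists (- x)%R.
  by rewrite opprK.
have indE e x : \1_(B e) x = `[< R (adic_of m e + x)%R >]%:R :> rT.
  rewrite indicE; congr ((nat_of_bool _)%:R); apply/idP/idP; rewrite inE.
    by move=> [r Rr <-]; apply/asboolP; rewrite addrA subrr add0r.
  by move=> /asboolP Rx; exists (adic_of m e + x)%R => //; rewrite addrA addNr add0r.
(* If every translate met at least half of the sets, the integrand would be at least n/2 everywhere,
   against an integral of at most n s eps < n/2. *)
have fle x : (n%:R / 2)%:E <= f x.
  rewrite /f; under eq_bigr do rewrite indE.
  rewrite sumEFin lee_fin -natr_sum ler_pdivrMr // mulrC -(natrM _ 2) ler_nat.
  apply: leq_trans (oc x) _; rewrite leq_mul2l /=.
  rewrite big_flatten big_map -sum1_card [leqLHS]big_mkcond /= big_enum /= [leqRHS](eq_bigl predT) //.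
  apply: leq_sum => j _; rewrite inE; case: asboolP => // -[e eE Re].
  by rewrite (big_rem e) //= (asboolT Re).
have intf : \int[mu]_x f x = (size flat)%:R%:E * mu R.
  rewrite /f ge0_integral_sum //.
  - transitivity (\sum_(e <- flat) mu R).
      apply: eq_bigr => e _; rewrite integral_indic // setIT.
      by apply: haar_invariant; apply: adic_open_measurable.
    by rewrite big_const_seq count_predT iter_addr_0 mule_natl.
  - by move=> e; apply/measurable_EFinP; apply: measurable_indic.
have sflat : (size flat <= n * s)%N.
  rewrite size_flatten /shape -map_comp sumnE big_map.
  apply: (@leq_trans (\sum_(j <- enum 'I_n) s)%N); first by apply: leq_sum => j _; apply: Es.
  by rewrite big_const_seq count_predT iter_addn_0 size_enum_ord mulnC.
have : (n%:R / 2)%:E <= \int[mu]_x f x.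
  have -> : (n%:R / 2)%:E = \int[mu]_x (cst (n%:R / 2)%:E x).
    by rewrite integral_cst // [X in _ * X](_ : _ = 1) ?mule1 //; exact: probability_setT.
  apply: ge0_le_integral => //.
  - by move=> x _; rewrite lee_fin divr_ge0.
  - apply: emeasurable_sum => e; apply/measurable_EFinP; exact: measurable_indic.
rewrite intf => /le_trans/(_ (lee_wpmul2l _ mR)); rewrite lee_fin ler0n => /(_ isT).
rewrite -EFinM lee_fin => le.
have : (n%:R / 2 <= (n * s)%N%:R * eps)%R.
  apply: le_trans le _; apply: ler_wpM2r; last by rewrite ler_nat.
  by have := le_trans (measure_ge0 mu R) mR; rewrite lee_fin.
have n0' : (0 < n%:R :> rT)%R by rewrite ltr0n.
rewrite natrM; move: epss n0' => {fle oc intf le}; nra.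
Qed.
End Haar.

(** * Sieves and local rules *)

Lemma translateP (V : zmodType) (d : V) (B : set V) y : translate d B y <-> B (y - d).
Proof.
split=> [[b Bb <-]|By]; first by rewrite addrAC subrr add0r.
by exists (y - d) => //; rewrite addrC subrK.
Qed.

Section SieveBasics.
Variables (K : etaleAlg) (R : sieve K).

Lemma sieve_level p : exists k, level (sieve_set R p) k.
Proof. by apply: clopen_level; [apply: sieve_compact|apply: sieve_open]. Qed.

Lemma admissibleP X : admissible R X <->
  forall p : prime_of K, exists d : adic p,
    forall x, X x -> ~ sieve_set R p (adic_of p x - d).
Proof.
by split=> aX p; have [d dX] := aX p; exists d => x /dX H; move/translateP: H => // /translateP.
Qed.

(** The form in which small measure of R_p is used: a strict minority of the family is hit. For n =
    1 this is plain avoidance; for larger n it allows the good indices at two primes to be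
    intersected. *)
Definition small_at (N : nat) (p : prime_of K) := forall n (E : 'I_n -> seq (integers K)),
  (0 < n)%N -> (forall j, (size (E j) <= N)%N) -> exists d : adic p,
  (2 * #|[pred j | `[< exists2 e, e \in E j & sieve_set R p (adic_of p e - d)%R >]]| < n)%N.

Lemma small_primes (rT : realType) (meas : forall p : prime_of K, haar_measure rT p)
    (N : nat) : non_large meas R ->
  exists s : seq (prime_of K), forall p, p \notin s -> small_at N p.
Proof.
(* This value of eps satisfies 2 N eps < 1, as averaging requires. *)
case=> _ fin; pose eps : rT := (2 * N%:R + 1)^-1.
have N0 : 0 <= N%:R :> rT by apply: ler0n.
have eps0 : 0 < eps by rewrite invr_gt0; lra.
have /finite_seqP[s sE] := fin eps eps0.
exists s => p ps n E n0 EN; apply: (@haar_avoid rT _ _ (meas p) _ n N eps E) => //.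
- exact: sieve_open.
- rewrite leNgt; apply/negP => lt; move/negP: ps; apply.
  by have : [set p | (eps%:E < meas p (sieve_set R p))%E] p by []; rewrite sE.
- by rewrite /eps ltr_pdivrMr; lra.
Qed.

Lemma seq_avoid (p : prime_of K) (E : seq (integers K)) :
  small_at (size E) p ->
  exists d : adic p, forall e, e \in E -> ~ sieve_set R p (adic_of p e - d).
Proof.
move=> /(_ 1%N (fun=> E)) [//|//|d]; rewrite ltnS leqn0 muln_eq0 /= => /eqP/card0_eq d0.
by exists d => e eE Re; have := d0 ord0; rewrite !inE => /negP; apply; apply/asboolP; exists e.
Qed.

End SieveBasics.

(** Only the rational integers n in D matter, and no nonzero multiple of |n| + 1 equals n. *)
Lemma spacing (K : etaleAlg) (D : seq (integers K)) :
  exists2 C : nat, (0 < C)%N & {in D, forall u, forall c : int, c != 0 -> u <> (C%:Z * c)%:~R}.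
Proof.
apply: seq_common_multiple => [u n k k0 H c c0|u _].
  by rewrite PoszM -mulrA; apply: H; rewrite mulf_neq0 // -lt0n.
have [[n ->]|nu] := pselect (exists n : int, u = n%:~R); last first.
  by exists 1%N => // c _ e; apply: nu; exists (1%:Z * c).
exists `|n|.+1 => // c c0 e.
have : (n - `|n|.+1%:Z * c)%:~R = 0 :> integers K by rewrite rmorphB /= e subrr.
move/integers_int_eq0/eqP; rewrite subr_eq0 => /eqP en.
have e' : `|n|%N = (`|n|.+1 * `|c|)%N by rewrite {1}en abszM.
have c1 : (0 < `|c|)%N by rewrite absz_gt0.
by have := leq_pmulr `|n|.+1 c1; rewrite -e' ltnn.
Qed.

(** * From patterns avoiding R to values avoiding S *)

Section Core.
Variables (rT : realType) (K L : etaleAlg).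
Variable measK : forall p : prime_of K, haar_measure rT p.
Variables (R : sieve K) (S : sieve L).
Hypothesis R_nonlarge : non_large measK R.
Variables (f : sieve_system R -> sieve_system S) (A : integers K -> integers L).
Hypothesis A_add : {morph A : x y / x + y}.
Variables (Ml : seq (integers K)) (TT : set (integers K -> bool)).
Hypothesis ruleP : local_rule f A [set` Ml] TT.

Lemma rule_supp T y : TT T -> T y -> y \in Ml.
Proof. have [_ _ h _] := ruleP; by move=> /h[_ TM _] /TM. Qed.

Lemma rule_adm T : TT T -> admissible R T.
Proof. have [_ _ h _] := ruleP; by move=> /h[]. Qed.

Lemma rule_nonempty T : TT T -> exists y, T y.
Proof. have [_ _ h _] := ruleP; by move=> /h[[y Ty] _ _]; exists y. Qed.

Lemma rule_intro (X : sieve_system R) x T :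
  TT T -> (forall y, y \in Ml -> (val X : _ -> bool) (x + y) = T y) ->
  (val (f X) : _ -> bool) (A x).
Proof.
move=> tt XT; have [_ _ _ rule] := ruleP; apply/rule; exists T => //.
apply/seteqP; split=> [u [Xu [y /= yM e]]|_ [y Ty <-]].
  by exists y => //; change (is_true (T y)); rewrite -XT // e.
have yM := rule_supp tt Ty.
by split; [change (is_true ((val X : _ -> bool) (x + y))); rewrite XT|exists y].
Qed.

Lemma rule_elim (X : sieve_system R) x : (val (f X) : _ -> bool) (A x) ->
  exists2 T, TT T & forall y, y \in Ml -> (val X : _ -> bool) (x + y) = T y.
Proof.
have [_ _ _ rule] := ruleP; move=> /rule[T tt e]; exists T => // y yM.
apply/idP/idP => [Xxy|Ty].
  have : ([set` (val X : _ -> bool)] `&` translate x [set` Ml]) (x + y) by split => //; exists y.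
  by rewrite e => -[z Tz /addrI <-].
have : translate x [set` T] (x + y) by exists y.
by rewrite -e => -[].
Qed.

Lemma additive_natM n x : A (n%:R * x) = n%:R * A x.
Proof.
have A0 : A 0 = 0 by apply: (addrI (A 0)); rewrite -A_add !addr0.
elim: n => [|n IHn]; first by rewrite !mul0r.
by rewrite -!natr1 !mulrDl !mul1r A_add IHn.
Qed.

(* Moving the points [x i] by suitable multiples [z i] of a common modulus makes the windows
   [x i + z i + M] disjoint, so that [f] maps the union of the [x i + z i + T i] to a set
   containing all [A (x i + z i)]; the primes outside [s] are harmless by their measure. *)
Lemma finite_translate_avoidance (n : nat) (s : seq (prime_of K)) (x : 'I_n -> integers K)
    (T : 'I_n -> integers K -> bool) :
    (forall p, p \notin s -> small_at R (n * size Ml) p) ->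
    (forall i, TT (T i)) ->
    (forall p, p \in s -> exists d : adic p, forall i t, T i t ->
       ~ sieve_set R p (adic_of p (x i + t) - d)) ->
  forall q : prime_of L, exists d : adic q, forall i, ~ sieve_set S q (adic_of q (A (x i)) - d).
Proof.
move=> small TTT good q.
have /choice[eR eRP] := sieve_level R; have [eS eSP] := sieve_level S q.
have [N1 N1_gt0 N1P] : exists2 N, (0 < N)%N & {in s, forall p, mexp p (eR p) N%:R}.
  apply: seq_common_multiple => [p a b _ H|p _]; first by rewrite natrM; apply: mexpMr.
  exact: mexp_pos_nat.
have [N2 N2_gt0 N2P] := mexp_pos_nat q eS.
pose D := [seq x ij.1 - x ij.2 + (ty.1 - ty.2) | ij <- enum {: 'I_n * 'I_n},
  ty <- [seq (t, y) | t <- Ml, y <- Ml]].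
have [C C0 CP] := spacing D.
(* [N1] preserves the conditions at the primes of [s], [N2] preserves the images under [A] at the
   level of S_q, and C i separates the windows. *)
pose z (i : 'I_n) : integers K := (N1 * N2 * (C * i))%:R.
have sep i j t y : t \in Ml -> y \in Ml -> i != j -> x i + z i + t <> x j + z j + y.
  move=> tM yM ij e.
  have uD : x i - x j + (t - y) \in D.
    apply: (allpairs_f (fun (ij : 'I_n * 'I_n) (ty : integers K * integers K) =>
      x ij.1 - x ij.2 + (ty.1 - ty.2)) (x := (i, j)) (y := (t, y))); first by rewrite mem_enum.
    exact: allpairs_f.
  apply: (CP _ uD ((N1 * N2)%N%:Z * (j%:Z - i%:Z))).
    by rewrite mulf_neq0 ?subr_eq0 // -?lt0n ?muln_gt0 ?N1_gt0 // eqz_nat eq_sym.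
  have -> : x i - x j + (t - y) = z j - z i.
    have -> : t = x j + z j + y - (x i + z i) by rewrite -e addrC addKr.
    by ring.
  rewrite /z !natrM !rmorphM rmorphB /=.
  have cast m : (m%:Z)%:~R = m%:R :> integers K by [].
  by rewrite !cast; ring.
pose E := [seq x it.1 + z it.1 + it.2 | it <- [seq (i, t) | i <- enum 'I_n, t <- Ml] & T it.1 it.2].
have EP u : reflect (exists i, exists2 t, T i t & u = x i + z i + t) (u \in E).
  apply: (iffP mapP) => [[[i t]]|[i [t Tt ->]]].
    by rewrite mem_filter => /andP[/= Tt _] ->; exists i, t.
  exists (i, t) => //; rewrite mem_filter /= Tt; apply: allpairs_f; first by rewrite mem_enum.
  exact: rule_supp Tt.
have sE : (size E <= n * size Ml)%N.
  rewrite size_map size_filter; apply: leq_trans (count_size _ _) _.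
  by rewrite size_allpairs size_enum_ord.
have aE : admissible R (fun u => u \in E).
  apply/admissibleP => p; have [ps|ps] := boolP (p \in s).
    have [d dP] := good p ps; exists d => u /EP[i [t Tt ->]] Ru; apply: (dP i t Tt).
    apply: (eRP p) Ru; apply: adic_levelD => //; apply/adic_ofE.
    have -> : x i + z i + t - (x i + t) = z i by ring.
    by rewrite /z -mulnA natrM; apply: mexpMr; apply: N1P.
  have [|d dP] := @seq_avoid K R p E; last by exists d => u uE; apply: dP.
  by move=> k E' k0 E'E; apply: small => // j; apply: leq_trans (E'E j) sE.
pose X : sieve_system R := exist _ (fun u => u \in E) (mem_set aE).
have fX i : (val (f X) : _ -> bool) (A (x i + z i)).
  apply: (rule_intro (TTT i)) => y yM; apply/EP/idP => [[j [t Tt]]|Ty]; last by exists i, y.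
  have [->|ij] := eqVneq i j; first by move/addrI => ->.
  by move/(sep i j y t yM (rule_supp (TTT j) Tt) ij).
have /set_mem/admissibleP/(_ q)[d dP] := valP (f X).
exists d => i Si; apply: (dP _ (fX i)); apply: eSP Si.
apply: adic_levelD => //; apply/adic_ofE.
rewrite A_add opprD addrA subrr add0r; apply: mexpN.
have -> : z i = (N1 * (C * i) * N2)%:R * 1 by rewrite mulr1 /z mulnAC.
by rewrite additive_natM natrM -mulrA; apply/mexpM/mexpMr.
Qed.

(* Otherwise some [x] defeats each of the finitely many translates of [S q], and these
   [x] together contradict the finite case. *)
Lemma translate_avoidance (q : prime_of L) : exists2 s : seq (prime_of K), uniq s &
  forall delta : (forall p : prime_of K, adic p), exists d : integers L,
  forall x T, TT T ->
    (forall p, p \in s -> forall t, T t -> ~ sieve_set R p (adic_of p (x + t) - delta p)) ->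
    ~ sieve_set S q (adic_of q (A x - d)).
Proof.
have [eS eSP] := sieve_level S q.
have [g gP] := mexp_reps q eS.
have [s sP] := small_primes (size g * size Ml) R_nonlarge.
exists (undup s); first exact: undup_uniq.
move=> delta; apply: contrapT => H.
have /choice[x xP] : forall i : 'I_(size g), exists xT : integers K * (integers K -> bool),
    [/\ TT xT.2, (forall p, p \in s -> forall t, xT.2 t ->
       ~ sieve_set R p (adic_of p (xT.1 + t) - delta p)) &
     sieve_set S q (adic_of q (A xT.1 - g`_i))].
  move=> i; apply: contrapT => nx; apply: H; exists g`_i => x T tt good Sx.
  apply: nx; exists (x, T); split => // p ps t; apply: good; by rewrite mem_undup.
have [||d dP] := @finite_translate_avoidance (size g) s (fun i => (x i).1) (fun i => (x i).2) sP _ _ q.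
- by move=> i; case: (xP i).
- by move=> p ps; exists (delta p) => i; case: (xP i) => _ /(_ p ps).
have [a da] := adic_approx d eS.
have [r rg ar] := gP a.
have ri : (index r g < size g)%N by rewrite index_mem.
have [_ _ Sr] := xP (Ordinal ri); apply: (dP (Ordinal ri)).
apply: eSP Sr; rewrite [X in adic_of q (_ - X)]nth_index // adic_ofB; apply: adic_levelD => //.
by apply: adic_levelN; rewrite da; apply/adic_ofE; rewrite -opprB; apply: mexpN.
Qed.
End Core.

(** * Multiplicativity of A *)

Section SplitLocal.
Variables (K : etaleAlg) (l : nat) (q : prime_of K).
Hypotheses (pl : prime l) (sl : totally_split K l) (ql : q l%:R).

(** Iterated Frobenius: u^(l^k) lies in q^k and is congruent to u modulo l, so q is generated by l
    modulo q^k. *)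
Lemma split_unramified k u : q u -> exists v, mexp q k (u - l%:R * v).
Proof.
move=> qu; have [z ez] := split_power u k sl; exists (- z).
have -> : u - l%:R * - z = u ^+ (l ^ k) by rewrite mulrN -ez; ring.
by apply: mexpXle => //; apply/ltnW/ltn_expl/prime_gt1.
Qed.

(** The integer is built digit by digit in base l: residues modulo q are integers and l generates q
    modulo q^k. *)
Lemma split_residue_pow k y : exists a : nat, mexp q k (y - a%:R).
Proof.
suff H j : exists (a : nat) z, mexp q k (y - a%:R - l%:R ^+ j * z).
  have [a [z H']] := H k; exists a.
  rewrite -[y - a%:R](subrK (l%:R ^+ k * z)); apply: mexpD => //.
  by apply: mexpMr; apply: mexpX.
elim: j => [|j [a [z H]]]; first by exists 0%N, y; rewrite subr0 mul1r subrr; apply: mexp0.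
have [b /(split_unramified k)[v qv]] := split_residue z pl sl ql.
exists (a + l ^ j * b)%N, v.
have -> : y - (a + l ^ j * b)%:R - l%:R ^+ j.+1 * v =
  (y - a%:R - l%:R ^+ j * z) + l%:R ^+ j * (z - b%:R - l%:R * v).
  by rewrite natrD natrM natrX exprS; ring.
by apply: mexpD => //; apply: mexpM.
Qed.

(** Modulo q^k the element h is an integer prime to l, hence invertible modulo l^k. *)
Lemma split_multiple k h c : ~ q h -> exists n : nat, mexp q k (c - n%:R * h).
Proof.
move=> qh; have [a qa] := split_residue_pow k.+1 h; have [b qb] := split_residue_pow k c.
have la : ~~ (l %| a)%N.
  apply/negP => /dvdnP[m am]; apply: qh; rewrite -(subrK a%:R h); apply: maxidealD.
    by apply/mexp1P; apply: mexp_le qa.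
  by rewrite am natrM; apply: maxidealM.
have lk : coprime (l ^ k) a by rewrite coprimeXl // prime_coprime.
have a0 : (0 < a)%N by case: a la {qa lk} => //; rewrite dvdn0.
have lk0 : (0 < l ^ k)%N by rewrite expn_gt0 prime_gt0.
case: (egcdnP (l ^ k) a0) => u v uv _; rewrite gcdnC (eqP lk) in uv.
exists (b * u)%N.
have -> : c - (b * u)%:R * h = (c - b%:R) - (b * u)%:R * (h - a%:R) - b%:R * v%:R * l%:R ^+ k.
  have e : (u * a)%:R = (v * l ^ k + 1)%:R :> integers K by rewrite uv.
  rewrite natrM natrD natrM natrX in e.
  have -> : (b * u)%:R * (h - a%:R) = (b * u)%:R * h - b%:R * (u%:R * a%:R).
    by rewrite natrM; ring.
  by rewrite e; ring.
apply: mexpB; first apply: mexpB => //.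
  by apply: mexpM; apply: mexp_le qa.
by apply: mexpM; apply: mexpX.
Qed.
End SplitLocal.

Section PartA.
Variables (rT : realType) (K L : etaleAlg).
Variable measK : forall p : prime_of K, haar_measure rT p.
Variables (R : sieve K) (S : sieve L).
Hypothesis R_nonlarge : non_large measK R.
Variables (f : sieve_system R -> sieve_system S) (A : integers K -> integers L).
Hypothesis fA : @is_morphism (sieve_system R) (sieve_system S) f A.
Hypothesis A_surj : forall y, exists x, A x = y.
Variables (Ml : seq (integers K)) (TT : set (integers K -> bool)).
Hypothesis ruleP : local_rule f A [set` Ml] TT.

Let A_add : {morph A : x y / x + y}. Proof. by case: fA. Qed.

Let A0 : A 0 = 0.
Proof. by apply: (addrI (A 0)); rewrite -A_add !addr0. Qed.

Let AN x : A (- x) = - A x.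
Proof. by apply: (addrI (A x)); rewrite -A_add !subrr. Qed.

Let AM := additive_natM A_add.

(** If A x = 0, shifting X = T by any n x leaves f(X) unchanged. As A 0 stays in f(X), each n x is a
    difference of two points of the finite window, which forces x = 0. *)
Lemma morphism_injective : injective A.
Proof.
suff ker x : A x = 0 -> x = 0.
  by move=> x y e; apply/subr0_eq/ker; rewrite A_add AN e subrr.
move=> Ax0; apply/eqP; apply: contraT => x0.
have [_ [T tt] _ _] := ruleP.
pose X : sieve_system R := exist _ T (mem_set (rule_adm ruleP tt)).
have fX0 : (val (f X) : _ -> bool) (A 0).
  by apply: (rule_intro ruleP tt) => y _; rewrite add0r.
have key n : exists y y', [/\ y \in Ml, y' \in Ml & n%:R * x = y - y'].
  have [_ _ equiv] := fA.
  have : (val (f (@action (sieve_system R) (n%:R * x) X)) : _ -> bool) (A 0).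
    by rewrite equiv AM Ax0 mulr0 action0.
  move/(rule_elim ruleP) => [T' tt' XT'].
  have [y T'y] := rule_nonempty ruleP tt'; have yM := rule_supp ruleP tt' T'y.
  have : T (0 + y - n%:R * x) by have := XT' y yM; rewrite T'y.
  rewrite add0r => Ty; exists y, (y - n%:R * x); split => //; last by ring.
  exact: (rule_supp ruleP tt).
pose D := [seq y - y' | y <- Ml, y' <- Ml].
pose s := [seq n%:R * x | n <- iota 0 (size D).+1].
have us : uniq s.
  rewrite map_inj_uniq ?iota_uniq // => n m.
  wlog nm : n m / (n <= m)%N.
    by move=> W e; case: (leqP n m) => [/W->//|/ltnW/W H]; apply/esym/H.
  move=> e; apply/eqP; rewrite eqn_leq nm /= leqNgt; apply/negP => lt; case/eqP: x0.
  apply: (@natr_integers_inj _ (m - n)); first by rewrite subn_gt0.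
  by rewrite mulr0 natrB // mulrBl e subrr.
have : (size s <= size D)%N.
  apply: uniq_leq_size => // _ /mapP[n _ ->].
  have [y [y' [yM yM' ->]]] := key n; exact: allpairs_f.
by rewrite size_map size_iota ltnn.
Qed.

(** The translate of R_p avoided by T may be taken by an integer, since R_p has a level; moving T
    instead makes it avoid R_p itself. *)
Lemma local_point T (p : prime_of K) : TT T ->
  exists w, forall t, T t -> ~ sieve_set R p (adic_of p (w + t)).
Proof.
move=> tt; have [k kP] := sieve_level R p.
have /admissibleP/(_ p)[d dP] := rule_adm ruleP tt.
have [a da] := adic_approx d k; exists (- a) => t Tt Ra; apply: (dP t Tt).
apply: kP Ra; rewrite adic_ofD addrC; apply: adic_levelD => //.
by rewrite adic_ofN; apply: adic_levelN.
Qed.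

Section Local.
Variables (l : nat) (q : prime_of L).
Hypotheses (pl : prime l) (splK : totally_split K l) (splL : totally_split L l).
Hypotheses (ql : q l%:R) (Sq : sieve_set S q !=set0).
Hypothesis small : forall p : prime_of K, p l%:R -> small_at R (size Ml) p.

Lemma preimage_ideal :
  exists (p1 : prime_of K) (e : nat), forall x, mexp p1 e x -> q (A x).
Proof.
have [_ [T tt] _ _] := ruleP.
have [s us avoid] := translate_avoidance R_nonlarge A_add ruleP q.
have /choice[eR eRP] := sieve_level R.
have [k kP] := sieve_level S q.
have /choice[w wP] := fun p => local_point p tt.
have [s0 Ss0] : exists s0, sieve_set S q (adic_of q s0).
  have [y Sy] := Sq; have [a ya] := adic_approx y k; exists a; exact: kP Sy.
(* Adding an element of [V p] to a point leaves the sieve conditions at the primes of [s] other than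
   p unchanged; adding one of [Vall] leaves all of them unchanged. *)
pose V p x := forall p', p' \in s -> p' != p -> mexp p' (eR p') x.
pose Vall x := forall p', p' \in s -> mexp p' (eR p') x.
have [w0 w0P] := crt_solution eR w us.
have hit d x : mexp q k (A x - (d + s0)) -> sieve_set S q (adic_of q (A x - d)).
  move=> H; apply: (level_mem kP) Ss0.
  have -> : s0 - (A x - d) = - (A x - (d + s0)) by ring.
  exact: mexpN.
(* If [A] does not map [Vall] (resp. two different [V p]) into [q], then [A x] takes all values
   modulo q^k on points [x] with [x + T] avoiding translates of the [R p]. *)
have Vall_sub x : Vall x -> q (A x).
  move=> Vx; apply: contrapT => qx.
  have [d dP] := avoid (fun p => 0).
  have [n nP] := split_multiple pl splL ql k (d + s0 - A w0) qx.
  apply: (dP (w0 + n%:R * x) T tt); last first.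
    apply: hit; rewrite A_add AM.
    have -> : A w0 + n%:R * A x - (d + s0) = - (d + s0 - A w0 - n%:R * A x) by ring.
    exact: mexpN.
  move=> p ps t Tt; rewrite subr0 => Rx; apply: (wP p t Tt).
  apply: (level_mem (eRP p)) Rx.
  have -> : w0 + n%:R * x + t - (w p + t) = (w0 - w p) + n%:R * x by ring.
  by apply: mexpD; [apply: w0P|apply/mexpM/Vx].
(* If l were not in p, then 1 = y^e + l b with y in p and e = eR p; the first part of x falls into
   [Vall], the second into the multiples of l, and [A] maps both into q. *)
have V_l p x : p \in s -> V p x -> ~ q (A x) -> p l%:R.
  move=> ps Vx qx; apply: contrapT => /maxideal_inv[y py [a e]]; apply: qx.
  have [b eb] : exists b, 1 = y ^+ eR p + l%:R * b.
    exists (a * (\sum_(i < eR p) 1 ^+ ((eR p).-1 - i) * y ^+ i)).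
    have ey : 1 - y = a * l%:R by rewrite -[X in X - _]e addrK.
    have := subrXX 1 y (eR p); rewrite expr1n ey => /eqP; rewrite subr_eq => /eqP e1.
    by rewrite [LHS]e1 addrC; congr (_ + _); ring.
  have -> : x = y ^+ eR p * x + l%:R * (b * x) by rewrite mulrA -mulrDl -eb mul1r.
  rewrite A_add AM; apply: maxidealD; last by rewrite mulrC; apply: maxidealM.
  apply: Vall_sub => p' p's; have [->|p'p] := eqVneq p' p; first by apply/mexpMr/mexpX.
  by apply/mexpM/Vx.
have two p1 p2 x1 x2 : p1 \in s -> p2 \in s -> p1 != p2 ->
    V p1 x1 -> V p2 x2 -> ~ q (A x1) -> q (A x2).
  move=> p1s p2s p12 Vx1 Vx2 qx1; apply: contrapT => qx2.
  have unit p x : V p x -> ~ q (A x) -> exists2 v, V p v & mexp q k (1 - A v).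
    move=> Vx qx; have [n nP] := split_multiple pl splL ql k 1 qx.
    exists (n%:R * x); last by rewrite AM.
    by move=> p' p's p'p; apply/mexpM/Vx.
  have [v1 Vv1 Av1] := unit p1 x1 Vx1 qx1; have [v2 Vv2 Av2] := unit p2 x2 Vx2 qx2.
  have lk : (1 < l ^ k.+1)%N by rewrite (leq_trans (prime_gt1 pl)) // -{1}[l]expn1 leq_exp2l ?prime_gt1.
  case Nl : (l ^ k.+1)%N lk => [//|N] _.
  pose E (v : integers K) (j : 'I_N.+1) := [seq w0 + j%:R * v + t | t <- Ml].
  pose bad p (d : adic p) (v : integers K) := [pred j : 'I_N.+1 |
    `[< exists2 e, e \in E v j & sieve_set R p (adic_of p e - d) >]].
  have /all_sig[delta deltaP] : forall p : prime_of K, {d : adic p |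
      (p = p1 -> (2 * #|bad p d v1| < N.+1)%N) /\ (p = p2 -> (2 * #|bad p d v2| < N.+1)%N) /\
      (p <> p1 -> p <> p2 -> d = 0)}.
    move=> p; apply: cid.
    have sm v : p l%:R -> exists d : adic p, (2 * #|bad p d v| < N.+1)%N.
      by move=> pl1; apply: (small pl1 (E := E v)) => // j; rewrite size_map.
    have [e1|n1] := pselect (p = p1).
      have [|d dP] := sm v1; first by rewrite e1; apply: V_l qx1.
      by exists d; split=> //; split=> // e2; move/eqP: p12; rewrite -e1 -e2.
    have [e2|n2] := pselect (p = p2).
      have [|d dP] := sm v2; first by rewrite e2; apply: V_l qx2.
      by exists d.
    by exists 0.
  have [d dP] := avoid delta.
  have [c cP] := split_residue_pow pl splL ql k (d + s0 - A w0).
  have b1 := (deltaP p1).1 erefl; have b2 := (deltaP p2).2.1 erefl.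
  (* Since [h] is a bijection, a majority of the j is good at p1 and a majority has [h j] good at
     p2. Some j is good for both, while j + h j = c modulo l^(k+1). *)
  pose h (j : 'I_N.+1) : 'I_N.+1 := inZp c - j.
  have hI : injective h by move=> i j /addrI/oppr_inj.
  have [j j1 j2] : exists2 j, ~~ bad p1 (delta p1) v1 j & ~~ bad p2 (delta p2) v2 (h j).
    pose B2 := [pred j | bad p2 (delta p2) v2 (h j)].
    have cB2 : (#|B2| <= #|bad p2 (delta p2) v2|)%N.
      rewrite -(fintype.card_image hI); apply/fintype.subset_leq_card/fintype.subsetP => i.
      by move=> /fintype.imageP[j jB ->]; rewrite !inE in jB *.
    have cU : (#|[predU bad p1 (delta p1) v1 & B2]| < N.+1)%N.
      apply: (leq_ltn_trans (leq_addr #|[predI bad p1 (delta p1) v1 & B2]| _)).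
      rewrite cardUI; move: b1 b2 cB2.
      by move: #|bad p1 (delta p1) v1| #|bad p2 (delta p2) v2| #|B2| => u1 u2 u3; lia.
    have /existsP[j] : [exists j, j \notin [predU bad p1 (delta p1) v1 & B2]].
      rewrite -negb_forall; apply/negP => /forallP all; move: cU.
      by rewrite (eq_card (B := predT)) ?card_ord ?ltnn // => j; rewrite all.
    by rewrite !inE negb_or => /andP[j1 j2]; exists j.
  have hj : exists m, ((h j + j)%N%:R : integers L) = c%:R + m * l%:R ^+ k.
    have : h j + j = inZp c by rewrite /h subrK.
    move/(congr1 val) => /=; set a := (h j + j)%N => e.
    exists (((a %/ N.+1)%:R - (c %/ N.+1)%:R) * l%:R).
    rewrite {1}(divn_eq a N.+1) e {2}(divn_eq c N.+1) !natrD !natrM -Nl expnS natrM natrX.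
    by ring.
  (* At p1 only the summand j v1 is visible, at p2 only (h j) v2, at the other primes of [s]
     neither. Modulo q^k both A v1 and A v2 are 1, so the image is A w0 + c, which [c] was chosen to
     put in the translate of S_q. *)
  apply: (dP (w0 + j%:R * v1 + (h j)%:R * v2) T tt).
    move=> p ps t Tt Rx.
    have tM := rule_supp ruleP tt Tt.
    have [e1|n1] := eqVneq p p1.
      move/asboolP: j1; apply; exists (w0 + j%:R * v1 + t); first exact: map_f.
      rewrite -e1; move: Rx; apply: (eRP p); apply: adic_levelD => //; apply/adic_ofE.
      have -> : w0 + j%:R * v1 + (h j)%:R * v2 + t - (w0 + j%:R * v1 + t) = (h j)%:R * v2 by ring.
      by apply/mexpM/Vv2 => //; rewrite e1.
    have [e2|n2] := eqVneq p p2.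
      move/asboolP: j2; apply; exists (w0 + (h j)%:R * v2 + t); first exact: map_f.
      rewrite -e2; move: Rx; apply: (eRP p); apply: adic_levelD => //; apply/adic_ofE.
      have -> : w0 + j%:R * v1 + (h j)%:R * v2 + t - (w0 + (h j)%:R * v2 + t) = j%:R * v1 by ring.
      by apply/mexpM/Vv1.
    move: Rx; rewrite (deltaP p).2.2 ?subr0; [|exact/eqP|exact/eqP] => Rx; apply: (wP p t Tt).
    apply: (level_mem (eRP p)) Rx.
    have -> : w0 + j%:R * v1 + (h j)%:R * v2 + t - (w p + t) =
      (w0 - w p) + (j%:R * v1 + (h j)%:R * v2) by ring.
    apply: mexpD; first exact: w0P.
    by apply: mexpD; apply: mexpM; [apply: Vv1|apply: Vv2].
  apply: hit; rewrite !A_add !AM.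
  have [m mP] := hj.
  have -> : A w0 + j%:R * A v1 + (h j)%:R * A v2 - (d + s0) =
    m * l%:R ^+ k - (d + s0 - A w0 - c%:R) - (j%:R * (1 - A v1) + (h j)%:R * (1 - A v2)).
    have -> : m * l%:R ^+ k = (h j)%:R + j%:R - c%:R by rewrite -natrD mP; ring.
    by ring.
  apply: mexpB; last by apply: mexpD; apply: mexpM.
  by apply: mexpB => //; apply/mexpM/mexpX.
have [p1 p1s p1P] : exists2 p1, p1 \in s & forall p2, p2 \in s -> p2 != p1 ->
    forall x, V p2 x -> q (A x).
  have [[p1 [p1s [x1 Vx1 qx1]]]|none] :=
      pselect (exists p1, p1 \in s /\ exists2 x1, V p1 x1 & ~ q (A x1)).
    exists p1 => // p2 p2s p21 x2 Vx2; apply: (two p1 p2 x1 x2) => //.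
    by rewrite eq_sym.
  have : exists p1, p1 \in s.
    have [s_nil|] := eqVneq s [::]; last by case: (s) => // p1 s' _; exists p1; rewrite mem_head.
    have [x Ax] := A_surj 1; have := @Vall_sub x; rewrite Ax => H.
    by case: (@maxideal1 _ q); apply: H => p; rewrite s_nil.
  move=> [p1 p1s]; exists p1 => // p2 p2s p21 x2 Vx2; apply: contrapT => qx2.
  by apply: none; exists p2; split => //; exists x2.
(* Write [x] in terms of idempotents modulo the prime powers: all parts other than the one
   at [p1] lie in some [V p2], hence are mapped into [q]. *)
exists p1, (eR p1) => x p1x.
suff H : forall t : seq (prime_of K), {subset t <= s} -> p1 \notin t ->
    forall y, (forall p, p \in s -> p \notin t -> mexp p (eR p) y) -> q (A y).
  apply: (H [seq p <- s | p != p1]).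
  - by move=> p; rewrite mem_filter => /andP[].
  - by rewrite mem_filter eqxx.
  - by move=> p ps; rewrite mem_filter ps andbT negbK => /eqP ->.
elim=> [|p t IHt] ts p1t y yP; first by apply: Vall_sub => p ps; apply: yP.
have [i [ip iq]] := crt_idempotent s eR p.
have -> : y = y * i + y * (1 - i) by ring.
rewrite A_add; apply: maxidealD.
  apply: (p1P p); first by apply: ts; rewrite mem_head.
    by apply: contraNneq p1t => ->; rewrite mem_head.
  by move=> p' p's p'p; apply: mexpM; apply: iq.
apply: IHt.
- by move=> p' p't; apply: ts; rewrite inE p't orbT.
- by apply: contra p1t; rewrite inE => ->; rewrite orbT.
- move=> p' p's p't; have [->|p'p] := eqVneq p' p; first exact: mexpM.
  by apply: mexpMr; apply: yP; rewrite // inE negb_or p'p.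
Qed.

(** Modulo q the map [A] factors through O/p1 = F_l, so A z = c A 1 whenever z is congruent to the
    integer c; both products become a b (A 1)^2. *)
Lemma image_mul_mod x y : q (A (x * y) * A 1 - A x * A y).
Proof.
have [p1 [e p1e]] := preimage_ideal.
have lJ z : q (A (l%:R * z)) by rewrite AM mulrC; apply: maxidealM.
(* The exponent [e] drops to 1, because z is congruent modulo l to z^(l^e), which lies in p1^e. *)
have p1q z : p1 z -> q (A z).
  move=> pz; have [c ec] := split_power z e splK.
  have -> : z = z ^+ (l ^ e) - l%:R * c by rewrite -ec; ring.
  rewrite A_add AN; apply: maxidealB => //; apply/p1e.
  by apply: mexpXle => //; apply/ltnW/ltn_expl/prime_gt1.
have pl1 : p1 l%:R.
  apply: contrapT => /maxideal_inv[z pz [a ea]].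
  have [u Au] := A_surj 1; apply: (@maxideal1 _ q); rewrite -Au.
  have -> : u = l%:R * (a * u) + u * z.
    transitivity ((a * l%:R + z) * u); first by rewrite ea mul1r.
    by ring.
  by rewrite A_add; apply: maxidealD => //; apply/p1q/maxidealM.
have [a pa] := split_residue x pl splK pl1; have [b pb] := split_residue y pl splK pl1.
have AX c z : p1 (z - c%:R) -> q (A z - c%:R * A 1).
  by move=> /p1q; rewrite A_add AN -[c%:R]mulr1 AM.
have qa := AX a x pa; have qb := AX b y pb.
have /AX qab : p1 (x * y - (a * b)%N%:R).
  have -> : x * y - (a * b)%N%:R = y * (x - a%:R) + a%:R * (y - b%:R) by rewrite natrM; ring.
  by apply: maxidealD; apply: maxidealM.
have -> : A (x * y) * A 1 - A x * A y = A 1 * (A (x * y) - (a * b)%N%:R * A 1)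
   - (A y * (A x - a%:R * A 1) + a%:R * A 1 * (A y - b%:R * A 1)) by rewrite natrM; ring.
by apply: maxidealB; [apply: maxidealM|apply: maxidealD; apply: maxidealM].
Qed.
End Local.

Hypothesis S_cofinite : cofinite_sieve S.

(** The difference is divisible by arbitrarily large totally split l, hence zero. Such l are taken
    beyond the finitely many primes where R_p is not small or S_q is empty. *)
Lemma image_mul x y : A (x * y) * A 1 = A x * A y.
Proof.
apply/subr0_eq/integers_dvd_inf => B.
have [sR sRP] := small_primes (size Ml) R_nonlarge.
have [BR BRP] := large_prime_notin sR.
have /finite_seqP[sS sSE] := S_cofinite.
have [BS BSP] := large_prime_notin sS.
have [l [pl lB splK splL]] := etale_split_primes K L (B + BR + BS).
exists l; first by apply: leq_ltn_trans lB; rewrite -addnA leq_addr.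
apply: split_mem => // q ql.
have lBR : (BR < l)%N by apply: leq_ltn_trans lB; rewrite -addnA addnCA leq_addr.
have lBS : (BS < l)%N by apply: leq_ltn_trans lB; rewrite leq_addl.
apply: (@image_mul_mod l) => //.
- apply/set0P/eqP => Sq; apply: (BSP l pl lBS q) ql.
  by have : [set q | sieve_set S q = set0] q by []; rewrite sSE.
- by move=> p pl1; apply: sRP; apply/negP => /(BRP l pl lBR)/(_ pl1).
Qed.

Lemma image1_unit : exists e, A 1 * e = 1.
Proof.
have [x Ax] := A_surj 1; exists (A (x * x)).
by rewrite mulrC image_mul Ax mulr1.
Qed.
End PartA.

(** * Extension of A to the algebras and to the completions *)

Section AdicMap.
Variables (O O' : comNzRingType) (m : maxideal O) (m' : maxideal O').
Variable A : O -> O'.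
Hypothesis A_add : {morph A : x y / x + y}.
Hypothesis A_exp : forall n x, mexp m n x -> mexp m' n (A x).

Lemma adic_map_exists : exists Ah : adic m -> adic m',
  forall (x : adic m) n a, x n = adic_of m a n -> Ah x n = adic_of m' (A a) n.
Proof.
have A0 : A 0 = 0 by apply: (addrI (A 0)); rewrite -A_add !addr0.
have AB x y : A (x - y) = A x - A y.
  by apply: (addIr (A y)); rewrite -A_add !subrK.
have step n a b : adic_of m a n = adic_of m b n -> adic_of m' (A a) n = adic_of m' (A b) n.
  by move=> /adic_ofE ab; apply/adic_ofE; rewrite -AB; apply: A_exp.
suff /choice[Ah AhP] : forall x : adic m, exists y : adic m',
    forall n a, x n = adic_of m a n -> y n = adic_of m' (A a) n by exists Ah.
move=> x.
have /choice[a aP] := adic_approx x.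
have compat n : coset (mexp m' n.+1) (A (a n.+1)) `<=` coset (mexp m' n) (A (a n)).
  move=> y /(mexp_le (leqnSn n)) H.
  have e : adic_of m' (A (a n.+1)) n = adic_of m' (A (a n)) n.
    by apply: step; rewrite -aP; apply: (@adic_eq_le _ _ _ _ n.+1) => //; rewrite -aP.
  by have : adic_of m' (A (a n.+1)) n y by []; rewrite e.
exists (Adic (fun n => ex_intro _ (A (a n)) erefl) compat) => n b e.
by rewrite -[LHS]/(adic_of m' (A (a n)) n); apply: step; rewrite -aP.
Qed.

Variable Ah : adic m -> adic m'.
Hypothesis AhP : forall (x : adic m) n a, x n = adic_of m a n -> Ah x n = adic_of m' (A a) n.

Lemma adic_map_of a : Ah (adic_of m a) = adic_of m' (A a).
Proof. by apply: adic_ext => n; apply: AhP. Qed.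

Lemma adic_map_continuous : continuous Ah.
Proof.
apply/continuousP => U /adic_openP oU; apply/adic_openP => x /= Ux.
have [n nU] := oU _ Ux; exists n => y yx; apply: nU => k kn.
by have [a ea] := adic_approx x k; rewrite (AhP ea); apply: AhP; rewrite yx.
Qed.
End AdicMap.

Lemma adic_map_cancel (O O' : comNzRingType) (m : maxideal O) (m' : maxideal O')
    (A : O -> O') (B : O' -> O) (Ah : adic m -> adic m') (Bh : adic m' -> adic m) :
  (forall (x : adic m) n a, x n = adic_of m a n -> Ah x n = adic_of m' (A a) n) ->
  (forall (x : adic m') n a, x n = adic_of m' a n -> Bh x n = adic_of m (B a) n) ->
  cancel A B -> cancel Ah Bh.
Proof.
move=> AhP BhP AB x; apply: adic_ext => n.
by have [a ea] := adic_approx x n; rewrite (BhP _ _ _ (AhP _ _ _ ea)) AB.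
Qed.

Section RingIsoExp.
Variables (O O' : comNzRingType) (m : maxideal O) (m' : maxideal O').
Variable t : O -> O'.
Hypotheses (t_add : {morph t : x y / x + y}) (t_mul : {morph t : x y / x * y}).
Hypothesis t_max : forall x, m x -> m' (t x).

Lemma morph_mexp n x : mexp m n x -> mexp m' n (t x).
Proof.
have t0 : t 0 = 0 by apply: (addrI (t 0)); rewrite -t_add !addr0.
elim: n x => [//|n IHn] _ [s sP ->].
rewrite (big_morph t t_add t0) big_seq; apply: mexp_sum => u /sP[mu1 mu2].
by rewrite t_mul; apply: mexpS; [apply: t_max|apply: IHn].
Qed.
End RingIsoExp.

(** * Passing from the integers to the algebras by clearing denominators *)

Section Tau.
Variables (K L : etaleAlg) (t : integers K -> integers L).
Hypotheses (t_add : {morph t : x y / x + y}) (t_mul : {morph t : x y / x * y}) (t1 : t 1 = 1).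

Lemma etale_natI (M : etaleAlg) (n : nat) (x y : M) : (0 < n)%N -> n%:R * x = n%:R * y -> x = y.
Proof.
move=> n0; rewrite !mulr_natl -!scaler_nat; apply: scalerI.
by rewrite pnatr_eq0 -lt0n.
Qed.

Lemma tau_exists : exists tau : {lrmorphism K -> L},
  forall x, tau (etale_val x) = etale_val (t x).
Proof.
have tn n x : t (n%:R * x) = n%:R * t x by apply: additive_natM.
have valn (M : etaleAlg) n (y : integers M) : etale_val (n%:R * y) = n%:R * etale_val y.
  by rewrite [LHS](rmorphM val) rmorph_nat.
(* The value is characterized through every n that clears the denominator of x, so that sums and
   products can be compared over a common denominator. *)
have /choice[T TP] : forall x : K, exists y : L, forall n z, (0 < n)%N ->
    etale_val z = n%:R * x -> n%:R * y = etale_val (t z).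
  move=> x; have [n n0 [y ey]] := etale_denominator x.
  exists (n%:R^-1 *: etale_val (t y)) => m z m0 ez.
  have e : m%:R * y = n%:R * z.
    by apply: val_inj; rewrite [LHS]valn [RHS]valn ey ez mulrCA.
  have nV (V : L) : n%:R * (n%:R^-1 *: V) = V.
    by rewrite -scalerAr mulr_natl -scaler_nat scalerA mulVf ?scale1r // pnatr_eq0 -lt0n.
  by apply: (etale_natI n0); rewrite mulrCA nV -!valn -!tn e.
have den x : exists n, (0 < n)%N /\ exists z : integers K, etale_val z = n%:R * x.
  by have [n n0 [z ez]] := etale_denominator x; exists n; split => //; exists z.
have valM (M : etaleAlg) (y z : integers M) : etale_val (y * z) = etale_val y * etale_val z by [].
have valB (M : etaleAlg) (y z : integers M) : etale_val (y - z) = etale_val y - etale_val z by [].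
have tB x y : t (x - y) = t x - t y by apply: (addIr (t y)); rewrite -t_add !subrK.
have T_add : zmod_morphism T.
  move=> x y; have [n [n0 [u eu]]] := den x; have [k [k0 [v ev]]] := den y.
  have nk0 : (0 < n * k)%N by rewrite muln_gt0 n0.
  apply: (etale_natI nk0); rewrite (TP _ _ (k%:R * u - n%:R * v)) //.
    rewrite tB !tn valB !valn -(TP x n u) // -(TP y k v) // natrM mulrBr.
    by congr (_ - _); ring.
  by rewrite valB !valn eu ev natrM mulrBr; congr (_ - _); ring.
have T_mul : monoid_morphism T.
  split; first by rewrite -[LHS]mul1r (TP _ 1%N 1) // ?mul1r // t1.
  move=> x y; have [n [n0 [u eu]]] := den x; have [k [k0 [v ev]]] := den y.
  have nk0 : (0 < n * k)%N by rewrite muln_gt0 n0.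
  apply: (etale_natI nk0); rewrite (TP _ _ (u * v)) //.
    by rewrite t_mul valM -(TP x n u) // -(TP y k v) // natrM; ring.
  by rewrite valM eu ev natrM; ring.
have T_lin : scalable T by apply: rat_linear.
pose TT : {lrmorphism K -> L} := HB.pack_for {lrmorphism K -> L} T
  (GRing.isZmodMorphism.Build _ _ T T_add) (GRing.isMonoidMorphism.Build _ _ T T_mul)
  (GRing.isScalable.Build _ _ _ _ T T_lin).
exists TT => x; rewrite /=. 
have := TP (etale_val x) 1%N x isT; rewrite !mul1r; exact.
Qed.
End Tau.

Lemma tau_cancel (K L : etaleAlg) (t : integers K -> integers L) (t' : integers L -> integers K)
    (tau : {lrmorphism K -> L}) (tau' : {lrmorphism L -> K}) :
  (forall x, tau (etale_val x) = etale_val (t x)) ->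
  (forall x, tau' (etale_val x) = etale_val (t' x)) ->
  cancel t t' -> cancel tau tau'.
Proof.
move=> tE t'E tK x; have [n n0 [z ez]] := etale_denominator x.
apply: (etale_natI n0); rewrite -[in LHS](rmorph_nat tau' n) -rmorphM.
by rewrite -(rmorph_nat tau n) -rmorphM /= -ez tE t'E tK.
Qed.

(** * Division by the unit [A 1] and the induced map on primes *)

Section Transfer.
Variables (K L : etaleAlg) (A : integers K -> integers L) (B : integers L -> integers K).
Hypothesis A_add : {morph A : x y / x + y}.
Hypotheses (AK : cancel A B) (BK : cancel B A).
Hypothesis A_mul : forall x y, A (x * y) * A 1 = A x * A y.
Variable e : integers L.
Hypothesis eP : A 1 * e = 1.

Definition normalized x := e * A x.
Definition normalized_inv y := B (A 1 * y).

Lemma normalized_add : {morph normalized : x y / x + y}.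
Proof. by move=> x y; rewrite /normalized A_add mulrDr. Qed.

Lemma normalized_mul : {morph normalized : x y / x * y}.
Proof.
move=> x y; rewrite /normalized.
transitivity (e * e * (A (x * y) * A 1)); last by rewrite A_mul; ring.
by transitivity (e * A (x * y) * (A 1 * e)); [rewrite eP mulr1|ring].
Qed.

Lemma normalized1 : normalized 1 = 1.
Proof. by rewrite /normalized mulrC. Qed.

Lemma normalizedK : cancel normalized normalized_inv.
Proof. by move=> x; rewrite /normalized_inv /normalized mulrA eP mul1r. Qed.

Lemma normalized_invK : cancel normalized_inv normalized.
Proof. by move=> x; rewrite /normalized_inv /normalized BK mulrA [e * _]mulrC eP mul1r. Qed.

Lemma normalized_inv_add : {morph normalized_inv : x y / x + y}.
Proof.
by move=> x y; apply: (can_inj normalizedK); rewrite normalized_add !normalized_invK.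
Qed.

Lemma normalized_inv_mul : {morph normalized_inv : x y / x * y}.
Proof.
by move=> x y; apply: (can_inj normalizedK); rewrite normalized_mul !normalized_invK.
Qed.

Lemma normalized_inv1 : normalized_inv 1 = 1.
Proof. by rewrite -normalized1 normalizedK. Qed.

Lemma image_prime_exists (p : prime_of K) :
  exists q : prime_of L, forall y, q y = p (normalized_inv y).
Proof.
have id : idealr_closed (fun y => p (normalized_inv y)).
  have [p0 p1 pl] := maxideal_idealr p.
  have n0 : normalized_inv 0 = 0.
    by apply: (addrI (normalized_inv 0)); rewrite -normalized_inv_add !addr0.
  split; rewrite -?topredE /= ?n0 ?normalized_inv1 // => a x y px py.
  by rewrite -topredE /= normalized_inv_add normalized_inv_mul; apply: pl.
have mx (J : integers L -> bool) : idealr_closed J ->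
    {subset (fun y => p (normalized_inv y)) <= J} -> {subset J <= (fun y => p (normalized_inv y))}.
  move=> [J0 J1 Jl] pJ y Jy; rewrite -topredE /=.
  have n0 : normalized 0 = 0.
    by apply: (addrI (normalized 0)); rewrite -normalized_add !addr0.
  apply: (@maxideal_max _ p (fun x => J (normalized x))).
  - split; rewrite -?topredE /= ?n0 ?normalized1 // => a x z px pz.
    by rewrite -topredE /= normalized_add normalized_mul; apply: Jl.
  - by move=> x px; rewrite -topredE /=; apply: pJ; rewrite -topredE /= normalizedK.
  - by rewrite -topredE /= normalized_invK.
by exists (MaxIdeal id mx).
Qed.

Variables (p : prime_of K) (q : prime_of L).
Hypothesis qE : forall y, q y = p (normalized_inv y).

(** [A] itself need not be multiplicative, but it is the unit [A 1] times a ring isomorphism, and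
    ideals absorb the unit. *)
Lemma transfer_mexp n x : mexp p n x -> mexp q n (A x).
Proof.
move=> px; have -> : A x = A 1 * normalized x by rewrite /normalized mulrA eP mul1r.
apply: mexpM; apply: (morph_mexp normalized_add normalized_mul) px => y py.
by rewrite qE normalizedK.
Qed.

Lemma transfer_mexp_inv n y : mexp q n y -> mexp p n (B y).
Proof.
move=> qy; have -> : B y = normalized_inv (e * y) by rewrite /normalized_inv mulrA eP mul1r.
apply: (morph_mexp normalized_inv_add normalized_inv_mul); last exact: mexpM qy.
by move=> z; rewrite qE.
Qed.
End Transfer.

Section TranslateOf.
Variables (O O' : comNzRingType) (m : maxideal O) (m' : maxideal O').
Variables (A : O -> O') (Ah : adic m -> adic m') (Bh : adic m' -> adic m).
Hypothesis AhP : forall (x : adic m) n a, x n = adic_of m a n -> Ah x n = adic_of m' (A a) n.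
Hypothesis BhK : cancel Bh Ah.

Lemma translate_of (S : set (adic m')) (G : set (adic m)) k e u :
  level S k -> level G e ->
  (forall x, S (adic_of m' (A x + u)) <-> G (adic_of m x)) ->
  S = translate (adic_of m' u) (Ah @` G).
Proof.
move=> Sk Ge H.
have key r : S (Ah r + adic_of m' u) <-> G r.
  have [x ex] := adic_approx r (maxn k e).
  have ek : r k = adic_of m x k by apply: adic_eq_le ex; apply: leq_maxl.
  have ee : r e = adic_of m x e by apply: adic_eq_le ex; apply: leq_maxr.
  have eS : (Ah r + adic_of m' u) k = adic_of m' (A x + u) k.
    by rewrite adic_ofD; apply: adic_levelD => //; apply: AhP.
  split=> [Sr|Gr]; first by apply: (Ge _ _ (esym ee)); apply/H; apply: Sk Sr.
  by apply: (Sk _ _ (esym eS)); apply/H; apply: Ge Gr.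
apply/seteqP; split=> [s Ss|s /translateP[r Gr e']].
  apply/translateP; exists (Bh (s - adic_of m' u)); last exact: BhK.
  by apply/key; rewrite BhK subrK.
have -> : s = Ah r + adic_of m' u by rewrite e' subrK.
exact/key.
Qed.
End TranslateOf.

(** * Existence of a local rule *)

Lemma ptws_bool_cvg (T : choiceType) (F : set_system {ptws T -> bool}) (Z : {ptws T -> bool}) :
  Filter F -> (forall x, F [set X | X x = Z x]) -> F --> Z.
Proof.
move=> FF H; apply/(@cvg_sup _ _ _ _ _ FF) => x A [_ [[B Bop <-] Bf sBA]].
by apply: filterS (H x) => X /= e; apply: sBA; rewrite /= /proj e.
Qed.

Section Compactness.
Variables (K : etaleAlg) (R : sieve K).

Lemma ultra_seq_union (T : Type) (I : eqType) (s : seq I) (F : set_system T) (P : I -> set T) :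
  UltraFilter F -> F [set x | exists2 i, i \in s & P i x] -> exists2 i, i \in s & F (P i).
Proof.
move=> FU; elim: s => [|i s IHs] Fs.
  by have [x [j]] := filter_ex Fs.
have [FP|FP] := in_ultra_setVsetC (P i) FU; first by exists i; rewrite ?mem_head.
have [|j js Fj] := IHs; last by exists j => //; rewrite inE js orbT.
apply: filterS (filterI Fs FP) => x [[j]]; rewrite inE => /predU1P[->//|js Pj _].
by exists j.
Qed.

(** At each p only finitely many translates of R_p differ, so an ultrafilter selects one that is
    avoided by almost all its sets; the pointwise limit avoids it too. *)
Lemma admissible_compact : compact (admissible R).
Proof.
rewrite compact_ultra => F FU FR.
pose Z : {ptws integers K -> bool} := fun x => `[< F [set X | X x] >].
have FZ x : F [set X | X x = Z x].
  rewrite /Z; case: asboolP => Fx; first by apply: filterS Fx => X /= ->.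
  have [//|] := in_ultra_setVsetC [set X : {ptws integers K -> bool} | X x] FU.
  by apply: filterS => X /= /negP/negbTE.
exists Z; split; last exact: ptws_bool_cvg.
apply/admissibleP => p; have [k kP] := sieve_level R p; have [s sP] := mexp_reps p k.
have [|r rs Fr] := @ultra_seq_union _ _ s F
    (fun r => [set X | forall x, X x -> ~ sieve_set R p (adic_of p x - adic_of p r)]).
  apply: filterS FR => X /admissibleP/(_ p)[d dX].
  have [a da] := adic_approx d k; have [r rs ar] := sP a; exists r => // x Xx Rx.
  apply: (dX x Xx); apply: kP Rx; apply: adic_levelD => //; apply: adic_levelN.
  by rewrite da; apply/adic_ofE; rewrite -opprB; apply: mexpN.
exists (adic_of p r) => x Zx; have [X [/= H e]] := filter_ex (filterI Fr (FZ x)).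
by apply: H; rewrite e.
Qed.

(** Continuity gives each X a window of its own; compactness of the admissible sets gives a common
    one. *)
Lemma continuous_window (g : sieve_system R -> bool) :
    (forall X, nbhs X [set Y | g Y = g X]) ->
  exists M : seq (integers K), forall X Y : sieve_system R,
    (forall x, x \in M -> (val X : _ -> bool) x = (val Y : _ -> bool) x) -> g X = g Y.
Proof.
move=> gc.
have win (X : sieve_system R) : exists M : seq (integers K), forall Y : sieve_system R,
    (forall x, x \in M -> (val Y : _ -> bool) x = (val X : _ -> bool) x) -> g Y = g X.
  pose F : set_system (sieve_system R) := [set U | exists M : seq (integers K),
    forall Y : sieve_system R,
    (forall x, x \in M -> (val Y : _ -> bool) x = (val X : _ -> bool) x) -> U Y].
  have FF : Filter F.
    split; first by exists [::].
    - move=> U V [M MU] [N NV]; exists (M ++ N) => Y H; split.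
        by apply: MU => x xM; apply: H; rewrite mem_cat xM.
      by apply: NV => x xN; apply: H; rewrite mem_cat xN orbT.
    - by move=> U V UV [M MU]; exists M => Y /MU/UV.
  suff : F --> X by move=> /(_ _ (gc X))[M MP]; exists M.
  move=> U [_ [[B Bop <-] BX sBU]].
  have vF : (fmap (fun Y : sieve_system R => (val Y : {ptws integers K -> bool})) F) --> (val X : {ptws integers K -> bool}).
    by apply: ptws_bool_cvg => x; exists [:: x] => Y; apply; rewrite mem_head.
  have [M MP] := vF B (open_nbhs_nbhs (conj Bop BX)).
  by exists M => Y H; apply: sBU; apply: MP.
have /choice[M MP] := win.
(* The filter of sufficiently large windows, along which the near-covering form of compactness is
   applied. *)
pose F : set_system (seq (integers K)) := [set U | exists N : seq (integers K), forall N' : seq (integers K), {subset N <= N'} -> U N'].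
have FF : Filter F.
  split; first by exists [::].
  - move=> U V [N NU] [N' NV]; exists (N ++ N') => Q H; split.
      by apply: NU => x xN; apply: H; rewrite mem_cat xN.
    by apply: NV => x xN; apply: H; rewrite mem_cat xN orbT.
  - by move=> U V UV [N NU]; exists N => Q /NU/UV.
have /compact_near_coveringP nc := @admissible_compact.
have [|N NP] := nc _ F (fun N Z => forall (aZ : Z \in admissible R) (Y : sieve_system R),
    (forall x, x \in N -> Z x = (val Y : _ -> bool) x) -> g (exist _ Z aZ) = g Y) FF.
  move=> Z /mem_set aZ; pose X : sieve_system R := exist _ Z aZ.
  exists ([set Z' : {ptws integers K -> bool} | forall x, x \in M X -> Z' x = Z x], [set N : seq (integers K) | {subset M X <= N}]).
    split=> /=; last by exists (M X).
    elim: (M X) => [|x s IHs]; first by apply: filterS filterT => Z' _ x.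
    have nx : nbhs Z [set Z' : {ptws integers K -> bool} | Z' x = Z x].
      have : nbhs Z ((fun Z' : {ptws integers K -> bool} => Z' x) @^-1` [set Z x]).
        apply: (@proj_continuous _ (fun=> bool) x Z).
        exact: (discrete_set1 (Z x)).
      by apply: filterS.
    apply: filterS (filterI nx IHs) => Z' [e H] y; rewrite inE => /predU1P[->//|ys].
    exact: H.
  move=> [Z' N] /= [Z'Z MN] aZ' Y H.
  rewrite (MP X (exist _ Z' aZ')); last by move=> x /Z'Z.
  rewrite (MP X Y) // => x xM; transitivity (Z' x); last exact: Z'Z.
  by apply/esym/H/MN.
by exists N => -[X aX] Y XY; apply: (NP N _ X (set_mem aX) aX Y XY).
Qed.
End Compactness.

Section LocalRule.
Variables (K L : etaleAlg) (R : sieve K) (S : sieve L).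
Variables (f : sieve_system R -> sieve_system S) (A : integers K -> integers L).
Hypothesis fA : @is_morphism (sieve_system R) (sieve_system S) f A.
Hypothesis A_surj : forall y, exists x, A x = y.
Hypothesis f_nonempty : exists (X : sieve_system R) (y : integers L), (val (f X) : _ -> bool) y.
Variable q : prime_of L.
Hypothesis Sq : sieve_set S q !=set0.

(* The empty pattern is excluded because [f] would map the empty set to O_L. *)
Lemma local_rule_exists : exists M TT, local_rule f A M TT.
Proof.
have [A_add f_cont f_equiv] := fA.
have [|N NP] := @continuous_window K R (fun X => (val (f X) : _ -> bool) (A 0)).
  have ev_cont : continuous ((fun Z : {ptws integers L -> bool} => Z (A 0)) \o
      (fun Y : admissible S => val Y)).
    move=> Y; apply: continuous_comp; first exact: initial_continuous.
    exact: proj_continuous.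
  move=> X; apply: (f_cont X [set Y : sieve_system S |
    (val Y : _ -> bool) (A 0) = (val (f X) : _ -> bool) (A 0)]).
  exact: (ev_cont (f X) _ (discrete_set1 _)).
pose pat (X : sieve_system R) (u : integers K) := (u \in N) && (val X : _ -> bool) u.
have A0 : A 0 = 0 by apply: (addrI (A 0)); rewrite -A_add !addr0.
have translate0 (x : integers K) (X : sieve_system R) :
    (val (f X) : _ -> bool) (A x) =
    (val (f (@action (sieve_system R) (- x) X)) : _ -> bool) (A 0).
  rewrite f_equiv /= /Defs.shift A0.
  rewrite sub0r; congr ((val (f X) : _ -> bool) _).
  by apply: (addrI (A (- x))); rewrite subrr -A_add addNr A0.
pose TT : set (integers K -> bool) := [set T | exists2 X : sieve_system R,
  T = pat X & (val (f X) : _ -> bool) (A 0)].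
have patE (X Y : sieve_system R) : pat X = pat Y -> (val (f X) : _ -> bool) (A 0) = (val (f Y) : _ -> bool) (A 0).
  move=> e; apply: NP => x xN.
  by have := congr1 (fun P : integers K -> bool => P x) e; rewrite /pat xN.
have aE : (fun=> false) \in admissible R by apply/mem_set/admissibleP => p; exists 0.
pose E : sieve_system R := exist _ (fun=> false) aE.
have fE y : ~~ (val (f E) : _ -> bool) y.
  apply/negP => fEy.
  have all z : (val (f E) : _ -> bool) z.
    have [u uy] := A_surj y; have [v vz] := A_surj z.
    have shiftE w : @action (sieve_system R) w E = E by apply: val_inj.
    by rewrite -vz translate0 shiftE -(shiftE (- u)) -translate0 uy.
  have /set_mem/admissibleP/(_ q)[d dP] := valP (f E).
  have [s Ss] := Sq; have [k kP] := sieve_level S q.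
  have [a da] := adic_approx (s + d) k.
  apply: (dP a (all a)); apply: kP Ss.
  rewrite -[s in LHS](addrK d); exact: adic_levelD.
exists [set` N], TT; split.
- exact: finite_seq.
- have [X [y fXy]] := f_nonempty; have [x xy] := A_surj y.
  exists (pat (@action (sieve_system R) (- x) X)).
  by exists (@action (sieve_system R) (- x) X); rewrite // -translate0 xy.
- move=> _ [X -> fX]; split.
  + apply: contrapT => H; have := fE (A 0); rewrite (patE E X) ?fX //.
    apply/funext => u; rewrite /pat /= andbF; apply/esym/negP => pu.
    by apply: H; exists u.
  + by move=> u /andP[].
  + apply/admissibleP => p; have /set_mem/admissibleP/(_ p)[d dP] := valP X.
    by exists d => x /andP[_]; apply: dP.
- move=> x X; rewrite translate0; set Y := action _ X.
  have YE u : (val Y : _ -> bool) u = (val X : _ -> bool) (x + u).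
    by rewrite /Y /= /Defs.shift opprK addrC.
  split=> [fY|[T [Z -> fZ] e]].
    exists (pat Y); first by exists Y.
    apply/seteqP; split=> [v [Xv [u uN e]]|v [u /andP[uN Yu] e]].
      by exists u => //; apply/andP; split => //; rewrite YE e.
    by split; [rewrite -e; move: Yu; rewrite YE|exists u].
  rewrite (patE Y Z) //; apply/funext => u; rewrite /pat; apply: andb_id2l => uN.
  rewrite YE; apply/idP/idP => [Xu|Zu].
    have : ([set` (val X : _ -> bool)] `&` translate x [set` N]) (x + u) by split => //; exists u.
    by rewrite e => -[v /andP[_ Zv] /addrI <-].
  have : translate x [set` pat Z] (x + u) by exists u => //; apply/andP.
  by rewrite -e => -[].
Qed.
End LocalRule.

(** * Comparison of the sieves *)

Lemma sieve_diffP (K : etaleAlg) (R : sieve K) (T : set (integers K)) p r :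
  @sieve_diff K R T p r <-> exists2 t, T t & sieve_set R p (adic_of p t + r).
Proof.
split=> [[t Tt [x Rx <-]]|[t Tt Rr]].
  by exists t => //; rewrite addrA subrr add0r.
by exists t => //; exists (adic_of p t + r) => //; rewrite addrA addNr add0r.
Qed.

Lemma sieve_diff_level (K : etaleAlg) (R : sieve K) (T : set (integers K)) p k :
  level (sieve_set R p) k -> level (@sieve_diff K R T p) k.
Proof.
move=> kP x y e /sieve_diffP[t Tt Rx]; apply/sieve_diffP; exists t => //.
by apply: kP Rx; apply: adic_levelD.
Qed.

(* The subgroup generated by [d] is finite modulo m^k, so an inclusion of a clopen
   set in its translate is an equality. *)
Lemma level_shift (K : etaleAlg) (p : prime_of K) (S : set (adic p)) k d :
  level S k -> (forall y, S (adic_of p y) -> S (adic_of p (y + d))) ->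
  forall y, S (adic_of p (y + d)) -> S (adic_of p y).
Proof.
move=> kP sub y Sy; have [N N0 pN] := mexp_pos_nat p k.
have iter n z : S (adic_of p z) -> S (adic_of p (z + n%:R * d)).
  elim: n z => [|n IHn] z Sz; first by rewrite mul0r addr0.
  by rewrite -natr1 mulrDl mul1r addrA; apply/sub/IHn.
apply: (level_mem kP) (iter N.-1 _ Sy).
have -> : y + d + N.-1%:R * d - y = N%:R * d.
  by rewrite -[in RHS](prednK N0) -natr1; ring.
exact: mexpMr.
Qed.

Section Inclusion.
Variables (rT : realType) (K L : etaleAlg).
Variable measK : forall p : prime_of K, haar_measure rT p.
Variables (R : sieve K) (S : sieve L).
Hypothesis R_nonlarge : non_large measK R.
Variables (f : sieve_system R -> sieve_system S) (A : integers K -> integers L).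
Hypothesis A_add : {morph A : x y / x + y}.
Variables (Ml : seq (integers K)) (TT : set (integers K -> bool)).
Hypothesis ruleP : local_rule f A [set` Ml] TT.
Variables (p : prime_of K) (q : prime_of L).
Hypothesis A_exp : forall n x, mexp p n x -> mexp q n (A x).

(** If x + T avoided R_p for some pattern T, the Chinese remainder theorem would give x' close to x
    at p and harmless at the other relevant primes. Then A x' avoids the translate of S_q, and so
    does A x, which agrees with it modulo q^k. *)
Lemma sieve_inclusion : exists d, forall x, sieve_set S q (adic_of q (A x - d)) ->
  forall T, TT T -> exists2 t, T t & sieve_set R p (adic_of p (x + t)).
Proof.
have [s us avoid] := translate_avoidance R_nonlarge A_add ruleP q.
have [d dP] := avoid (fun p => 0); exists d => x Sx T tt; apply: contrapT => H.
have /choice[eR eRP] := sieve_level R; have [k kP] := sieve_level S q.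
have /choice[w wP] := fun p' => local_point ruleP p' tt.
pose c p' := if p' == p then x else w p'.
pose e p' := maxn (eR p') k.
have [x' x'P] := crt_solution e c (undup_uniq (p :: s)).
have x'p : mexp p (e p) (x' - x).
  by have := x'P p; rewrite mem_undup mem_head /c eqxx => /(_ isT).
apply: (dP x' T tt).
  move=> p' p's t Tt; rewrite subr0 => Rx'.
  have x'p' : mexp p' (eR p') (x' + t - (c p' + t)).
    have -> : x' + t - (c p' + t) = x' - c p' by ring.
    apply: (@mexp_le _ _ _ (e p')); first exact: leq_maxl.
    by apply: x'P; rewrite mem_undup inE p's orbT.
  have := level_mem (eRP p') x'p' Rx'; rewrite /c; case: eqP => [e'|_ ]; last exact: wP.
  by move: e' => -> in Rx' * => Rx; apply: H; exists t.
apply: (level_mem kP) Sx.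
have AN z : A (- z) = - A z.
  have A0 : A 0 = 0 by apply: (addrI (A 0)); rewrite -A_add !addr0.
  by apply: (addrI (A z)); rewrite -A_add !subrr.
have -> : A x - d - (A x' - d) = - A (x' - x) by rewrite A_add AN; ring.
apply: mexpN; apply: A_exp; apply: mexp_le x'p; exact: leq_maxr.
Qed.
End Inclusion.

Section Isomorphism.
Variables (K L : etaleAlg) (R : sieve K) (S : sieve L).
Hypothesis R_proper : forall p, sieve_set R p <> setT.
Variables (f : sieve_system R -> sieve_system S) (A : integers K -> integers L).
Hypothesis A_surj : forall y, exists x, A x = y.
Hypothesis f_inj : injective f.
Variables (Ml : seq (integers K)) (TT : set (integers K -> bool)).
Hypothesis ruleP : local_rule f A [set` Ml] TT.

Lemma proper_point p : exists x : integers K, ~ sieve_set R p (adic_of p x).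
Proof.
apply: contrapT => H; apply: (@R_proper p); apply/seteqP; split=> // x _.
have [k kP] := sieve_level R p; have [a ea] := adic_approx x k.
by apply: kP (esym ea) _; apply: contrapT => nR; apply: H; exists a.
Qed.

(* [f] maps the empty set to itself, so it maps a singleton to a non-empty set. *)
Lemma singleton_pattern : exists2 T, TT T & exists a, T a /\ forall t, T t -> t = a.
Proof.
have a1 : (fun u : integers K => u == 0) \in admissible R.
  apply/mem_set/admissibleP => p; have [x xP] := proper_point p.
  by exists (- adic_of p x) => u /eqP ->; rewrite opprK -adic_ofD add0r.
have a0 : (fun u : integers K => false) \in admissible R.
  by apply/mem_set/admissibleP => p; exists 0.
pose X1 : sieve_system R := exist _ (fun u : integers K => u == 0) a1.
pose X0 : sieve_system R := exist _ (fun u : integers K => false) a0.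
have f0 y : (val (f X0) : _ -> bool) y = false.
  have [x <-] := A_surj y; apply/negP => /(rule_elim ruleP)[T tt TE].
  have [t Tt] := rule_nonempty ruleP tt.
  by have := TE t (rule_supp ruleP tt Tt); rewrite Tt.
have [y fy] : exists y, (val (f X1) : _ -> bool) y.
  apply: contrapT => H; have e : f X1 = f X0.
    by apply: val_inj; apply/funext => y; rewrite f0; apply/negP => fy; apply: H; exists y.
  have := congr1 (fun X : sieve_system R => (val X : _ -> bool) 0) (f_inj e).
  by rewrite /= eqxx.
have [x xy] := A_surj y; rewrite -xy in fy.
have [T tt TE] := rule_elim ruleP fy; exists T => //; exists (- x).
have Tx t : T t -> t = - x.
  move=> Tt; have := TE t (rule_supp ruleP tt Tt); rewrite Tt => /eqP xt.
  by apply: (addrI x); rewrite xt subrr.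
by have [t Tt] := rule_nonempty ruleP tt; split=> //; rewrite -(Tx t Tt).
Qed.
End Isomorphism.

(** * Factor maps *)

Lemma distinct_choice (I P : eqType) (s : seq I) (F : I -> set P) (p0 : P) :
  uniq s -> (forall i, i \in s -> infinite_set (F i)) ->
  exists g : I -> P, (forall i, i \in s -> F i (g i)) /\ {in s &, injective g}.
Proof.
elim: s => [|i s IHs] /= => [_ _|/andP[nis us] Finf]; first by exists (fun=> p0).
have [g [gF gI]] := IHs us (fun j js => Finf j (@mem_behead _ (i :: s) j js)).
have [p Fp ps] : exists2 p, F i p & p \notin map g s.
  apply: contrapT => H; apply: (Finf i (mem_head _ _)).
  apply: (@sub_finite_set _ _ [set` map g s]); last exact: finite_seq.
  by move=> p Fp; apply: contrapT => /negP ps; apply: H; exists p.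
exists (fun j => if j == i then p else g j); split=> [j|j k].
  by rewrite inE; have [->|_] := eqVneq j i => //= /gF.
rewrite !inE; have [->|ji] := eqVneq j i; have [->|ki] := eqVneq k i => //=.
- by move=> _ ks e; move: ps; rewrite e map_f.
- by move=> js _ e; move: ps; rewrite -e map_f.
- exact: gI.
Qed.

Lemma finite_patterns (T : choiceType) (s : seq T) (TT : set (T -> bool)) :
  (forall P x, TT P -> P x -> x \in s) -> finite_set TT.
Proof.
move=> sup; apply: (@sub_finite_set _ _
  ((fun g : {ffun 'I_(size s) -> bool} => (fun x => if insub (index x s) is Some i then g i else false)) @` setT)).
  move=> P TP; exists [ffun i : 'I_(size s) => P (tnth (in_tuple s) i)] => //.
  apply/funext => x; case: insubP => [i _ ei|]; last first.
    by rewrite -leqNgt => le; apply/esym/negP => /(sup P x TP); rewrite -index_mem ltnNge le.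
  rewrite ffunE (tnth_nth x) /= ei nth_index // -index_mem -ei; exact: ltn_ord.
exact/finite_image/finite_finset.
Qed.

Section FactorMap.
Variables (rT : realType) (K L : etaleAlg).
Variable measK : forall p : prime_of K, haar_measure rT p.
Variable measL : forall p : prime_of L, haar_measure rT p.
Variables (R : sieve K) (S : sieve L).
Hypotheses (R_nonlarge : non_large measK R) (S_nonlarge : non_large measL S).
Variables (f : sieve_system R -> sieve_system S).
Variables (A : integers K -> integers L) (B : integers L -> integers K).
Hypotheses (A_add : {morph A : x y / x + y}) (AK : cancel A B) (BK : cancel B A).
Variables (Ml : seq (integers K)) (TT : set (integers K -> bool)).
Hypothesis ruleP : local_rule f A [set` Ml] TT.
Variable tauP : prime_of K -> prime_of L.
Hypothesis tauP_inj : injective tauP.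
Hypothesis A_exp : forall p n x, mexp p n x -> mexp (tauP p) n (A x).
Hypothesis B_exp : forall p n y, mexp (tauP p) n y -> mexp p n (B y).
Hypothesis f_surj : forall Y, exists X, f X = Y.

(* [S (tauP p)] is a translate of the image under [A] of [-T + R p]. *)
Definition translate_rule (T : integers K -> bool) p := exists u, forall x,
  sieve_set S (tauP p) (adic_of (tauP p) (A x + u)) <->
  exists2 t, T t & sieve_set R p (adic_of p (x + t)).

(** Without such a point, some translate of the image of -T + R_p would lie in S. The opposite
    inclusion, up to translation, is [sieve_inclusion], and the two together force equality. *)
Lemma not_translate_rule T p (delta : adic p) : TT T -> ~ translate_rule T p ->
  exists a, ~ sieve_set S (tauP p) (adic_of (tauP p) (A a)) /\
    exists2 t, T t & sieve_set R p (adic_of p (a + t) - delta).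
Proof.
move=> tt bad; apply: contrapT => H; apply: bad.
have [e eP] := sieve_level R p; have [k kP] := sieve_level S (tauP p).
have [c cd] := adic_approx delta e.
have [d dP] := sieve_inclusion R_nonlarge A_add ruleP (@A_exp p).
have RS x t : T t -> sieve_set R p (adic_of p (x + t)) ->
    sieve_set S (tauP p) (adic_of (tauP p) (A x - d + (d + A c))).
  move=> Tt Rx; apply: contrapT => nS; apply: H; exists (x + c); split.
    by rewrite A_add; apply: contra_not nS; rewrite addrA subrK.
  exists t => //; apply: eP Rx.
  have -> : x + t = x + c + t - c by ring.
  by rewrite adic_ofB; apply: adic_levelD => //; apply: adic_levelN.
exists (- d) => x; split=> [Sx|[t' Tt' /(RS x t' Tt')]]; first exact: (dP x Sx T tt).
apply: (level_shift kP) => y Sy.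
have ey : y = A (B (y + d)) - d by rewrite BK addrK.
by rewrite ey in Sy *; have [t Tt Rt] := dP _ Sy T tt; apply: RS Rt.
Qed.

(* If every [T] fails at infinitely many primes, pick distinct primes [p_ T] and a preimage under
   [f] of the finite set of [y c], for [c] in the product over [T] of the complements of [S (tauP (p_ T))].
   Each [y c] selects a pattern [T]; by a diagonal argument the points selecting some fixed [T]
   cover the whole complement at [p_ T]. *)
Lemma factor_map_rule : exists2 T, TT T & finite_set [set p | ~ translate_rule T p].
Proof.
apply: contrapT => H.
have inf T : TT T -> infinite_set [set p | ~ translate_rule T p].
  by move=> tt fin; apply: H; exists T.
have /finite_seqP[TTl0 TTE] : finite_set TT by apply: finite_patterns => P x /(rule_supp ruleP); apply.
pose TTl := undup TTl0.
have TTlP T : T \in TTl <-> TT T by rewrite mem_undup TTE.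
have [T0 tt0] : TT !=set0 by case: ruleP.
have [p00 _] : exists p : prime_of K, True.
  by have [p] := prime_above_nat K (isT : prime 2); exists p.
have [||g [gF gI]] := @distinct_choice _ _ TTl (fun T => [set p | ~ translate_rule T p]) p00.
- exact: undup_uniq.
- by move=> T /TTlP/inf.
pose r := size TTl; pose T_ (i : 'I_r) := tnth (in_tuple TTl) i.
have T_in i : T_ i \in TTl by apply: mem_tnth.
have T_TT i : TT (T_ i) by apply/TTlP.
pose p_ i := g (T_ i).
have p_inj : injective p_.
  move=> i j /(gI _ _ (T_in i) (T_in j)) e; apply/val_inj/eqP => /=.
  rewrite -(nth_uniq T0 (ltn_ord i) (ltn_ord j) (undup_uniq _)).
  by move: e; rewrite /T_ !(tnth_nth T0) /= => ->.
pose q_ i := tauP (p_ i).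
have q_inj : injective q_ by move=> i j /tauP_inj/p_inj.
have /choice[eR eRP] := sieve_level R; have /choice[eS eSP] := sieve_level S.
have S_proper : forall q, sieve_set S q <> setT by case: S_nonlarge.
have /choice[w wP] := proper_point S_proper.
pose e := \max_(i : 'I_r) maxn (eR (p_ i)) (eS (q_ i)).
have eRe i : (eR (p_ i) <= e)%N.
  by apply: leq_trans (leq_bigmax i); apply: leq_maxl.
have eSe i : (eS (q_ i) <= e)%N.
  by apply: leq_trans (leq_bigmax i); apply: leq_maxr.
have /choice[rp rpP] := fun i => mexp_reps (p_ i) e.
pose N := (\max_(i : 'I_r) size (rp i)).
(* A list of classes modulo p_i^e whose images avoid S at q_i: a representative whose image lies in
   S is replaced by a default point outside, so every index is usable. The list exhausts the
   complement of S. *)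
pose rho i (j : 'I_N.+1) : integers K := let x := nth 0 (rp i) j in
  if `[< sieve_set S (q_ i) (adic_of (q_ i) (A x)) >] then B (w (q_ i)) else x.
have rho_notin i j : ~ sieve_set S (q_ i) (adic_of (q_ i) (A (rho i j))).
  by rewrite /rho; case: asboolP => // _; rewrite BK; apply: wP.
have rho_cover i a : ~ sieve_set S (q_ i) (adic_of (q_ i) (A a)) ->
    exists j, mexp (p_ i) e (a - rho i j).
  move=> Sa; have [x xr xa] := rpP i a.
  have xN : (index x (rp i) < N.+1)%N.
    rewrite ltnS; apply: leq_trans (leq_bigmax i); exact: index_size.
  exists (Ordinal xN); rewrite /rho /= nth_index //; case: asboolP => // Sx; case: Sa.
  apply: (level_mem (@eSP (q_ i))) Sx; apply: (mexp_le (eSe i)).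
  have -> : A x - A a = A (- (a - x)).
    by apply: (addIr (A a)); rewrite -A_add subrK; congr A; ring.
  exact/A_exp/mexpN.
pose C : finType := {ffun 'I_r -> 'I_N.+1}.
have [s1 s1P] := small_primes #|C| S_nonlarge.
pose Q := undup (s1 ++ [seq q_ i | i <- enum 'I_r]).
(* At each q_i the class prescribed by [c]; at other primes any point outside S, so that all the y c
   avoid S_q itself there. *)
pose target (c : C) (q : prime_of L) : integers L :=
  if [pick i | q == q_ i] is Some i then A (rho i (c i)) else w q.
have targetE c i : target c (q_ i) = A (rho i (c i)).
  rewrite /target; case: pickP => [j /eqP/q_inj <-//|/(_ i)]; by rewrite eqxx.
have target_notin c q : ~ sieve_set S q (adic_of q (target c q)).
  by rewrite /target; case: pickP => [i /eqP -> //|_]; apply: wP.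
have /choice[y yP] := fun c : C => crt_solution (fun q => maxn (eS q) e) (target c) (undup_uniq (s1 ++ [seq q_ i | i <- enum 'I_r])).
have aY : (fun u => u \in [seq y c | c <- enum C]) \in admissible S.
  apply/mem_set/admissibleP => q; have [qQ|qQ] := boolP (q \in Q).
    exists 0 => u /mapP[c _ ->]; rewrite subr0; apply: contra_not (target_notin c q).
    apply: (level_mem (@eSP q)); apply: (mexp_le (leq_maxl _ e)); exact: yP.
  have [|d dP] := @seq_avoid L S q [seq y c | c <- enum C]; last by exists d => u uE; apply: dP.
  rewrite size_map -cardE; apply: s1P; apply: contra qQ => qs.
  by rewrite mem_undup mem_cat qs.
pose Y : sieve_system S := exist _ (fun u => u \in [seq y c | c <- enum C]) aY.
have [X XY] := f_surj Y.
have /choice[kap kapP] : forall c : C, exists i : 'I_r, forall t, T_ i t -> (val X : _ -> bool) (B (y c) + t).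
  move=> c; have : (val (f X) : _ -> bool) (A (B (y c))).
    by rewrite XY BK /=; apply/map_f/mem_enum.
  move=> /(rule_elim ruleP)[T tt TE].
  have /seq_tnthP[i Ti] : T \in TTl by apply/TTlP.
  exists i => t; rewrite /T_ -Ti => Tt.
  by rewrite TE // (rule_supp ruleP tt).
have /set_mem/admissibleP XR := valP X.
have /choice[a aP] : forall i : 'I_r, exists a, exists delta : adic (p_ i),
   [/\ forall x, (val X : _ -> bool) x -> ~ sieve_set R (p_ i) (adic_of (p_ i) x - delta),
     ~ sieve_set S (q_ i) (adic_of (q_ i) (A a)) &
     exists2 t, T_ i t & sieve_set R (p_ i) (adic_of (p_ i) (a + t) - delta)].
  move=> i; have [delta dP] := XR (p_ i).
  have [a [a1 a2]] := not_translate_rule delta (T_TT i) (gF _ (T_in i)).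
  by exists a, delta.
have /choice[j jP] : forall i, exists j, mexp (p_ i) e (a i - rho i j).
  by move=> i; apply: rho_cover; have [d []] := aP i.
(* The diagonal choice: [c] records at every i the class of the point [a i] where T_i meets the
   avoided translate. Whichever i is selected for y c, the translate of T_i placed in X meets the
   translate of R that X avoids. *)
pose c : C := [ffun i => j i]; pose i := kap c.
have [delta [Xd _ [t Tt Rt]]] := aP i.
apply: (Xd _ (kapP c t Tt)); move: Rt; apply: eRP; apply: adic_levelD => //.
apply/adic_ofE; apply: (mexp_le (eRe i)).
have -> : a i + t - (B (y c) + t) = (a i - rho i (j i)) - (B (y c) - rho i (j i)) by ring.
apply: mexpB => //.
have BN u v : B (u - v) = B u - B v.
  by apply: (can_inj AK); rewrite BK; apply: (addIr (A (B v))); rewrite -A_add subrK !BK subrK.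
have -> : B (y c) - rho i (j i) = B (y c - target c (q_ i)).
  by rewrite BN targetE AK ffunE.
apply: B_exp; apply: (mexp_le (leq_maxr (eS (q_ i)) e)); apply: yP.
by rewrite mem_undup mem_cat map_f ?orbT // mem_enum.
Qed.
End FactorMap.

(** * Proof of the theorem *)

Lemma nonempty_prime (K : etaleAlg) (R : sieve K) : cofinite_sieve R ->
  exists p, sieve_set R p !=set0.
Proof.
move=> /finite_seqP[s sE]; have [B BP] := large_prime_notin s.
have [l Bl pl] := prime_above B; have [p pl1] := prime_above_nat K pl.
exists p; apply/set0P/eqP => Rp; apply: (BP l pl Bl p) pl1.
by have : [set q | sieve_set R q = set0] p by []; rewrite sE.
Qed.

Section Conclusions.
Variables (rT : realType) (K L : etaleAlg).
Variable measK : forall p : prime_of K, haar_measure rT p.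
Variable measL : forall p : prime_of L, haar_measure rT p.
Variables (R : sieve K) (S : sieve L).
Hypotheses (R_nonlarge : non_large measK R) (S_nonlarge : non_large measL S).
Hypothesis R_cofinite : cofinite_sieve R.
Variables (f : sieve_system R -> sieve_system S).
Variables (A : integers K -> integers L) (B : integers L -> integers K).
Hypothesis fA : @is_morphism (sieve_system R) (sieve_system S) f A.
Hypotheses (AK : cancel A B) (BK : cancel B A).
Variables (Ml : seq (integers K)) (TT : set (integers K -> bool)).
Hypothesis ruleP : local_rule f A [set` Ml] TT.
Variables (p : prime_of K) (q : prime_of L).
Hypothesis A_exp : forall n x, mexp p n x -> mexp q n (A x).
Hypothesis B_exp : forall n y, mexp q n y -> mexp p n (B y).
Variables (Ah : adic p -> adic q) (Bh : adic q -> adic p).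
Hypothesis AhP : forall (x : adic p) n a, x n = adic_of p a n -> Ah x n = adic_of q (A a) n.
Hypothesis BhK : cancel Bh Ah.

Let A_add : {morph A : x y / x + y}. Proof. by case: fA. Qed.

Let AN x : A (- x) = - A x.
Proof.
have A0 : A 0 = 0 by apply: (addrI (A 0)); rewrite -A_add !addr0.
by apply: (addrI (A x)); rewrite -A_add !subrr.
Qed.

Lemma sieve_subset_translate : exists d : adic q,
  sieve_set S q `<=` translate d (Ah @` \bigcap_(T in TT) @sieve_diff K R [set` T] p).
Proof.
have [d dP] := sieve_inclusion R_nonlarge A_add ruleP A_exp.
have [e eP] := sieve_level R p; have [k kP] := sieve_level S q.
exists (- adic_of q d) => s Ss; apply/translateP; rewrite opprK.
exists (Bh (s + adic_of q d)); last exact: BhK.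
set r := Bh _ => T tt; have [x ex] := adic_approx r (maxn e k).
have er : adic_of p x e = r e by apply/esym; apply: adic_eq_le ex; apply: leq_maxl.
have kr : r k = adic_of p x k by apply: adic_eq_le ex; apply: leq_maxr.
have [|t Tt Rt] := dP x _ T tt.
  apply: kP Ss; rewrite adic_ofB -[s in LHS](addrK (adic_of q d)); apply: adic_levelD => //.
  by rewrite -(BhK (s + adic_of q d)); apply: AhP.
apply: (@sieve_diff_level _ _ [set` T] _ _ eP _ _ er); apply/sieve_diffP; exists t => //.
by rewrite -adic_ofD addrC.
Qed.

Lemma translate_of_rule (T : integers K -> bool) u :
  (forall x, sieve_set S q (adic_of q (A x + u)) <->
     exists2 t, T t & sieve_set R p (adic_of p (x + t))) ->
  is_translate (Ah @` @sieve_diff K R [set` T] p) (sieve_set S q).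
Proof.
move=> H; have [e eP] := sieve_level R p; have [k kP] := sieve_level S q.
exists (adic_of q u).
apply: (translate_of AhP BhK kP (@sieve_diff_level _ _ [set` T] _ _ eP)) => x.
split=> [/H[t Tt Rt]|/sieve_diffP[t Tt Rt]].
  by apply/sieve_diffP; exists t => //; rewrite -adic_ofD addrC.
by apply/H; exists t => //; rewrite addrC adic_ofD.
Qed.

Hypothesis S_cofinite : cofinite_sieve S.

(** The inverse is a morphism with a local rule of its own. Singleton patterns on both sides turn
    the two inclusions into R inside a translate of S and S inside a translate of R, under [A]. *)
Lemma isomorphism_translate : @is_isomorphism (sieve_system R) (sieve_system S) f A ->
  is_translate (Ah @` sieve_set R p) (sieve_set S q).
Proof.
case=> _ _ [f' [fK f'K f'_cont]].
have B_add : {morph B : x y / x + y}.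
  by move=> x y; apply: (can_inj AK); rewrite A_add !BK.
have fB : @is_morphism (sieve_system S) (sieve_system R) f' B.
  split=> // g X; apply: (can_inj fK); have [_ _ eqv] := fA.
  by rewrite f'K eqv f'K BK.
have A_surj y : exists x, A x = y by exists (B y).
have B_surj x : exists y, B y = x by exists (A x).
have R_proper : forall p, sieve_set R p <> setT by case: R_nonlarge.
have S_proper : forall p, sieve_set S p <> setT by case: S_nonlarge.
have [T tt [a [Ta aT]]] := singleton_pattern R_proper A_surj (can_inj fK) ruleP.
have [p0 Rp0] := nonempty_prime R_cofinite.
have [|M' [TT' rule']] := local_rule_exists fB B_surj _ Rp0.
  exists (f (exist _ T (mem_set (rule_adm ruleP tt)) : sieve_system R)), a.
  by rewrite fK.
have [Ml' M'E] : exists s : seq (integers L), M' = [set` s].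
  by have [/finite_seqP] := rule'.
rewrite M'E in rule'.
have [T' tt' [b [Tb bT]]] := singleton_pattern S_proper B_surj (can_inj f'K) rule'.
have [d dP] := sieve_inclusion R_nonlarge A_add ruleP A_exp.
have [c cP] := sieve_inclusion S_nonlarge B_add rule' B_exp.
have [e eP] := sieve_level R p; have [k kP] := sieve_level S q.
have SR x : sieve_set S q (adic_of q (A x - A a - d)) -> sieve_set R p (adic_of p x).
  rewrite -AN -A_add => Sx; have [t /aT -> Rt] := dP _ Sx T tt.
  by rewrite -(subrK a x).
have RS x : sieve_set R p (adic_of p x) ->
    sieve_set S q (adic_of q (A x - A a - d + (A c + b + A a + d))).
  move=> Rx; have Rx' : sieve_set R p (adic_of p (B (A (x + c)) - c)) by rewrite AK addrK.
  have [t /bT -> St] := cP _ Rx' T' tt'.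
  by have -> : A x - A a - d + (A c + b + A a + d) = A (x + c) + b by rewrite A_add; ring.
exists (adic_of q (- A a - d)); apply: (translate_of AhP BhK kP eP) => x.
(* [SR] followed by [RS] maps S into a translate of itself, so this translation preserves S and can
   be undone. *)
rewrite addrA; split=> [/SR//|/RS]; apply: (level_shift kP) => y Sy.
have ey : y = A (B (y + A a + d)) - A a - d by rewrite BK; ring.
by rewrite ey; apply: RS; apply: SR; rewrite -ey.
Qed.

End Conclusions.

Theorem theorem5p7 (rT : realType) (K L : etaleAlg)
    (measK : forall p : prime_of K, haar_measure rT p)
    (measL : forall q : prime_of L, haar_measure rT q)
    (R : sieve K) (S : sieve L)
    (R_nonlarge : non_large measK R) (R_cofinite : cofinite_sieve R)
    (S_nonlarge : non_large measL S) (S_cofinite : cofinite_sieve S)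
    (f : sieve_system R -> sieve_system S) (A : integers K -> integers L)
    (fA_morphism : @is_morphism (sieve_system R) (sieve_system S) f A)
    (A_surjective : forall y, exists x, A x = y)
    (f_nonempty : exists (X : sieve_system R) (y : integers L), val (f X) y) :
  (exists M TT, local_rule f A M TT) /\
  forall (M : set (integers K)) (TT : set (integers K -> bool)),
    local_rule f A M TT ->
    exists (tau : {lrmorphism K -> L}) (eps : integers L)
      (tauP : prime_of K -> prime_of L)
      (Ahat : forall p : prime_of K, adic p -> adic (tauP p)),
    [/\ [/\ bijective tau,
            exists eps' : integers L, eps * eps' = 1,
            forall x : integers K,
              etale_val (A x) = etale_val eps * tau (etale_val x) &
            bijective A],
        forall p, is_prime_image tau p (tauP p),
        forall p, extends_to_completion A (Ahat p) /\ bijective (Ahat p) &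
    [/\ forall p, exists d : adic (tauP p),
          S (tauP p) `<=`
          translate d (Ahat p @` \bigcap_(T in TT) sieve_diff R [set` T] p),
        @is_isomorphism (sieve_system R) (sieve_system S) f A ->
          forall p, is_translate (Ahat p @` R p) (S (tauP p)) &
        @is_factor_map (sieve_system R) (sieve_system S) f A ->
          exists2 T, TT T &
            finite_set (~` [set p : prime_of K |
              is_translate (Ahat p @` sieve_diff R [set` T] p)
                           (S (tauP p))])]].
Proof.
have [A_add _ _] := fA_morphism.
split=> [|M TT ruleP].
  have [q Sq] := nonempty_prime S_cofinite.
  exact: (local_rule_exists fA_morphism A_surjective f_nonempty Sq).
have [Ml ME] : exists s : seq (integers K), M = [set` s].
  by have [/finite_seqP] := ruleP.
rewrite ME in ruleP; have A_inj := morphism_injective fA_morphism ruleP.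
have /choice[B BK] := A_surjective.
have AK : cancel A B by move=> x; apply: A_inj; rewrite BK.
have A_mul := image_mul R_nonlarge fA_morphism A_surjective ruleP S_cofinite.
have [e eP] := image1_unit R_nonlarge fA_morphism A_surjective ruleP S_cofinite.
pose t := normalized A e; pose t' := normalized_inv A B.
have tK : cancel t t' := normalizedK AK eP.
have t'K : cancel t' t := normalized_invK BK eP.
have [tau tauE] := tau_exists (normalized_add A_add e) (normalized_mul A_mul eP) (normalized1 eP).
have [tau' tau'E] := tau_exists (normalized_inv_add A_add AK BK eP)
  (normalized_inv_mul AK BK A_mul eP) (normalized_inv1 AK eP).
have /choice[tauP tauPE] := image_prime_exists A_add AK BK A_mul eP.
have A_exp p n x := transfer_mexp A_add AK A_mul eP (tauPE p) (n := n) (x := x).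
have B_exp p n y := transfer_mexp_inv A_add AK BK A_mul eP (tauPE p) (n := n) (y := y).
have B_add : {morph B : x y / x + y} by move=> x y; apply: A_inj; rewrite A_add !BK.
pose Ahat p := projT1 (cid (adic_map_exists A_add (A_exp p))).
have AhatP p := projT2 (cid (adic_map_exists A_add (A_exp p))).
pose Bhat p := projT1 (cid (adic_map_exists B_add (B_exp p))).
have BhatP p := projT2 (cid (adic_map_exists B_add (B_exp p))).
have AhK p : cancel (Ahat p) (Bhat p) := adic_map_cancel (AhatP p) (BhatP p) AK.
have BhK p : cancel (Bhat p) (Ahat p) := adic_map_cancel (BhatP p) (AhatP p) BK.
have tauP_inj : injective tauP.
  move=> p p' pp; apply: maxideal_ext => x px.
  have tauPE' r y : tauP r y = r (t' y) by apply: tauPE.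
  by rewrite -(tK x) -tauPE' -pp tauPE' tK.
(* As tau extends A divided by [A 1], the unit is [A 1]. *)
exists tau, (A 1), tauP, Ahat; split.
- split; last by exists B.
  + by exists tau'; [apply: tau_cancel tauE tau'E tK|apply: tau_cancel tau'E tauE t'K].
  + by exists e.
  + move=> x; rewrite tauE -[RHS]/(etale_val (A 1 * normalized A e x)).
    by rewrite /normalized mulrA eP mul1r.
- move=> p y; rewrite tauPE; split=> [py|[x px /esym]].
    by exists (t' y) => //; rewrite tauE; congr etale_val; apply/esym/t'K.
  rewrite tauE => /val_inj <-.
  by have -> : normalized_inv A B (normalized A e x) = x by apply: tK.
- move=> p; split; last by exists (Bhat p).
  by split; [apply: adic_map_continuous (AhatP p)|apply: adic_map_of (AhatP p)].
split.
- move=> p; exact: (sieve_subset_translate R_nonlarge fA_morphism ruleP (@A_exp p) (AhatP p) (@BhK p)).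
- move=> iso p; exact: (isomorphism_translate R_nonlarge S_nonlarge R_cofinite fA_morphism
    AK BK ruleP (@A_exp p) (@B_exp p) (AhatP p) (@BhK p)).
- case=> _ _ f_surj.
  have [T tt fin] := factor_map_rule R_nonlarge S_nonlarge A_add AK BK ruleP tauP_inj A_exp B_exp f_surj.
  exists T => //; apply: sub_finite_set fin => p; apply: contra_not => -[u uP].
  exact: (translate_of_rule (AhatP p) (@BhK p) uP).
Qed.
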